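(* Let $r=p/q$, where $p$ is a complex polynomial of degree $d$ with simple roots $\lambda_1,\dots,\lambda_d$, and $q$ is a complex polynomial with $\deg q<d$ and $q(\lambda_j)\ne0$ for all $j$. Let $R\ge0$ be such that $\{z:|r(z)|=R\}$ contains no critical points of $r$, and let $C(r,R)$ be a constant such that for all $f=(f_1,\dots,f_d)$ with components $f_j$ holomorphic in $|w|\le R$, $$\sup_{|w|\le R}\ \max_{1\le j\le d}|f_j(w)|\le C(r,R)\sup_{|r(z)|\le R}\Big|\sum_{j=1}^d\delta_j(z)f_j(r(z))\Big| .$$ Suppose $A$ is a bounded operator in a complex Hilbert space, whose spectrum contains no pole of $r$, such that $\|r(A)\|\le R$. If $\varphi$ is holomorphic in $V_r(R)=\{z\in\mathbb{C}:|r(z)|\le R\}$, then $$\|\varphi(A)\|\le K\sup_{V_r(R)}|\varphi|,\qquad\text{where } K=C(r,R)\sum_{j=1}^d\|\delta_j(A)\| .$$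
   Context: For $j=1,\dots,d$, $\delta_j(z)=\dfrac{r(z)}{r'(\lambda_j)(z-\lambda_j)}$, with the removable singularity at $\lambda_j$ removed; its poles are among the poles of $r$. At poles of $r$ one sets $|r|=\infty$. A function is holomorphic in a compact set if it is holomorphic in some open neighborhood of it. The operators $r(A)$, $\delta_j(A)$, $\varphi(A)$ are defined by the holomorphic functional calculus (note $\|r(A)\|\le R$ implies $\sigma(A)\subset V_r(R)$). A constant $C(r,R)$ as in the claim, depending only on $r$ and $R$, exists. *)

(* Defs.v *)
From HB Require Import structures.
From mathcomp Require Import all_boot all_order all_algebra.
From mathcomp Require Import sesquilinear complex.
From mathcomp Require Import all_classical all_reals all_analysis.

Set Implicit Arguments.
Unset Strict Implicit.
Unset Printing Implicit Defensive.

Import Order.TTheory GRing.Theory Num.Theory.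
Import numFieldNormedType.Exports.

Local Open Scope classical_set_scope.
Local Open Scope ring_scope.
Local Open Scope complex_scope.

(* R[i] gets the topology and the normed module structure over itself that
   every numFieldType carries. *)
HB.instance Definition _ (R : realType) :=
  NormedModule.copy R[i] (R[i] : numFieldType).

(* Norms of normed spaces over R[i] are R[i]-valued (with values on the
   nonnegative real half-line); rnorm is the same number as an element of R. *)
Definition rnorm (R : realType) (V : normedModType R[i]) (x : V) : R :=
  complex.Re `|x|.

Definition sup_on (R : realType) (S : set R[i]) (f : R[i] -> R[i]) : R :=
  sup [set rnorm (f z) | z in S].

Definition cdisc (R : realType) (rho : R) : set R[i] :=
  [set w | rnorm w <= rho].

Definition holomorphic_on (R : realType) (U : set R[i]) (f : R[i] -> R[i]) :=
  forall z, U z -> derivable f z 1.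

Definition holomorphic_in (R : realType) (K : set R[i]) (f : R[i] -> R[i]) :=
  exists U : set R[i], [/\ open U, K `<=` U & holomorphic_on U f].

(* p / q, with the junk value 0 at the zeros of q: conditions on |r| below
   therefore have to exclude these points, where |r| = oo. *)
Definition ratfun (R : realType) (p q : {poly R[i]}) (z : R[i]) : R[i] :=
  p.[z] / q.[z].

(* V_r(rho) *)
Definition lemniscate (R : realType) (p q : {poly R[i]}) (rho : R) :
    set R[i] :=
  [set z | q.[z] != 0 /\ rnorm (ratfun p q z) <= rho].

Definition no_critical_point (R : realType) (p q : {poly R[i]}) (rho : R) :=
  forall z : R[i], q.[z] != 0 -> rnorm (ratfun p q z) = rho ->
    derive1 (ratfun p q) z != 0.

(* delta_j for l = lambda_j; since r l = 0, its limit at l is 1. *)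
Definition delta (R : realType) (p q : {poly R[i]}) (l z : R[i]) : R[i] :=
  if z == l then 1
  else ratfun p q z / (derive1 (ratfun p q) l * (z - l)).

(* c is admissible as the constant C(r, rho). *)
Definition multicentric_const (R : realType) (d : nat) (p q : {poly R[i]})
    (lambda : 'I_d -> R[i]) (rho c : R) :=
  forall f : 'I_d -> R[i] -> R[i],
    (forall j, holomorphic_in (cdisc rho) (f j)) ->
    sup [set \big[Num.max/0]_(j < d) rnorm (f j w) | w in cdisc rho] <=
    c * sup_on (lemniscate p q rho)
          (fun z => \sum_(j < d) delta p q (lambda j) z * f j (ratfun p q z)).

Definition opnorm (R : realType) (V : normedModType R[i])
    (T : {linear V -> V}) : R :=
  sup [set rnorm (T x) | x in [set x : V | rnorm x <= 1]].

(* B is a bounded two-sided inverse of z - A; for linear maps, bounded is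
   spelled continuous (see linear_bounded_continuous). *)
Definition is_resolvent (R : realType) (V : normedModType R[i])
    (A : {linear V -> V}) (z : R[i]) (B : {linear V -> V}) :=
  [/\ continuous B,
      forall x : V, B (z *: x - A x) = x &
      forall x : V, z *: B x - A (B x) = x].

Definition resolvent (R : realType) (V : normedModType R[i])
    (A : {linear V -> V}) (z : R[i]) : {linear V -> V} :=
  get (is_resolvent A z).

Definition spectrum (R : realType) (V : normedModType R[i])
    (A : {linear V -> V}) : set R[i] :=
  [set z | ~ exists B, is_resolvent A z B].

(* A contour is a finite family of oriented line segments, each given by its
   end points. *)
Definition contour (R : realType) := seq (R[i] * R[i]).

Definition segment_pt (R : realType) (e : R[i] * R[i]) (t : R) : R[i] :=
  e.1 + t%:C * (e.2 - e.1).

Definition integral01 (R : realType) (g : R -> R[i]) : R[i] :=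
  (\int[lebesgue_measure]_(t in `[0%R, 1%R]) complex.Re (g t)) +i*
  (\int[lebesgue_measure]_(t in `[0%R, 1%R]) complex.Im (g t)).

Definition contour_integral (R : realType) (G : contour R)
    (g : R[i] -> R[i]) : R[i] :=
  \sum_(e <- G) (e.2 - e.1) * integral01 (fun t => g (segment_pt e t)).

Definition winding_index (R : realType) (G : contour R) (z : R[i]) : R[i] :=
  ((2 * pi)%:C * 'i)^-1 * contour_integral G (fun w => (w - z)^-1).

(* G is a contour in U \ K surrounding K in U. The first clause says that the
   chain of segments has zero boundary. *)
Definition surrounds (R : realType) (G : contour R) (K U : set R[i]) :=
  [/\ perm_eq [seq e.1 | e <- G] [seq e.2 | e <- G],
      forall e, e \in G -> forall t : R, 0 <= t <= 1 ->
        U (segment_pt e t) /\ ~ K (segment_pt e t),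
      forall z, K z -> winding_index G z = 1 &
      forall z, ~ U z -> winding_index G z = 0].

(* Riesz-Dunford: T = (2 i pi)^-1 \int_G f(z) (z - A)^-1 dz, the
   operator-valued integral being tested against the inner product. The
   operator does not depend on the choice of U and G. *)
Definition is_hfc (R : realType) (V : normedModType R[i])
    (ip : {dot V for Num.conj}) (A : {linear V -> V}) (f : R[i] -> R[i])
    (T : {linear V -> V}) :=
  continuous T /\
  exists (U : set R[i]) (G : contour R),
    [/\ open U, spectrum A `<=` U, holomorphic_on U f,
        surrounds G (spectrum A) U &
        forall x y : V, ip (T x) y =
          ((2 * pi)%:C * 'i)^-1 *
          contour_integral G (fun z => f z * ip (resolvent A z x) y)].

(* f(A) *)
Definition hfc (R : realType) (V : normedModType R[i])
    (ip : {dot V for Num.conj}) (A : {linear V -> V}) (f : R[i] -> R[i]) :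
    {linear V -> V} :=
  get (is_hfc ip A f).

(* Main.v *)
Require Import Defs.
From HB Require Import structures.
From mathcomp Require Import all_boot all_order all_algebra.
From mathcomp Require Import sesquilinear complex.
From mathcomp Require Import all_classical all_reals all_analysis.
Set Implicit Arguments.
Unset Strict Implicit.
Unset Printing Implicit Defensive.
Import Order.TTheory GRing.Theory Num.Theory.
Import numFieldNormedType.Exports.
Local Open Scope classical_set_scope.
Local Open Scope ring_scope.
Local Open Scope complex_scope.
From mathcomp Require Import separable.
From mathcomp Require cyclic cyclotomic.
From mathcomp Require Import ring lra zify.

(** For r(z) = z the bound is von Neumann's inequality; the general case is
reduced to it by expanding phi in powers of r, with the delta_j as
coefficients.

Let G be a contour around the lemniscate VR = {|r| <= rho}, inside the domain
of phi and away from the poles of r; on G one has |r| >= rho1 > rho.  Lagrange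
interpolation at the roots of p gives (delta_partial_fractions)
  sum_j delta_j(z) / (w - lambda_j) = (1 - r(z) / r(w)) / (w - z).
Multiplied by (r(z) / r(w))^k and summed over k < N, the right side
telescopes to 1 / (w - z), up to an error of order (rho / rho1)^N for w on G
and z in VR.  Integrated against phi along G, this provides polynomials P_jN
(approximant) such that sum_j delta_j P_jN(r) tends to phi uniformly on VR
(approximant_lemniscate).

The same identity holds with r(A), delta_j(A) and the resolvent of A in place
of r(z), delta_j(z) and 1 / (w - z) (partial_fractions_op).  It shows that
the spectrum of A lies in VR (spectrum_sub_lemniscate), so that phi(A) can be
computed along G, and then that sum_j delta_j(A) P_jN(r(A)) tends weakly to
phi(A) (approximant_op).  The constant c, applied to the functions P_jN,
bounds them by c (sup |phi| + o(1)) on the disc of radius rho; von Neumann's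
inequality turns this into a bound of the operators P_jN(r(A)), and hfc_bound
lets N tend to infinity.

Three classical facts carry the argument.  Cauchy's formula holds for a grid
contour around any compact set (grid_contour).  Cauchy's theorem in its
homology form (homology_cauchy) makes contour integrals depend only on winding
numbers; it gives the independence of the functional calculus from the contour
and identifies r(A) and the delta_j(A) with quotients of polynomials in A
(hfc_ratio).  Von Neumann's inequality for polynomials (von_neumann) comes
from Parseval's identity for the discrete Fourier transform along the orbits
of a strict contraction. *)

(** * Norms and derivatives over the complex numbers *)

Section Rnorm.
Variable (R : realType) (V : normedModType R[i]).
Implicit Types (x y : V) (z w : R[i]).

Lemma rnormE x : `|x| = (rnorm x)%:C.
Proof. by rewrite /rnorm RRe_real// ger0_real. Qed.

Lemma rnorm_ge0 x : 0 <= rnorm x.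
Proof. rewrite -lecR -rnormE; exact: normr_ge0. Qed.

Lemma rnorm0 : rnorm (0 : V) = 0.
Proof. by rewrite /rnorm normr0. Qed.

Lemma rnorm_eq0 x : (rnorm x == 0) = (x == 0).
Proof. by rewrite -(inj_eq (@complexI _)) -rnormE normr_eq0. Qed.

Lemma rnormN x : rnorm (- x) = rnorm x.
Proof. by rewrite /rnorm normrN. Qed.

Lemma rdistC x y : rnorm (x - y) = rnorm (y - x).
Proof. by rewrite /rnorm distrC. Qed.

Lemma ler_rnormD x y : rnorm (x + y) <= rnorm x + rnorm y.
Proof. by rewrite -lecR rmorphD/= -!rnormE ler_normD. Qed.

Lemma ler_rnormB x y : rnorm (x - y) <= rnorm x + rnorm y.
Proof. by rewrite -[rnorm y]rnormN ler_rnormD. Qed.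

Lemma ler_rdistD y x (v : V) : rnorm (x - v) <= rnorm (x - y) + rnorm (y - v).
Proof. by rewrite (le_trans _ (ler_rnormD _ _))// addrA subrK. Qed.

Lemma lerB_rnorm x y : rnorm x - rnorm y <= rnorm (x - y).
Proof. by rewrite lerBlDr (le_trans _ (ler_rnormD _ _))// subrK. Qed.

Lemma rnorm_gt0 x : (0 < rnorm x) = (x != 0).
Proof. by rewrite lt_def rnorm_ge0 rnorm_eq0 andbT. Qed.

Lemma ler_rnorm_sum (I : Type) (r : seq I) (P : pred I) (F : I -> V) :
  rnorm (\sum_(i <- r | P i) F i) <= \sum_(i <- r | P i) rnorm (F i).
Proof.
elim/big_ind2 : _ => //; first by rewrite rnorm0.
by move=> x1 x2 y1 y2 h1 h2; rewrite (le_trans (ler_rnormD _ _))// lerD.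
Qed.

Lemma rnorm_small x : (forall e, 0 < e -> rnorm x <= e) -> x = 0.
Proof.
move=> H; apply/eqP; rewrite -rnorm_eq0 eq_le rnorm_ge0 andbT.
by apply/ler_addgt0Pr => e e0; rewrite add0r; exact: H.
Qed.

Lemma rnormZ z x : rnorm (z *: x) = rnorm z * rnorm x.
Proof. by apply: (@complexI R); rewrite rmorphM/= -!rnormE normrZ. Qed.

Lemma nbhs_rnormP x (P : set V) :
  nbhs x P <-> exists2 e : R, 0 < e & forall y, rnorm (y - x) < e -> P y.
Proof.
split.
  move=> /nbhs_normP [e /= e0 He]; exists (complex.Re e).
    by move: e0; rewrite ltcE => /andP[].
  move=> y yx; apply: He; rewrite /ball_/= -normrN opprB rnormE.
  move: e0 yx; case: e => a b; rewrite !ltcE /= => /andP[/eqP -> _] ->.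
  by rewrite eqxx.
move=> [e e0 He]; apply/nbhs_normP; exists e%:C => /=; first by rewrite ltcR.
by move=> y; rewrite /ball_/= -normrN opprB rnormE ltcR => /He.
Qed.

End Rnorm.

Section RnormC.
Variable (R : realType).
Implicit Types (z w : R[i]).

Lemma rnormM z w : rnorm (z * w) = rnorm z * rnorm w.
Proof. exact: rnormZ. Qed.

Lemma rnorm1 : rnorm (1 : R[i]) = 1.
Proof. by rewrite /rnorm normr1. Qed.

Lemma rnormV z : rnorm z^-1 = (rnorm z)^-1.
Proof. by apply: (@complexI R); rewrite fmorphV/= -!rnormE normfV. Qed.

Lemma rnormX z n : rnorm (z ^+ n) = rnorm z ^+ n.
Proof. by apply: (@complexI R); rewrite rmorphXn/= -!rnormE normrX. Qed.

Lemma rnormR (t : R) : rnorm (t%:C : R[i]) = `|t|.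
Proof. by rewrite /rnorm normc_def/= expr0n addr0 sqrtr_sqr. Qed.

Lemma rnormi : rnorm ('i : R[i]) = 1.
Proof. by rewrite /rnorm normc_def/= expr0n add0r expr1n sqrtr1. Qed.

Lemma ler_Re_rnorm z : `|complex.Re z| <= rnorm z.
Proof. by rewrite -lecR -rnormE normc_ge_Re. Qed.

Lemma ler_Im_rnorm z : `|complex.Im z| <= rnorm z.
Proof.
have := ler_Re_rnorm (z * 'i); rewrite ReiNIm normrN.
by rewrite rnormM rnormi mulr1.
Qed.

Lemma complexRI z : z = (complex.Re z)%:C + 'i * (complex.Im z)%:C.
Proof. exact: complexE. Qed.

Lemma ler_rnorm_ReIm z : rnorm z <= `|complex.Re z| + `|complex.Im z|.
Proof.
rewrite {1}[z]complexRI (le_trans (ler_rnormD _ _))// rnormM rnormi mul1r.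
by rewrite !rnormR.
Qed.

Lemma ReD z w : complex.Re (z + w) = complex.Re z + complex.Re w.
Proof. by case: z w => [? ?] [? ?]. Qed.
Lemma ImD z w : complex.Im (z + w) = complex.Im z + complex.Im w.
Proof. by case: z w => [? ?] [? ?]. Qed.
Lemma ReB z w : complex.Re (z - w) = complex.Re z - complex.Re w.
Proof. by case: z w => [? ?] [? ?]. Qed.
Lemma ImB z w : complex.Im (z - w) = complex.Im z - complex.Im w.
Proof. by case: z w => [? ?] [? ?]. Qed.
Lemma ReM z w : complex.Re (z * w) =
  complex.Re z * complex.Re w - complex.Im z * complex.Im w.
Proof. by case: z w => [? ?] [? ?]. Qed.
Lemma ImM z w : complex.Im (z * w) =
  complex.Re z * complex.Im w + complex.Im z * complex.Re w.
Proof. by case: z w => [? ?] [? ?]. Qed.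

Lemma complex_eqP z w :
  complex.Re z = complex.Re w -> complex.Im z = complex.Im w -> z = w.
Proof. by case: z w => [? ?] [? ?] /= -> ->. Qed.

End RnormC.

Section Cont.
Variable (R : realType).

Lemma continuous_rnormP (V W : normedModType R[i]) (f : V -> W) x :
  {for x, continuous f} <->
  forall e : R, 0 < e -> exists2 d : R, 0 < d &
    forall y, rnorm (y - x) < d -> rnorm (f y - f x) < e.
Proof.
split=> [fx e e0|H].
  have : nbhs x (f @^-1` [set y | rnorm (y - f x) < e]).
    by apply: fx; apply/nbhs_rnormP; exists e.
  by move=> /nbhs_rnormP.
move=> P /nbhs_rnormP[e e0 He].
have [d d0 Hd] := H e e0.
by apply/nbhs_rnormP; exists d => // y /Hd /He.
Qed.

Lemma continuous_rnormRP (W : normedModType R[i]) (f : R -> W) x :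
  {for x, continuous f} <->
  forall e : R, 0 < e -> exists2 d : R, 0 < d &
    forall y, `|y - x| < d -> rnorm (f y - f x) < e.
Proof.
split=> [fx e e0|H].
  have : nbhs x (f @^-1` [set y | rnorm (y - f x) < e]).
    by apply: fx; apply/nbhs_rnormP; exists e.
  move=> /nbhs_normP[d /= d0 Hd]; exists d => // y yx.
  by apply: Hd; rewrite /ball_/= distrC.
move=> P /nbhs_rnormP[e e0 He].
have [d d0 Hd] := H e e0.
apply/nbhs_normP; exists d => // y; rewrite /ball_/= distrC.
by move=> /Hd/He.
Qed.

Lemma continuous_rnormrP (V : normedModType R[i]) (f : V -> R) x :
  {for x, continuous f} <->
  forall e : R, 0 < e -> exists2 d : R, 0 < d &
    forall y, rnorm (y - x) < d -> `|f y - f x| < e.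
Proof.
split=> [fx e e0|H].
  have : nbhs x (f @^-1` [set y | `|y - f x| < e]).
    by apply: fx; apply/nbhs_normP; exists e => // y; rewrite /ball_/= distrC.
  by move=> /nbhs_rnormP.
move=> P /nbhs_normP[e /= e0 He].
have [d d0 Hd] := H e e0.
apply/nbhs_rnormP; exists d => // y /Hd; rewrite distrC; exact: He.
Qed.

Lemma continuous_Re (z : R[i]) : {for z, continuous (@complex.Re R)}.
Proof.
apply/continuous_rnormrP => e e0; exists e => // y; rewrite -ReB.
exact: le_lt_trans (ler_Re_rnorm _).
Qed.

Lemma continuous_Im (z : R[i]) : {for z, continuous (@complex.Im R)}.
Proof.
apply/continuous_rnormrP => e e0; exists e => // y; rewrite -ImB.
exact: le_lt_trans (ler_Im_rnorm _).
Qed.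

Lemma continuous_RC (t : R) : {for t, continuous (fun t : R => t%:C : R[i])}.
Proof.
apply/continuous_rnormRP => e e0; exists e => // y.
by rewrite -rmorphB rnormR.
Qed.

Lemma continuous_rnorm (V : normedModType R[i]) (x : V) :
  {for x, continuous (@rnorm R V)}.
Proof.
apply/continuous_rnormrP => e e0; exists e => // y; apply: le_lt_trans.
by rewrite ler_norml lerB_rnorm andbT lerNl opprB rdistC lerB_rnorm.
Qed.

(** Differentiability with derivative l in epsilon-delta form, without the
division and the punctured filter of derivable: this is what the estimates of
integrals use. *)
Definition cder (f : R[i] -> R[i]) (z l : R[i]) :=
  forall e : R, 0 < e -> exists2 d : R, 0 < d &
    forall w, rnorm (w - z) < d ->
      rnorm (f w - f z - l * (w - z)) <= e * rnorm (w - z).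

Lemma derivable_cder (f : R[i] -> R[i]) (z : R[i]) :
  derivable f z 1 -> cder f z (derive1 f z).
Proof.
move=> fz e e0.
have := fz; rewrite /derivable; move=> /cvg_ex[l Hl].
have -> : derive1 f z = l.
  rewrite derive1E; apply: cvg_lim => //.
move/cvgrPdist_le: Hl => /(_ e%:C).
rewrite ltcR => /(_ e0); rewrite near_withinE => /nbhs_rnormP[d d0 Hd].
exists d => // w wz.
have [->|wz0] := eqVneq w z; first by rewrite !subrr mulr0 subr0 rnorm0 mulr0.
have h0 : w - z != 0 by rewrite subr_eq0.
have := Hd (w - z); rewrite subr0 => /(_ wz h0) /=.
rewrite -[_ *: 1]/(_ * 1) mulr1 subrK rnormE lecR => H.
have -> : f w - f z - l * (w - z) =
   - ((l - (w - z)^-1 *: (f w - f z)) * (w - z)).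
  rewrite mulrBl -[(w - z)^-1 *: _]/((w - z)^-1 * _) mulrAC mulVf// mul1r.
  by rewrite opprB.
by rewrite rnormN rnormM ler_wpM2r// rnorm_ge0.
Qed.

Lemma cder_is_derive (f : R[i] -> R[i]) z l : cder f z l -> is_derive z 1 f l.
Proof.
move=> H.
have Hl : (fun h : R[i] => h^-1 *: ((f \o shift z) (h *: 1) - f z)) @ 0^' --> l.
  apply/cvgrPdist_le => -[a b]; rewrite ltcE /= => /andP[/eqP -> e0].
  rewrite near_withinE; apply/nbhs_rnormP.
  have [d d0 Hd] := H a e0.
  exists d => // h; rewrite subr0 => hd h0.
  have := Hd (h + z); rewrite addrK => /(_ hd).
  rewrite -[h *: 1]/(h * 1) mulr1 => Hh.
  rewrite rnormE lecR.
  have -> : l - h^-1 *: (f (h + z) - f z) =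
     - (h^-1 * (f (h + z) - f z - l * h)).
    rewrite -[_ *: _]/(_ * _) [in RHS]mulrBr opprB [h^-1 * (l * h)]mulrCA.
    by rewrite mulVf// mulr1.
  rewrite rnormN rnormM rnormV ler_pdivrMl ?rnorm_gt0//.
  by rewrite [rnorm h * a]mulrC.
split; first by apply/cvg_ex; exists l.
by apply: cvg_lim => //; exact: Hl.
Qed.

Lemma cder_unique (f : R[i] -> R[i]) z l : cder f z l -> derive1 f z = l.
Proof. by move=> /cder_is_derive H; rewrite derive1E derive_val. Qed.

Lemma cder_derivable f z l : cder f z l -> derivable f z 1.
Proof. by move=> /cder_is_derive H; exact: ex_derive. Qed.

Lemma is_derive_cder (f : R[i] -> R[i]) (z l : R[i]) : is_derive z 1 f l -> cder f z l.
Proof.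
move=> H; have := derivable_cder (@ex_derive _ _ _ _ _ _ _ H).
by rewrite derive1E derive_val.
Qed.

Lemma derivable_continuous_at (f : R[i] -> R[i]) (z : R[i]) :
  derivable f z 1 -> {for z, continuous f}.
Proof.
move=> /derivable1_diffP fz; exact: differentiable_continuous.
Qed.

End Cont.

(** * Integration along segments *)

Section RealInt.
Variable (R : realType).
Implicit Types (k F : R -> R).

Local Notation J k := (\int[lebesgue_measure]_(t in `[0%R, 1%R]) k t).

Definition cont01 (T : topologicalType) (k : R -> T) :=
  forall t, 0 <= t <= 1 -> {for t, continuous k}.

Lemma cont01_within k : cont01 k -> {within `[0, 1], continuous k}.
Proof.
move=> kc; apply: continuous_in_subspaceT => t; rewrite inE/= in_itv/=.
exact: kc.
Qed.

Lemma cont01_integrable k : cont01 k ->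
  lebesgue_measure.-integrable `[0, 1] (EFin \o k).
Proof.
move=> /cont01_within kc.
by apply: continuous_compact_integrable => //; exact: segment_compact.
Qed.

Lemma int01D k1 k2 : cont01 k1 -> cont01 k2 ->
  J (fun t => k1 t + k2 t) = J k1 + J k2.
Proof. by move=> h1 h2; rewrite RintegralD//; exact: cont01_integrable. Qed.

Lemma int01Z c k : cont01 k -> J (fun t => c * k t) = c * J k.
Proof. by move=> h; rewrite RintegralZl//; exact: cont01_integrable. Qed.

Lemma int01_bound k M : cont01 k -> (forall t, 0 <= t <= 1 -> `|k t| <= M) ->
  `|J k| <= M.
Proof.
move=> kc kM; rewrite (le_trans (le_normr_Rintegral _ _))//.
  exact: cont01_integrable.
have -> : M = J (cst M).
  by rewrite Rintegral_cst//= lebesgue_measure_itv/= lte_fin ltr01 oppr0 adde0 mulr1.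
apply: le_Rintegral => //.
- apply: (@cont01_integrable (fun t => `|k t|)) => t t01.
  by apply: continuous_comp; [exact: kc|exact: norm_continuous].
- by apply: (@cont01_integrable (cst M)) => t t01; exact: cst_continuous.
Qed.

Lemma int01_FTC F k : cont01 k ->
  (forall t : R, 0 <= t <= 1 -> is_derive t 1 F (k t)) -> J k = F 1 - F 0.
Proof.
move=> kc Fk.
have Fd t : 0 <= t <= 1 -> {for t, continuous F}.
  by move=> /Fk Ft; apply: differentiable_continuous; apply/derivable1_diffP.
rewrite /Rintegral (@continuous_FTC2 _ k F)//.
- exact: cont01_within.
- split => [t| |].
  + by rewrite in_itv/= => /andP[t0 t1]; apply: (@ex_derive _ _ _ _ _ _ _ (Fk t _)); rewrite !ltW.
  + by apply: cvg_at_right_filter; apply: Fd; rewrite lexx ler01.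
  + by apply: cvg_at_left_filter; apply: Fd; rewrite lexx ler01.
- move=> t; rewrite in_itv/= => /andP[t0 t1].
  by have := Fk t; rewrite !ltW// => /(_ isT) Ft; rewrite derive1E derive_val.
Qed.

(** Clamping the variable to [0, 1] extends the integrand continuously to the
line, so that the fundamental theorem applies at the end points as well. *)
Lemma int01_primitive k : cont01 k ->
  exists F, forall t : R, 0 <= t <= 1 -> is_derive t 1 F (k t).
Proof.
move=> kc.
pose clamp (t : R) := Num.min 1 (Num.max 0 t).
have clampE t : 0 <= clamp t <= 1.
  by rewrite /clamp ge_min lexx/= le_min ler01 le_max lexx.
have clampK t : 0 <= t <= 1 -> clamp t = t.
  by move=> /andP[t0 t1]; rewrite /clamp (max_idPr t0) (min_idPr t1).
pose h := k \o clamp.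
have hc : continuous h.
  move=> t; apply: continuous_comp; last exact: kc.
  apply: continuous_min; first exact: cst_continuous.
  by apply: continuous_max; [exact: cst_continuous|exact: cvg_id].
exists (fun x => \int[lebesgue_measure]_(t in [set` `[-1, x]]) h t) => t t01.
have hint : lebesgue_measure.-integrable `[-1, 2] (EFin \o h).
  apply: continuous_compact_integrable; first exact: segment_compact.
  exact: continuous_subspaceT.
have t2 : t < 2 by case/andP: t01 => _ /le_lt_trans; apply; rewrite ltr1n.
have [||H1 H2] := continuous_FTC1 t2 hint.
- by rewrite lte_fin; case/andP: t01 => t0 _; rewrite (lt_le_trans _ t0)// ltrN10.
- exact: hc.
by split => //; rewrite -derive1E H2 /h /= clampK.
Qed.

(** Both sides integrate the derivative of t |-> F (u + t (v - u)), whatever the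
order of u and v. *)
Lemma int01_affine k F (u v : R) : cont01 k ->
  (forall t : R, 0 <= t <= 1 -> is_derive t 1 F (k t)) ->
  0 <= u <= 1 -> 0 <= v <= 1 ->
  (v - u) * J (fun t => k (u + t * (v - u))) = F v - F u.
Proof.
move=> kc Fk u01 v01.
have in01 t : 0 <= t <= 1 -> 0 <= u + t * (v - u) <= 1.
  by move=> t01; nra.
have ac (t : R) : {for t, continuous (fun t : R => u + t * (v - u))}.
  apply: cvgD; first exact: cvg_cst.
  by apply: cvgM; [exact: cvg_id|exact: cvg_cst].
have kac : cont01 (fun t : R => k (u + t * (v - u))).
  by move=> t t01; apply: (@continuous_comp _ _ _ (fun t : R => u + t * (v - u)) k) => //; exact: kc (in01 _ t01).
rewrite -int01Z//.
have D (t : R) : 0 <= t <= 1 ->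
    is_derive t 1 (fun t : R => F (u + t * (v - u))) ((v - u) * k (u + t * (v - u))).
  move=> t01.
  have Ft := Fk _ (in01 _ t01).
  have Ga : is_derive t 1 (fun t : R => u + t * (v - u)) (v - u).
    apply: is_derive_eq; rewrite ?scale1r ?scaler0 ?add0r ?addr0.
    by rewrite mul1r -[_ *: _]/(_ * _) mulr1.
  by rewrite mulrC; exact: (is_derive1_comp (g := fun t : R => u + t * (v - u)) Ft Ga).
rewrite (int01_FTC _ D); first by rewrite mul1r mul0r addr0 (addrC u) subrK.
move=> t t01.
by apply: cvgM; [exact: cvg_cst|exact: kac].
Qed.

End RealInt.

Section SegmentIntegral.
Variable (R : realType).
Implicit Types (f g F : R[i] -> R[i]) (h : R -> R[i]) (e : R[i] * R[i]).

Lemma cont01_Re h : cont01 h -> cont01 (fun t => complex.Re (h t)).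
Proof.
move=> hc t t01; apply: (@continuous_comp _ _ _ h (@complex.Re R)).
  exact: hc.
exact: continuous_Re.
Qed.

Lemma cont01_Im h : cont01 h -> cont01 (fun t => complex.Im (h t)).
Proof.
move=> hc t t01; apply: (@continuous_comp _ _ _ h (@complex.Im R)).
  exact: hc.
exact: continuous_Im.
Qed.

Lemma integral01_ext h1 h2 : (forall t, 0 <= t <= 1 -> h1 t = h2 t) ->
  integral01 h1 = integral01 h2.
Proof.
move=> h12; rewrite /integral01; congr (_ +i* _); apply: eq_Rintegral => t;
by rewrite inE/= in_itv/= => /h12 ->.
Qed.

Lemma integral01D h1 h2 : cont01 h1 -> cont01 h2 ->
  integral01 (fun t => h1 t + h2 t) = integral01 h1 + integral01 h2.
Proof.
move=> c1 c2; rewrite /integral01.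
under eq_Rintegral do rewrite ReD.
under [X in _ +i* X]eq_Rintegral do rewrite ImD.
by rewrite !int01D//; (exact: cont01_Re || exact: cont01_Im).
Qed.

Lemma integral01Z c h : cont01 h ->
  integral01 (fun t => c * h t) = c * integral01 h.
Proof.
move=> ch; have cR := cont01_Re ch; have cI := cont01_Im ch.
have cst0 (k : R -> R) a : cont01 k -> cont01 (fun t => a * k t).
  by move=> ck t t01; apply: cvgM; [exact: cvg_cst|exact: ck].
apply: complex_eqP; rewrite ?ReM ?ImM /=.
  under eq_Rintegral do rewrite ReM -mulNr.
  by rewrite int01D ?int01Z ?mulNr//; exact: cst0.
under eq_Rintegral do rewrite ImM.
by rewrite int01D ?int01Z//; exact: cst0.
Qed.

(** The factor 2 comes from bounding real and imaginary parts separately. *)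
Lemma integral01_bound h M : cont01 h ->
  (forall t, 0 <= t <= 1 -> rnorm (h t) <= M) -> rnorm (integral01 h) <= 2 * M.
Proof.
move=> ch hM; rewrite (le_trans (ler_rnorm_ReIm _))//= [2]mulr2n mulrDl mul1r.
apply: lerD; apply: int01_bound.
- exact: cont01_Re.
- by move=> t /hM; apply: le_trans; exact: ler_Re_rnorm.
- exact: cont01_Im.
- by move=> t /hM; apply: le_trans; exact: ler_Im_rnorm.
Qed.

Lemma integral01_affine h : cont01 h ->
  exists P : R -> R[i], forall u v : R, 0 <= u <= 1 -> 0 <= v <= 1 ->
  (v - u)%:C * integral01 (fun t => h (u + t * (v - u))) = P v - P u.
Proof.
move=> ch; have cR := cont01_Re ch; have cI := cont01_Im ch.
have [F FP] := int01_primitive cR; have [G GP] := int01_primitive cI.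
exists (fun t => F t +i* G t) => u v u01 v01.
apply: complex_eqP; rewrite ?ReM ?ImM ?ReB ?ImB /= mul0r ?subr0 ?addr0.
  exact: (int01_affine cR FP).
exact: (int01_affine cI GP).
Qed.

Lemma integral01_FTC (P h : R -> R[i]) : cont01 h ->
  (forall t : R, 0 <= t <= 1 ->
    is_derive t 1 (fun t => complex.Re (P t)) (complex.Re (h t)) /\
    is_derive t 1 (fun t => complex.Im (P t)) (complex.Im (h t))) ->
  integral01 h = P 1 - P 0.
Proof.
move=> ch Ph; apply: complex_eqP; rewrite ?ReB ?ImB /=.
  exact: (int01_FTC (F := fun t => complex.Re (P t)) (cont01_Re ch)
    (fun t t01 => (Ph t t01).1)).
exact: (int01_FTC (F := fun t => complex.Im (P t)) (cont01_Im ch)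
  (fun t t01 => (Ph t t01).2)).
Qed.

Definition on_seg e : set R[i] := [set segment_pt e t | t in [set t : R | 0 <= t <= 1]].

Definition eint f e := (e.2 - e.1) * integral01 (fun t => f (segment_pt e t)).

Definition cont_on (S : set R[i]) f := forall z, S z -> {for z, continuous f}.

Lemma contour_integralE (G : contour R) f :
  contour_integral G f = \sum_(e <- G) eint f e.
Proof. by []. Qed.

Lemma continuous_segment_pt e t : {for t, continuous (segment_pt e)}.
Proof.
apply: cvgD; first exact: cvg_cst.
apply: (@cvgM R[i]); last exact: cvg_cst.
exact: continuous_RC.
Qed.

Lemma cont01_seg f e : cont_on (on_seg e) f -> cont01 (fun t => f (segment_pt e t)).
Proof.
move=> fc t t01; apply: (@continuous_comp _ _ _ (segment_pt e) f).
  exact: continuous_segment_pt.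
by apply: fc; exists t.
Qed.

Lemma eint_ext f g e : (forall z, on_seg e z -> f z = g z) -> eint f e = eint g e.
Proof.
move=> fg; congr (_ * _); apply: integral01_ext => t t01; apply: fg.
by exists t.
Qed.

Lemma eintD f g e : cont_on (on_seg e) f -> cont_on (on_seg e) g ->
  eint (fun z => f z + g z) e = eint f e + eint g e.
Proof.
by move=> fc gc; rewrite /eint integral01D ?mulrDr//; exact: cont01_seg.
Qed.

Lemma eintZ c f e : cont_on (on_seg e) f ->
  eint (fun z => c * f z) e = c * eint f e.
Proof.
move=> fc; rewrite /eint (integral01Z c (cont01_seg fc)).
by rewrite (mulrCA (e.2 - e.1) c).
Qed.

Lemma eint_bound f e M : cont_on (on_seg e) f ->
  (forall z, on_seg e z -> rnorm (f z) <= M) ->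
  rnorm (eint f e) <= 2 * M * rnorm (e.2 - e.1).
Proof.
move=> fc fM; rewrite rnormM mulrC ler_wpM2r ?rnorm_ge0//.
apply: integral01_bound; first exact: cont01_seg.
by move=> t t01; apply: fM; exists t.
Qed.

Lemma segment_pt0 e : segment_pt e 0 = e.1.
Proof. by rewrite /segment_pt mul0r addr0. Qed.

Lemma segment_pt1 e : segment_pt e 1 = e.2.
Proof. by rewrite /segment_pt mul1r addrC subrK. Qed.

Lemma segment_pt_affine e u v t :
  segment_pt (segment_pt e u, segment_pt e v) t = segment_pt e (u + t * (v - u)).
Proof.
rewrite /segment_pt /=; rewrite !rmorphD/= !rmorphM/= !rmorphB/=; ring.
Qed.

Lemma on_seg_sub e u v : 0 <= u <= 1 -> 0 <= v <= 1 ->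
  on_seg (segment_pt e u, segment_pt e v) `<=` on_seg e.
Proof.
move=> u01 v01 _ [t /= t01 <-]; rewrite segment_pt_affine.
by exists (u + t * (v - u)) => //=; nra.
Qed.

(** A single P serves for all pieces of e, in both directions: splitting,
reversing and telescoping are then algebra on the increments of P. *)
Lemma eint_primitive f e : cont_on (on_seg e) f ->
  exists P : R -> R[i], forall u v : R, 0 <= u <= 1 -> 0 <= v <= 1 ->
  eint f (segment_pt e u, segment_pt e v) = P v - P u.
Proof.
move=> fc; have [P HP] := integral01_affine (cont01_seg fc).
exists (fun t => (e.2 - e.1) * P t) => u v u01 v01.
rewrite -mulrBr -HP// /eint mulrA; congr (_ * _).
  by rewrite /segment_pt/= rmorphB/=; ring.
by apply: integral01_ext => t t01; rewrite segment_pt_affine.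
Qed.

Lemma eint_split f e s : cont_on (on_seg e) f -> 0 <= s <= 1 ->
  eint f e = eint f (e.1, segment_pt e s) + eint f (segment_pt e s, e.2).
Proof.
move=> /eint_primitive[P HP] s01.
have h0 : 0 <= (0 : R) <= 1 by rewrite lexx ler01.
have h1 : 0 <= (1 : R) <= 1 by rewrite lexx ler01.
have := HP _ _ h0 s01; have := HP _ _ s01 h1; have := HP _ _ h0 h1.
rewrite segment_pt0 segment_pt1 -surjective_pairing => -> -> ->.
by rewrite [RHS]addrC subrKA.
Qed.

Lemma eint_rev f a b : cont_on (on_seg (a, b)) f -> eint f (b, a) = - eint f (a, b).
Proof.
move=> /eint_primitive[P HP].
have h0 : 0 <= (0 : R) <= 1 by rewrite lexx ler01.
have h1 : 0 <= (1 : R) <= 1 by rewrite lexx ler01.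
have := HP _ _ h0 h1; have := HP _ _ h1 h0.
by rewrite segment_pt0 segment_pt1 /= => -> ->; rewrite opprB.
Qed.

Lemma on_seg_rev a b : on_seg (b, a) `<=` on_seg (a, b).
Proof.
move=> _ [t /= /andP[t0 t1] <-]; exists (1 - t) => /=.
  by rewrite subr_ge0 t1 lerBlDr lerDl.
by rewrite /segment_pt/= rmorphB/=; ring.
Qed.

Lemma real_is_derive (k : R -> R) (t l : R) :
  (forall eps : R, 0 < eps -> exists2 d : R, 0 < d & forall s, `|s - t| < d ->
     `|k s - k t - l * (s - t)| <= eps * `|s - t|) ->
  is_derive t 1 k l.
Proof.
move=> H.
have Hl : (fun h : R => h^-1 *: ((k \o shift t) (h *: 1) - k t)) @ 0^' --> l.
  apply/cvgrPdist_le => eps e0.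
  rewrite near_withinE; apply/nbhs_normP.
  have [d d0 Hd] := H eps e0.
  exists d => // h; rewrite /ball_/= sub0r normrN => hd h0.
  have := Hd (h + t); rewrite addrK => /(_ hd).
  rewrite -[h *: 1]/(h * 1) mulr1 => Hh.
  have -> : l - h^-1 *: (k (h + t) - k t) = - (h^-1 * (k (h + t) - k t - l * h)).
    by rewrite -[_ *: _]/(_ * _); field.
  by rewrite normrN normrM normfV ler_pdivrMl ?normr_gt0// [`|h| * _]mulrC.
split; first by apply/cvg_ex; exists l.
by apply: cvg_lim => //; exact: Hl.
Qed.

(** The complex derivative of F gives real derivatives of both components of
t |-> F (segment_pt e t). *)
Lemma eint_FTC F f e : cont_on (on_seg e) f ->
  (forall z, on_seg e z -> cder F z (f z)) -> eint f e = F e.2 - F e.1.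
Proof.
move=> fc Ff.
have hc := cont01_seg fc.
have hc' : cont01 (fun t => (e.2 - e.1) * f (segment_pt e t)).
  move=> t t01; apply: (@cvgM R[i]); first exact: cvg_cst.
  exact: hc.
rewrite /eint -(integral01Z _ hc).
rewrite (integral01_FTC (P := fun t => F (segment_pt e t)) hc').
  by rewrite segment_pt0 segment_pt1.
move=> t t01.
have key (eps : R) : 0 < eps -> exists2 d : R, 0 < d & forall s, `|s - t| < d ->
    rnorm (F (segment_pt e s) - F (segment_pt e t) -
      (e.2 - e.1) * f (segment_pt e t) * (s - t)%:C) <= eps * `|s - t|.
  move=> e0; set L := rnorm (e.2 - e.1).
  have L0 : 0 < L + 1 by rewrite ltr_wpDl ?rnorm_ge0.
  have zt : on_seg e (segment_pt e t) by exists t.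
  have [d d0 Hd] := Ff _ zt (eps / (L + 1)) (divr_gt0 e0 L0).
  exists (d / (L + 1)); first exact: divr_gt0.
  have dE s : segment_pt e s - segment_pt e t = (e.2 - e.1) * (s - t)%:C.
    by rewrite /segment_pt rmorphB/=; ring.
  move=> s st.
  have nE : rnorm (segment_pt e s - segment_pt e t) = L * `|s - t|.
    by rewrite dE rnormM rnormR.
  have Ld : L * `|s - t| < d.
    rewrite (@le_lt_trans _ _ ((L + 1) * `|s - t|))//; last first.
      by rewrite mulrC -ltr_pdivlMr.
    by rewrite ler_wpM2r// lerDl.
  have := Hd (segment_pt e s); rewrite nE => /(_ Ld).
  rewrite dE mulrA (mulrC (f _)) => /le_trans; apply.
  rewrite mulrA ler_wpM2r// mulrAC -mulrA ler_piMr// ?ltW//.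
  by rewrite ltr_pdivrMr// mul1r ltrDl.
have reE (x : R[i]) (r : R) : complex.Re (x * r%:C) = complex.Re x * r.
  by rewrite ReM/= mulr0 subr0.
have imE (x : R[i]) (r : R) : complex.Im (x * r%:C) = complex.Im x * r.
  by rewrite ImM/= mulr0 add0r.
split; apply: real_is_derive => eps /key[d d0 Hd]; exists d => // s /Hd.
  by apply: le_trans; rewrite -reE -!ReB ler_Re_rnorm.
by apply: le_trans; rewrite -imE -!ImB ler_Im_rnorm.
Qed.

End SegmentIntegral.

(** * Contour integrals *)

Section Contour.
Variable (R : realType).
Implicit Types (f g F : R[i] -> R[i]) (G : contour R) (e : R[i] * R[i]).

Definition ctrace G : set R[i] := [set z | exists2 e, e \in G & on_seg e z].

(** A cycle in the sense of homology: the boundary of the chain vanishes. *)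
Definition closed_chain G := perm_eq [seq e.1 | e <- G] [seq e.2 | e <- G].

Lemma sub_cont_on (S T : set R[i]) f : S `<=` T -> cont_on T f -> cont_on S f.
Proof. by move=> ST fT z /ST; exact: fT. Qed.

Lemma ctrace_edge G e f : e \in G -> cont_on (ctrace G) f -> cont_on (on_seg e) f.
Proof. by move=> eG; apply: sub_cont_on => z ez; exists e. Qed.

Lemma cint_ext G f g : (forall z, ctrace G z -> f z = g z) ->
  contour_integral G f = contour_integral G g.
Proof.
move=> fg; rewrite !contour_integralE; apply: eq_big_seq => e eG.
by apply: eint_ext => z ez; apply: fg; exists e.
Qed.

Lemma cintD G f g : cont_on (ctrace G) f -> cont_on (ctrace G) g ->
  contour_integral G (fun z => f z + g z) =
  contour_integral G f + contour_integral G g.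
Proof.
move=> fc gc; rewrite !contour_integralE -big_split/=.
by apply: eq_big_seq => e eG; apply: eintD; exact: (ctrace_edge eG).
Qed.

Lemma cintZ G c f : cont_on (ctrace G) f ->
  contour_integral G (fun z => c * f z) = c * contour_integral G f.
Proof.
move=> fc; rewrite !contour_integralE mulr_sumr.
by apply: eq_big_seq => e eG; apply: eintZ; exact: (ctrace_edge eG).
Qed.

Definition clength G : R := \sum_(e <- G) rnorm (e.2 - e.1).

Lemma clength_ge0 G : 0 <= clength G.
Proof. by apply: sumr_ge0 => e _; exact: rnorm_ge0. Qed.

Lemma cint_bound G f M : cont_on (ctrace G) f ->
  (forall z, ctrace G z -> rnorm (f z) <= M) ->
  rnorm (contour_integral G f) <= 2 * M * clength G.
Proof.
move=> fc fM; rewrite contour_integralE (le_trans (ler_rnorm_sum _ _ _))//.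
rewrite /clength mulr_sumr big_seq [leRHS]big_seq; apply: ler_sum => e eG.
apply: eint_bound; first exact: (ctrace_edge eG).
by move=> z ez; apply: fM; exists e.
Qed.

(** The increments of the primitive over the edges cancel, the chain having no
boundary. *)
Lemma cint_FTC G F f : closed_chain G -> cont_on (ctrace G) f ->
  (forall z, ctrace G z -> cder F z (f z)) -> contour_integral G f = 0.
Proof.
move=> clG fc Ff; rewrite contour_integralE.
transitivity (\sum_(e <- G) (F e.2 - F e.1)).
  apply: eq_big_seq => e eG; apply: eint_FTC; first exact: (ctrace_edge eG).
  by move=> z ez; apply: Ff; exists e.
rewrite big_split/= sumrN.
rewrite -(big_map (fun e => e.2) xpredT F) -(big_map (fun e => e.1) xpredT F).
by rewrite (perm_big _ clG) subrr.
Qed.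

Lemma cont_onD (S : set R[i]) f g : cont_on S f -> cont_on S g ->
  cont_on S (fun z => f z + g z).
Proof. by move=> fc gc z Sz; exact: (continuousD (fc z Sz) (gc z Sz)). Qed.

Lemma cont_onM (S : set R[i]) f g : cont_on S f -> cont_on S g ->
  cont_on S (fun z => f z * g z).
Proof.
by move=> fc gc z Sz; exact: (continuousM (fc z Sz) (gc z Sz)).
Qed.

Lemma cont_on_cst (S : set R[i]) c : cont_on S (fun=> c).
Proof. by move=> z Sz; exact: cst_continuous. Qed.

Lemma cont_on_id (S : set R[i]) : cont_on S id.
Proof. by move=> z Sz; exact: cvg_id. Qed.

Lemma cont_onN (S : set R[i]) f : cont_on S f -> cont_on S (fun z => - f z).
Proof. by move=> fc z Sz; exact: (continuousN (fc z Sz)). Qed.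

Lemma cont_onV (S : set R[i]) f : cont_on S f ->
  (forall z, S z -> f z != 0) -> cont_on S (fun z => (f z)^-1).
Proof. by move=> fc f0 z Sz; exact: (continuousV (f0 z Sz) (fc z Sz)). Qed.

Lemma cont_onX (S : set R[i]) f n : cont_on S f -> cont_on S (fun z => f z ^+ n).
Proof.
move=> fc; elim: n => [|n IH].
  by under [X in cont_on _ X]eq_fun do rewrite expr0; exact: cont_on_cst.
by under [X in cont_on _ X]eq_fun do rewrite exprS; exact: cont_onM.
Qed.

Lemma cont_on_sum (S : set R[i]) (I : Type) (r : seq I) (P : pred I)
  (F : I -> R[i] -> R[i]) : (forall i, P i -> cont_on S (F i)) ->
  cont_on S (fun z => \sum_(i <- r | P i) F i z).
Proof.
move=> Fc; elim: r => [|i r IH].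
  by under [X in cont_on _ X]eq_fun do rewrite big_nil; exact: cont_on_cst.
under [X in cont_on _ X]eq_fun do rewrite big_cons.
case E : (P i); [apply: cont_onD; [exact: Fc|exact: IH]|exact: IH].
Qed.

Lemma cont_on_horner (S : set R[i]) (p : {poly R[i]}) : cont_on S (fun z => p.[z]).
Proof.
under [X in cont_on _ X]eq_fun do rewrite horner_coef.
apply: cont_on_sum => i _; apply: cont_onM; first exact: cont_on_cst.
by apply: cont_onX; exact: cont_on_id.
Qed.

Lemma cderD f g (z l m : R[i]) : cder f z l -> cder g z m ->
  cder (fun w => f w + g w) z (l + m).
Proof.
move=> /cder_is_derive fl /cder_is_derive gm.
by apply: is_derive_cder; exact: is_deriveD.
Qed.

Lemma cderM f g (z l m : R[i]) : cder f z l -> cder g z m ->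
  cder (fun w => f w * g w) z (f z * m + g z * l).
Proof.
move=> /cder_is_derive fl /cder_is_derive gm.
by apply: is_derive_cder; exact: is_deriveM.
Qed.

Lemma cderV f (z l : R[i]) : f z != 0 -> cder f z l ->
  cder (fun w => (f w)^-1) z (- (f z) ^- 2 * l).
Proof.
move=> f0 /cder_is_derive fl.
have fd : derivable f z 1 by exact: ex_derive.
apply: is_derive_cder; split; first exact: derivableV.
by rewrite (deriveV f0 fd) (@derive_val _ _ _ _ _ _ _ fl).
Qed.

Lemma cder_cst (c z : R[i]) : cder (fun=> c) z 0.
Proof. by apply: is_derive_cder; exact: is_derive_cst. Qed.

Lemma cder_id (z : R[i]) : cder id z 1.
Proof. by apply: is_derive_cder; exact: is_derive_id. Qed.

Lemma cder_eq f (z l m : R[i]) : cder f z l -> l = m -> cder f z m.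
Proof. by move=> ? <-. Qed.

Lemma cderX f (z l : R[i]) n : cder f z l ->
  cder (fun w => f w ^+ n) z (n%:R * f z ^+ n.-1 * l).
Proof.
move=> fl; elim: n => [|n IH].
  rewrite !mul0r; have -> : (fun w => f w ^+ 0) = fun=> 1 by apply/funext=> w; rewrite expr0.
  exact: cder_cst.
have -> : (fun w => f w ^+ n.+1) = fun w => f w * f w ^+ n.
  by apply/funext => w; rewrite exprS.
apply: (cder_eq (cderM fl IH)) => /=.
case: n IH => [|n] IH /=; first by rewrite expr0; ring.
by rewrite [in n.+2%:R]mulrS exprS; ring.
Qed.

Lemma cder_horner (P : {poly R[i]}) z : cder (horner P) z P^`().[z].
Proof.
elim/poly_ind: P => [|P c IH].
  rewrite linear0 horner0; have -> : horner 0 = fun=> (0 : R[i]).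
    by apply/funext => w; rewrite horner0.
  exact: cder_cst.
have -> : horner (P * 'X + c%:P) = fun w => P.[w] * w + c.
  by apply/funext => w; rewrite !hornerE.
apply: (cder_eq (cderD (cderM IH (cder_id z)) (cder_cst c z))).
by rewrite derivD derivM derivX derivC !hornerE; ring.
Qed.

Lemma cint_sum G (I : Type) (r : seq I) (F : I -> R[i] -> R[i]) :
  (forall i, cont_on (ctrace G) (F i)) ->
  contour_integral G (fun z => \sum_(i <- r) F i z) =
  \sum_(i <- r) contour_integral G (F i).
Proof.
move=> Fc; elim: r => [|i r IH].
  rewrite big_nil (cint_ext (g := fun z => 0 * 0)).
    by rewrite cintZ ?mul0r//; exact: cont_on_cst.
  by move=> z _; rewrite big_nil mul0r.
rewrite big_cons -IH -cintD//; last by apply: cont_on_sum => j _; exact: Fc.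
by apply: cint_ext => z _; rewrite big_cons.
Qed.

Lemma cint_horner G (P : {poly R[i]}) : closed_chain G ->
  contour_integral G (horner P) = 0.
Proof.
move=> clG.
rewrite (cint_ext (g := fun z => \sum_(i < size P) P`_i * z ^+ i)); last first.
  by move=> z _; rewrite horner_coef.
have Xc i : cont_on (ctrace G) (fun z => z ^+ i).
  by apply: cont_onX; exact: cont_on_id.
rewrite cint_sum; last first.
  by move=> i; apply: cont_onM; [exact: cont_on_cst|exact: Xc].
apply: big1 => i _; rewrite cintZ; last exact: Xc.
rewrite (@cint_FTC G (fun z => i.+1%:R^-1 * z ^+ i.+1)) ?mulr0//.
move=> z _.
apply: (cder_eq (cderM (cder_cst _ z) (cderX i.+1 (cder_id z)))).
by rewrite mulr0 addr0 mulr1 mulKf// pnatr_eq0.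
Qed.

End Contour.

Section Rectangle.
Variable (R : realType).
Implicit Types (f g F : R[i] -> R[i]).

(** The boundary, counterclockwise from the lower left corner. *)
Definition rect (x0 x1 y0 y1 : R) : contour R :=
  [:: (x0 +i* y0, x1 +i* y0); (x1 +i* y0, x1 +i* y1);
      (x1 +i* y1, x0 +i* y1); (x0 +i* y1, x0 +i* y0)].

Definition rset (x0 x1 y0 y1 : R) : set R[i] :=
  [set z | x0 <= complex.Re z <= x1 /\ y0 <= complex.Im z <= y1].

Lemma rset_sub (x0 x1 y0 y1 x0' x1' y0' y1' : R) :
  x0 <= x0' -> x1' <= x1 -> y0 <= y0' -> y1' <= y1 ->
  rset x0' x1' y0' y1' `<=` rset x0 x1 y0 y1.
Proof. by move=> ? ? ? ? z [] ? ?; split; lra. Qed.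

Lemma closed_rect (x0 x1 y0 y1 : R) : closed_chain (rect x0 x1 y0 y1).
Proof.
rewrite /closed_chain /= perm_sym.
by rewrite -[X in perm_eq X _]/(rot 1 [:: x0 +i* y0; x1 +i* y0; x1 +i* y1; x0 +i* y1]) perm_rot.
Qed.

Lemma on_segE (a b : R[i]) z : on_seg (a, b) z ->
  exists2 t : R, 0 <= t <= 1 &
    complex.Re z = complex.Re a + t * (complex.Re b - complex.Re a) /\
    complex.Im z = complex.Im a + t * (complex.Im b - complex.Im a).
Proof.
move=> [t t01 <-]; exists t => //; rewrite /segment_pt ReD ImD ReM ImM ReB ImB /=.
by split; ring.
Qed.

Lemma on_seg_rset (a b : R[i]) (x0 x1 y0 y1 : R) :
  rset x0 x1 y0 y1 a -> rset x0 x1 y0 y1 b ->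
  on_seg (a, b) `<=` rset x0 x1 y0 y1.
Proof.
move=> [/andP[a1 a2] /andP[a3 a4]] [/andP[b1 b2] /andP[b3 b4]] z.
by move=> /on_segE[t /andP[t0 t1] [zR zI]]; split; rewrite ?zR ?zI; apply/andP; split; nra.
Qed.

Lemma on_hseg (x0 x1 x y : R) : x0 <= x <= x1 ->
  on_seg (x0 +i* y, x1 +i* y) (x +i* y).
Proof.
move=> /andP[h0 h1].
have [e|ne] := eqVneq x0 x1.
  exists 0; first by rewrite /= lexx ler01.
  by rewrite segment_pt0/=; congr (_ +i* _); lra.
have lt : 0 < x1 - x0 by rewrite subr_gt0 lt_def eq_sym ne (le_trans h0).
exists ((x - x0) / (x1 - x0)) => /=.
  apply/andP; split; first by apply: divr_ge0; [rewrite subr_ge0|exact: ltW].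
  by rewrite ler_pdivrMr// mul1r lerB.
rewrite /segment_pt/=; apply: complex_eqP; rewrite ?ReD ?ImD ?ReM ?ImM ?ReB ?ImB /=.
  by rewrite mul0r subr0 mulfVK ?gt_eqF// addrC subrK.
by rewrite subrr mulr0 mul0r !addr0.
Qed.

Lemma on_vseg (x y0 y1 y : R) : y0 <= y <= y1 ->
  on_seg (x +i* y0, x +i* y1) (x +i* y).
Proof.
move=> /andP[h0 h1].
have [e|ne] := eqVneq y0 y1.
  exists 0; first by rewrite /= lexx ler01.
  by rewrite segment_pt0/=; congr (_ +i* _); lra.
have lt : 0 < y1 - y0 by rewrite subr_gt0 lt_def eq_sym ne (le_trans h0).
exists ((y - y0) / (y1 - y0)) => /=.
  apply/andP; split; first by apply: divr_ge0; [rewrite subr_ge0|exact: ltW].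
  by rewrite ler_pdivrMr// mul1r lerB.
rewrite /segment_pt/=; apply: complex_eqP; rewrite ?ReD ?ImD ?ReM ?ImM ?ReB ?ImB /=.
  by rewrite subrr mulr0 mul0r subr0 addr0.
by rewrite mul0r addr0 mulfVK ?gt_eqF// addrC subrK.
Qed.

Lemma eint_on f (a b w : R[i]) : cont_on (on_seg (a, b)) f -> on_seg (a, b) w ->
  eint f (a, b) = eint f (a, w) + eint f (w, b).
Proof. by move=> fc [s s01 <-]; rewrite (eint_split fc s01). Qed.

Lemma ctrace_rect (x0 x1 y0 y1 : R) : x0 <= x1 -> y0 <= y1 ->
  ctrace (rect x0 x1 y0 y1) `<=` rset x0 x1 y0 y1.
Proof.
move=> hx hy z [e]; rewrite !inE => /or4P[] /eqP ->; apply: on_seg_rset;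
by split; rewrite /= ?lexx ?hx ?hy.
Qed.

Lemma rint_splitx f (x0 m x1 y0 y1 : R) : x0 <= m -> m <= x1 ->
  cont_on (ctrace (rect x0 x1 y0 y1)) f ->
  cont_on (on_seg (m +i* y0, m +i* y1)) f ->
  contour_integral (rect x0 x1 y0 y1) f =
  contour_integral (rect x0 m y0 y1) f + contour_integral (rect m x1 y0 y1) f.
Proof.
move=> h0 h1 fc fm.
have sc e : e \in rect x0 x1 y0 y1 -> cont_on (on_seg e) f.
  by move=> eQ; exact: ctrace_edge fc.
rewrite !contour_integralE !big_cons !big_nil.
have -> : eint f (x0 +i* y0, x1 +i* y0) =
    eint f (x0 +i* y0, m +i* y0) + eint f (m +i* y0, x1 +i* y0).
  apply: eint_on; last by apply: on_hseg; rewrite h0 h1.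
  by apply: sc; rewrite !inE eqxx.
have -> : eint f (x1 +i* y1, x0 +i* y1) =
    eint f (x1 +i* y1, m +i* y1) + eint f (m +i* y1, x0 +i* y1).
  apply: eint_on; last by apply: on_seg_rev; apply: on_hseg; rewrite h0 h1.
  by apply: sc; rewrite !inE eqxx !orbT.
rewrite (eint_rev fm).
do 7 move: (eint f _) => ?.
ring.
Qed.

Lemma rint_splity f (x0 x1 y0 m y1 : R) : y0 <= m -> m <= y1 ->
  cont_on (ctrace (rect x0 x1 y0 y1)) f ->
  cont_on (on_seg (x0 +i* m, x1 +i* m)) f ->
  contour_integral (rect x0 x1 y0 y1) f =
  contour_integral (rect x0 x1 y0 m) f + contour_integral (rect x0 x1 m y1) f.
Proof.
move=> h0 h1 fc fm.
have sc e : e \in rect x0 x1 y0 y1 -> cont_on (on_seg e) f.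
  by move=> eQ; exact: ctrace_edge fc.
rewrite !contour_integralE !big_cons !big_nil.
have -> : eint f (x1 +i* y0, x1 +i* y1) =
    eint f (x1 +i* y0, x1 +i* m) + eint f (x1 +i* m, x1 +i* y1).
  apply: eint_on; last by apply: on_vseg; rewrite h0 h1.
  by apply: sc; rewrite !inE eqxx !orbT.
have -> : eint f (x0 +i* y1, x0 +i* y0) =
    eint f (x0 +i* y1, x0 +i* m) + eint f (x0 +i* m, x0 +i* y0).
  apply: eint_on; last by apply: on_seg_rev; apply: on_vseg; rewrite h0 h1.
  by apply: sc; rewrite !inE eqxx !orbT.
rewrite (eint_rev fm).
do 7 move: (eint f _) => ?.
ring.
Qed.

Lemma rset_hseg (x0 x1 y0 y1 m : R) : x0 <= m -> m <= x1 -> y0 <= y1 ->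
  on_seg (m +i* y0, m +i* y1) `<=` rset x0 x1 y0 y1.
Proof. by move=> h0 h1 hy; apply: on_seg_rset; split; rewrite /= ?lexx ?h0 ?h1 ?hy. Qed.

Lemma rset_vseg (x0 x1 y0 y1 m : R) : y0 <= m -> m <= y1 -> x0 <= x1 ->
  on_seg (x0 +i* m, x1 +i* m) `<=` rset x0 x1 y0 y1.
Proof. by move=> h0 h1 hy; apply: on_seg_rset; split; rewrite /= ?lexx ?h0 ?h1 ?hy. Qed.

Lemma clength_rect (x0 x1 y0 y1 : R) : x0 <= x1 -> y0 <= y1 ->
  clength (rect x0 x1 y0 y1) <= 2 * ((x1 - x0) + (y1 - y0)).
Proof.
move=> hx hy; rewrite /clength !big_cons big_nil /=.
have E (a b : R[i]) : rnorm (a - b) <= `|complex.Re a - complex.Re b| + `|complex.Im a - complex.Im b|.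
  by rewrite -ReB -ImB ler_rnorm_ReIm.
have dx : `|x1 - x0| = x1 - x0 by rewrite ger0_norm ?subr_ge0.
have dy : `|y1 - y0| = y1 - y0 by rewrite ger0_norm ?subr_ge0.
have e1 := E (x1 +i* y0) (x0 +i* y0); have e2 := E (x1 +i* y1) (x1 +i* y0).
have e3 := E (x0 +i* y1) (x1 +i* y1); have e4 := E (x0 +i* y0) (x0 +i* y1).
move: e1 e2 e3 e4; rewrite /= !subrr normr0 !(distrC x0) !(distrC y0) dx dy.
by lra.
Qed.

Lemma rset_diam (x0 x1 y0 y1 : R) (z w : R[i]) :
  rset x0 x1 y0 y1 z -> rset x0 x1 y0 y1 w ->
  rnorm (z - w) <= (x1 - x0) + (y1 - y0).
Proof.
move=> [/andP[a1 a2] /andP[a3 a4]] [/andP[b1 b2] /andP[b3 b4]].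
apply: (le_trans (ler_rnorm_ReIm _)); rewrite ReB ImB.
by apply: lerD; rewrite ler_norml; apply/andP; split; lra.
Qed.

End Rectangle.

(** * Goursat's theorem for rectangles *)

Section Goursat.
Variable (R : realType).
Implicit Types (f g F : R[i] -> R[i]).

Local Notation rint f q w h := (contour_integral (rect q.1 (q.1 + w) q.2 (q.2 + h)) f).

(** The first of the four quarters that carries at least a fourth of the
integral; the last quarter serves as the default value. *)
Definition quarter f (w h : R) (q : R * R) : R * R :=
  let w2 := w / 2 in let h2 := h / 2 in
  let big q' := rnorm (rint f q w h) <= 4 * rnorm (rint f q' w2 h2) in
  if big q then q else if big (q.1 + w2, q.2) then (q.1 + w2, q.2)
  else if big (q.1, q.2 + h2) then (q.1, q.2 + h2)
  else (q.1 + w2, q.2 + h2).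

(** The integrals over the quarters add up to the integral over the rectangle,
so they cannot all be smaller than a fourth of it. *)
Lemma quarter_big f (w h : R) q : 0 < w -> 0 < h ->
  cont_on (rset q.1 (q.1 + w) q.2 (q.2 + h)) f ->
  rnorm (rint f q w h) <= 4 * rnorm (rint f (quarter f w h q) (w / 2) (h / 2)).
Proof.
case: q => x y /= w0 h0 fc.
have sx : x + w = x + w / 2 + w / 2 by lra.
have sy : y + h = y + h / 2 + h / 2 by lra.
have S : rint f (x, y) w h =
    (rint f (x, y) (w / 2) (h / 2) + rint f (x, y + h / 2) (w / 2) (h / 2)) +
    (rint f (x + w / 2, y) (w / 2) (h / 2) + rint f (x + w / 2, y + h / 2) (w / 2) (h / 2)).
  have sub1 (x0 x1 y0 y1 : R) : x <= x0 -> x0 <= x1 -> x1 <= x + w ->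
      y <= y0 -> y0 <= y1 -> y1 <= y + h -> cont_on (rset x0 x1 y0 y1) f.
    by move=> *; apply: sub_cont_on fc; exact: rset_sub.
  rewrite /= (@rint_splitx _ f x (x + w / 2) (x + w)); [|lra|lra| |]; last first.
  - by apply: sub_cont_on fc; apply: rset_hseg; lra.
  - by apply: sub_cont_on fc; apply: ctrace_rect; lra.
  rewrite (@rint_splity _ f x (x + w / 2) y (y + h / 2) (y + h)); [|lra|lra| |]; last first.
  - by apply: sub_cont_on (rset_vseg _ _ _) (sub1 x (x + w / 2) y (y + h) _ _ _ _ _ _); lra.
  - by apply: sub_cont_on (ctrace_rect _ _) (sub1 x (x + w / 2) y (y + h) _ _ _ _ _ _); lra.
  rewrite (@rint_splity _ f (x + w / 2) (x + w) y (y + h / 2) (y + h)); [|lra|lra| |]; last first.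
  - by apply: sub_cont_on (rset_vseg _ _ _) (sub1 (x + w / 2) (x + w) y (y + h) _ _ _ _ _ _); lra.
  - by apply: sub_cont_on (ctrace_rect _ _) (sub1 (x + w / 2) (x + w) y (y + h) _ _ _ _ _ _); lra.
  by rewrite -sx -sy.
rewrite /quarter/=; case: ifPn => // h1; case: ifPn => // h2; case: ifPn => // h3.
move: S h1 h2 h3; rewrite -!ltNge /=; set a := contour_integral _ _; set b := contour_integral _ _.
set c := contour_integral _ _; set d := contour_integral _ _; set e := contour_integral _ _.
move=> S h1 h2 h3.
have H1 := ler_rnormD b c; have H2 := ler_rnormD d e; have H3 := ler_rnormD (b + c) (d + e).
move: H3; rewrite -S => H3; lra.
Qed.

Lemma quarter_in f (w h : R) q : 0 < w -> 0 < h ->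
  let q' := quarter f w h q in
  q.1 <= q'.1 <= q.1 + w / 2 /\ q.2 <= q'.2 <= q.2 + h / 2.
Proof.
move=> w0 h0 /=; rewrite /quarter.
by case: ifP => _ /=; [|case: ifP => _ /=; [|case: ifP => _ /=]];
  split; apply/andP; split; lra.
Qed.

Fixpoint qseq f (w h : R) (q : R * R) n : R * R :=
  if n is m.+1 then quarter f (w / 2 ^+ m) (h / 2 ^+ m) (qseq f w h q m) else q.

Lemma nested_point (x : nat -> R) (w : R) : 0 < w ->
  (forall n, x n <= x n.+1 <= x n + (w / 2 ^+ n) / 2) ->
  exists s, forall n, x n <= s <= x n + w / 2 ^+ n.
Proof.
move=> w0 xn.
have E n : w / 2 ^+ n.+1 = (w / 2 ^+ n) / 2.
  by rewrite exprS invfM mulrCA mulrC.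
have nd : nondecreasing_seq x.
  by apply/nondecreasing_seqP => n; case/andP: (xn n).
have ni : {homo (fun n => x n + w / 2 ^+ n) : n m / (n <= m)%N >-> n >= m}.
  apply/nonincreasing_seqP => n; rewrite E; have := xn n; move: (w / _) => t.
  by lra.
have wn n : 0 < w / 2 ^+ n by rewrite divr_gt0// exprn_gt0.
have ub n m : x m <= x n + w / 2 ^+ n.
  case: (leqP n m) => nm; last first.
    by rewrite (le_trans (nd _ _ (ltnW nm)))// lerDl ltW.
  by apply: le_trans (ni _ _ nm); rewrite lerDl ltW.
exists (sup (range x)) => n; apply/andP; split.
  apply: ub_le_sup; last by exists n.
  by exists (x 0%N + w / 2 ^+ 0) => _ [m _ <-]; exact: ub.
by apply: ge_sup; [exists (x 0%N); exists 0%N|move=> _ [m _ <-]; exact: ub].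
Qed.

(** Goursat's bisection.  Along nested quarters the integral decreases at most
like 4 ^ - n.  At their common point s the function is affine up to
o(|z - s|); affine functions integrate to 0, and what is left integrates to
o(4 ^ - n), perimeter and diameter both being of order 2 ^ - n. *)
Lemma goursat f (x0 x1 y0 y1 : R) : x0 < x1 -> y0 < y1 ->
  (forall z, rset x0 x1 y0 y1 z -> derivable f z 1) ->
  contour_integral (rect x0 x1 y0 y1) f = 0.
Proof.
move=> hx hy fd.
pose w := x1 - x0; pose h := y1 - y0.
have w0 : 0 < w by rewrite subr_gt0.
have h0 : 0 < h by rewrite subr_gt0.
pose q0 : R * R := (x0, y0); pose q := qseq f w h q0.
pose W n := w / 2 ^+ n; pose H n := h / 2 ^+ n.
have Wn n : 0 < W n by rewrite divr_gt0// exprn_gt0.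
have Hn n : 0 < H n by rewrite divr_gt0// exprn_gt0.
have WE n : W n.+1 = W n / 2 by rewrite /W exprS invfM mulrCA mulrC.
have HE n : H n.+1 = H n / 2 by rewrite /H exprS invfM mulrCA mulrC.
have W0 : W 0%N = w by rewrite /W expr0 divr1.
have H0 : H 0%N = h by rewrite /H expr0 divr1.
have qin n : (q n).1 <= (q n.+1).1 <= (q n).1 + W n / 2 /\
             (q n).2 <= (q n.+1).2 <= (q n).2 + H n / 2.
  exact: (quarter_in f (q n) (Wn n) (Hn n)).
have sub n : rset (q n).1 ((q n).1 + W n) (q n).2 ((q n).2 + H n) `<=` rset x0 x1 y0 y1.
  elim: n => [|n IH].
    by apply: rset_sub; rewrite ?W0 ?H0 /= /w /h; lra.
  apply: subset_trans IH; have [] := qin n; rewrite WE HE.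
  by move: (Wn n) (Hn n) (q n.+1) (q n) => ? ? [a b] [a' b'] /= ? ?; apply: rset_sub; lra.
have fcont : cont_on (rset x0 x1 y0 y1) f.
  by move=> z /fd; exact: derivable_continuous_at.
have big n : rnorm (contour_integral (rect x0 x1 y0 y1) f) <=
    4 ^+ n * rnorm (rint f (q n) (W n) (H n)).
  elim: n => [|n IH].
    rewrite expr0 mul1r W0 H0 /q /= /w /h.
    by rewrite (addrC x0) (addrC y0) !subrK.
  apply: (le_trans IH); rewrite exprSr -mulrA ler_wpM2l ?exprn_ge0//.
  by rewrite WE HE; apply: quarter_big => //; exact: sub_cont_on fcont.
have [sx Hsx] := @nested_point (fun n => (q n).1) w w0 (fun n => (qin n).1).
have [sy Hsy] := @nested_point (fun n => (q n).2) h h0 (fun n => (qin n).2).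
pose s := sx +i* sy.
have ins n : rset (q n).1 ((q n).1 + W n) (q n).2 ((q n).2 + H n) s.
  by split; [exact: Hsx|exact: Hsy].
have sin : rset x0 x1 y0 y1 s := sub 0%N _ (ins 0%N).
apply/eqP; rewrite -rnorm_eq0 eq_le rnorm_ge0 andbT.
have := derivable_cder (fd _ sin); set l := derive1 f s => fl.
pose D := w + h; have D0 : 0 < D by rewrite addr_gt0.
apply/ler_addgt0Pr => e e0; rewrite add0r.
have [d d0 Hd] := fl (e / (4 * D ^+ 2)) (divr_gt0 e0 (mulr_gt0 (ltr0Sn _ _) (exprn_gt0 _ D0))).
have [n Hnd] : exists n, D / 2 ^+ n < d.
  have [n Hn'] : exists n, D / d < n.+1%:R.
    by exists (Num.truncn (D / d)); rewrite truncnS_gt// divr_ge0// ltW.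
  exists n; rewrite ltr_pdivrMr ?exprn_gt0// mulrC -ltr_pdivrMr//.
  apply: (lt_le_trans Hn'); rewrite -natrX ler_nat; exact: ltn_expl.
have WH : W n + H n = D / 2 ^+ n by rewrite /W /H -mulrDl.
pose Q := rect (q n).1 ((q n).1 + W n) (q n).2 ((q n).2 + H n).
have cQ : ctrace Q `<=` rset (q n).1 ((q n).1 + W n) (q n).2 ((q n).2 + H n).
  by apply: ctrace_rect; rewrite lerDl ltW.
have fcQ : cont_on (ctrace Q) f.
  by apply: sub_cont_on fcont => z /cQ /sub.
pose P : {poly R[i]} := (f s)%:P + l *: ('X - s%:P).
have PE z : P.[z] = f s + l * (z - s) by rewrite /P !hornerE.
have Pc (S : set R[i]) : cont_on S (horner P) by exact: cont_on_horner.
pose g z := f z + - 1 * P.[z].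
have mc : cont_on (ctrace Q) (fun z => - 1 * P.[z]).
  by apply: (@cont_onM _ _ (fun=> - 1) (horner P)); [exact: cont_on_cst|exact: Pc].
have gc : cont_on (ctrace Q) g by exact: (cont_onD fcQ mc).
have fg : contour_integral Q f = contour_integral Q g.
  rewrite /g (cintD fcQ mc) (cintZ (- 1) (Pc (ctrace Q))).
  by rewrite (cint_horner _ (closed_rect _ _ _ _)) mulr0 addr0.
apply: (le_trans (big n)).
rewrite [contour_integral _ _]fg.
have c0 : 0 <= e / (4 * D ^+ 2).
  by rewrite ltW// divr_gt0// mulr_gt0// exprn_gt0.
have gb z : ctrace Q z -> rnorm (g z) <= e / (4 * D ^+ 2) * (D / 2 ^+ n).
  move=> /cQ Qz; have zs := rset_diam Qz (ins n).
  have {}zs : rnorm (z - s) <= D / 2 ^+ n by rewrite -WH; apply: le_trans zs _; lra.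
  have := Hd z (le_lt_trans zs Hnd).
  have -> : f z - f s - l * (z - s) = g z by rewrite /g PE; ring.
  move=> /le_trans; apply; exact: ler_wpM2l.
have := cint_bound gc gb.
have lQ : clength Q <= 2 * (D / 2 ^+ n).
  have l1 : (q n).1 <= (q n).1 + W n by rewrite lerDl ltW.
  have l2 : (q n).2 <= (q n).2 + H n by rewrite lerDl ltW.
  by apply: (le_trans (clength_rect l1 l2)); rewrite -WH; lra.
have p2 : 0 < (2 : R) ^+ n by rewrite exprn_gt0.
have E4 : 4 ^+ n = 2 ^+ n * 2 ^+ n :> R by rewrite -exprMn; congr (_ ^+ _); lra.
have bD : 0 <= e / (4 * D ^+ 2) * (D / 2 ^+ n).
  by rewrite mulr_ge0// divr_ge0// ltW.
move=> /(ler_wpM2l (exprn_ge0 n (ler0n R 4))) /le_trans; apply.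
have eE : 4 ^+ n * (2 * (e / (4 * D ^+ 2) * (D / 2 ^+ n)) * (2 * (D / 2 ^+ n))) = e.
  by rewrite E4; field; rewrite !gt_eqF.
by rewrite -[leRHS]eE ler_wpM2l ?exprn_ge0// ler_wpM2l// mulr_ge0.
Qed.

End Goursat.

(** * Cauchy's formula for rectangles *)

Section CauchyRect.
Variable (R : realType).
Implicit Types (f g F : R[i] -> R[i]).

Definition two_pi_i : R[i] := (2 * pi)%:C * 'i.

Lemma two_pi_i_neq0 : two_pi_i != 0.
Proof.
rewrite mulf_neq0//.
  by rewrite (inj_eq (@complexI R) _ 0) mulf_neq0// gt_eqF// pi_gt0.
by rewrite eq_complex/= oner_eq0 andbF.
Qed.

Lemma inv_at_cont (S : set R[i]) (z0 : R[i]) : ~ S z0 ->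
  cont_on S (fun z => (z - z0)^-1).
Proof.
move=> Sz0; apply: cont_onV.
  by apply: cont_onD; [exact: cont_on_id|exact: cont_on_cst].
by move=> z Sz; rewrite subr_eq0; apply/eqP => zz0; apply: Sz0; rewrite -zz0.
Qed.

Lemma derivable_inv_at (z0 z : R[i]) : z != z0 -> derivable (fun z => (z - z0)^-1) z 1.
Proof.
move=> zz0; apply: cder_derivable; apply: cderV; first by rewrite subr_eq0.
by apply: cderD; [exact: cder_id|exact: cder_cst].
Qed.

(** Along z = z0 + v (u - i), with u from - 1 to 1, dz / (z - z0) is
(u + i) / (u ^ 2 + 1) du, with primitive ln (u ^ 2 + 1) / 2 + i atan u: the
logarithm returns to its value and the arctangent gains pi / 2. *)
Lemma eint_quarter_turn (z0 v : R[i]) : v != 0 ->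
  eint (fun z => (z - z0)^-1) (z0 + v * (-1 -i* 1), z0 + v * (1 -i* 1)) =
  (pi / 2)%:C * 'i.
Proof.
move=> v0.
pose e := (z0 + v * (-1 -i* 1), z0 + v * (1 -i* 1)).
pose u (t : R) : R := 2 * t - 1.
have eE : e.2 - e.1 = v * 2%:C.
  rewrite /e/=; have -> : (2%:C : R[i]) = (1 -i* 1) - (-1 -i* 1).
    by apply: complex_eqP; rewrite ?ReB ?ImB/=; lra.
  ring.
have ptE t : segment_pt e t - z0 = v * (u t -i* 1).
  rewrite /segment_pt eE /e /=.
  have -> : u t -i* 1 = (-1 -i* 1) + t%:C * 2%:C :> R[i].
    by rewrite /u; apply: complex_eqP; rewrite ?ReD ?ImD ?ReM ?ImM/=; lra.
  ring.
have d0 (t : R) : 0 < u t ^+ 2 + 1 by rewrite ltr_wpDl// sqr_ge0.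
have u0 t : (u t -i* 1 : R[i]) != 0.
  by rewrite eq_complex/= oppr_eq0 oner_eq0 andbF.
have invE t : (u t -i* 1)^-1 = (u t / (u t ^+ 2 + 1)) +i* (u t ^+ 2 + 1)^-1 :> R[i].
  apply: (mulfI (u0 t)); rewrite mulfV//; apply: complex_eqP; rewrite ?ReM ?ImM /=.
    by field; rewrite gt_eqF.
  by field; rewrite gt_eqF.
pose h (t : R) : R[i] := (2 * u t / (u t ^+ 2 + 1)) +i* (2 / (u t ^+ 2 + 1)).
rewrite /eint -/e eE.
have c1 : cont01 (fun t => (segment_pt e t - z0)^-1).
  apply: (@cont01_seg _ (fun z => (z - z0)^-1) e); apply: inv_at_cont => -[t t01 tz].
  by have := ptE t; rewrite tz subrr => /esym/eqP; rewrite mulf_eq0 (negbTE v0) (negbTE (u0 t)).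
have hE t : h t = v * 2%:C * (segment_pt e t - z0)^-1.
  rewrite ptE invfM invE mulrACA mulfV// mul1r.
  by rewrite /h; apply: complex_eqP; rewrite ?ReM ?ImM/=; ring.
have hc : cont01 h.
  have -> : h = fun t => v * 2%:C * (segment_pt e t - z0)^-1 by apply/funext.
  move=> t t01; exact: (continuousM (@cst_continuous _ _ (v * 2%:C) t) (c1 t t01)).
rewrite -(integral01Z (v * 2%:C) c1) (integral01_ext (h2 := h)); last first.
  by move=> t _; rewrite hE.
rewrite (@integral01_FTC _ (fun t => (2^-1 * ln (u t ^+ 2 + 1)) +i* atan (u t)) h hc).
  apply: complex_eqP; rewrite ?ReB ?ImB ?ReM ?ImM /u /=.
    by rewrite mulr1 mulr0 sub0r sqrrN expr1n (_ : 2 - 1 = 1) ?expr1n ?subrr//; lra.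
  by rewrite mulr1 mulr0 sub0r atanN (_ : 2 - 1 = 1) ?atan1//; lra.
move=> t _ /=.
have ud : is_derive t 1 u 2.
  rewrite /u; apply: is_derive_eq; rewrite ?scaler0 ?add0r ?addr0 ?oppr0.
  by rewrite -[_ *: _]/(_ * _); lra.
have qd : is_derive t 1 (fun t => u t ^+ 2 + 1) (4 * u t).
  by apply: is_derive_eq; rewrite addr0 -![_ *: _]/(_ * _) /=; ring.
split.
  have lnd := is_derive1_comp (g := fun t => u t ^+ 2 + 1) (is_derive1_ln (d0 t)) qd.
  apply: (is_derive_eq (is_deriveZ 2^-1 lnd)); rewrite -[_ *: _]/(_ * _).
  by field; rewrite gt_eqF.
have := is_derive1_comp (g := u) (is_derive1_atan (u t)) ud.
by rewrite mulrC addrC.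
Qed.

(** The four sides are quarter turns, for v equal to eta, i eta, - eta and
- i eta. *)
Lemma rect_square_index (a b eta : R) : 0 < eta ->
  contour_integral (rect (a - eta) (a + eta) (b - eta) (b + eta))
    (fun z => (z - (a +i* b))^-1) = two_pi_i.
Proof.
move=> e0; rewrite contour_integralE !big_cons big_nil.
have e0' : (eta%:C : R[i]) != 0 by rewrite (inj_eq (@complexI R) _ 0) gt_eqF.
have ii : ('i : R[i]) != 0 by rewrite eq_complex/= oner_eq0 andbF.
have E1 : ((a - eta) +i* (b - eta), (a + eta) +i* (b - eta)) =
   ((a +i* b) + eta%:C * (-1 -i* 1), (a +i* b) + eta%:C * (1 -i* 1)) :> R[i] * R[i].
  by congr pair; apply: complex_eqP; rewrite ?ReD ?ImD ?ReM ?ImM/=; ring.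
have E2 : ((a + eta) +i* (b - eta), (a + eta) +i* (b + eta)) =
   ((a +i* b) + (eta%:C * 'i) * (-1 -i* 1), (a +i* b) + (eta%:C * 'i) * (1 -i* 1)) :> R[i] * R[i].
  by congr pair; apply: complex_eqP; rewrite ?ReD ?ImD ?ReM ?ImM/=; ring.
have E3 : ((a + eta) +i* (b + eta), (a - eta) +i* (b + eta)) =
   ((a +i* b) + (- eta%:C) * (-1 -i* 1), (a +i* b) + (- eta%:C) * (1 -i* 1)) :> R[i] * R[i].
  by congr pair; apply: complex_eqP; rewrite ?ReD ?ImD ?ReM ?ImM/=; ring.
have E4 : ((a - eta) +i* (b + eta), (a - eta) +i* (b - eta)) =
   ((a +i* b) + (- (eta%:C * 'i)) * (-1 -i* 1), (a +i* b) + (- (eta%:C * 'i)) * (1 -i* 1)) :> R[i] * R[i].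
  by congr pair; apply: complex_eqP; rewrite ?ReD ?ImD ?ReM ?ImM ?ReM ?ImM/=; ring.
rewrite E1 E2 E3 E4 !eint_quarter_turn ?oppr_eq0 ?mulf_neq0//.
by rewrite /two_pi_i; apply: complex_eqP; rewrite ?ReD ?ImD ?ReM ?ImM/=; field.
Qed.

(** The frame between the rectangle and the square splits into four rectangles
that avoid the singularity, to which Goursat's theorem applies. *)
Lemma rect_shrink f (x0 x1 y0 y1 a b eta : R) : 0 < eta ->
  x0 < a - eta -> a + eta < x1 -> y0 < b - eta -> b + eta < y1 ->
  (forall z, rset x0 x1 y0 y1 z -> z != a +i* b -> derivable f z 1) ->
  contour_integral (rect x0 x1 y0 y1) f =
  contour_integral (rect (a - eta) (a + eta) (b - eta) (b + eta)) f.
Proof.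
move=> e0 hx0 hx1 hy0 hy1 fd.
have fc (S : set R[i]) : S `<=` rset x0 x1 y0 y1 -> ~ S (a +i* b) -> cont_on S f.
  move=> SQ Sab z Sz; apply: derivable_continuous_at; apply: fd; first exact: SQ.
  by apply/eqP => zab; apply: Sab; rewrite -zab.
have nab (u v u' v' : R) : u < a -> u' < a -> ~ on_seg (u +i* v, u' +i* v') (a +i* b).
  move=> ua ua' /on_segE[t /andP[t0 t1] [/= A _]]; move: A; case: (lerP t (1/2)) => ?; nra.
have nab2 (u v u' v' : R) : a < u -> a < u' -> ~ on_seg (u +i* v, u' +i* v') (a +i* b).
  move=> ua ua' /on_segE[t /andP[t0 t1] [/= A _]]; move: A; case: (lerP t (1/2)) => ?; nra.
have nab3 (u v u' v' : R) : v < b -> v' < b -> ~ on_seg (u +i* v, u' +i* v') (a +i* b).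
  move=> ua ua' /on_segE[t /andP[t0 t1] [/= _ A]]; move: A; case: (lerP t (1/2)) => ?; nra.
have nab4 (u v u' v' : R) : b < v -> b < v' -> ~ on_seg (u +i* v, u' +i* v') (a +i* b).
  move=> ua ua' /on_segE[t /andP[t0 t1] [/= _ A]]; move: A; case: (lerP t (1/2)) => ?; nra.
have cr (u u' v v' : R) : u < a -> a < u' -> v < b -> b < v' ->
    x0 <= u -> u' <= x1 -> y0 <= v -> v' <= y1 -> cont_on (ctrace (rect u u' v v')) f.
  move=> h1 h2 h3 h4 h5 h6 h7 h8; apply: fc.
    by apply: subset_trans (ctrace_rect _ _) (rset_sub _ _ _ _); lra.
  move=> [e]; rewrite !inE => /or4P[] /eqP -> H.
  - by apply: nab3 H.
  - by apply: nab2 H.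
  - by apply: nab4 H.
  - by apply: nab H.
have go (u u' v v' : R) : u < u' -> v < v' ->
    x0 <= u -> u' <= x1 -> y0 <= v -> v' <= y1 -> ~ rset u u' v v' (a +i* b) ->
    contour_integral (rect u u' v v') f = 0.
  move=> h1 h2 h3 h4 h5 h6 nr; apply: goursat => // z rz; apply: fd.
    by apply: rset_sub rz.
  by apply/eqP => zab; apply: nr; rewrite -zab.
rewrite (@rint_splitx _ f x0 (a - eta) x1 y0 y1); [|lra|lra|apply: cr; lra|]; last first.
  apply: fc; last by apply: nab; lra.
  by apply: rset_hseg; lra.
rewrite [X in X + _]go ?add0r; [|lra..|]; last by move=> [/= ? _]; lra.
rewrite (@rint_splitx _ f (a - eta) (a + eta) x1 y0 y1); [|lra|lra|apply: cr; lra|]; last first.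
  apply: fc; last by apply: nab2; lra.
  by apply: rset_hseg; lra.
rewrite [X in _ + X]go ?addr0; [|lra..|]; last by move=> [/= ? _]; lra.
rewrite (@rint_splity _ f (a - eta) (a + eta) y0 (b - eta) y1); [|lra|lra|apply: cr; lra|]; last first.
  apply: fc; last by apply: nab3; lra.
  by apply: subset_trans (rset_vseg (y0 := y0) (y1 := y1) _ _ _) (rset_sub _ _ _ _); lra.
rewrite [X in X + _]go ?add0r; [|lra..|]; last by move=> [/= _ ?]; lra.
rewrite (@rint_splity _ f (a - eta) (a + eta) (b - eta) (b + eta) y1); [|lra|lra|apply: cr; lra|]; last first.
  apply: fc; last by apply: nab4; lra.
  by apply: subset_trans (rset_vseg (y0 := y0) (y1 := y1) _ _ _) (rset_sub _ _ _ _); lra.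
by rewrite [X in _ + X]go ?addr0//; [lra..|]; move=> [/= _ ?]; lra.
Qed.

(** On a small square around z0 the quotient (f z - f z0) / (z - z0) is bounded,
so its integral is of the order of the side eta. *)
Lemma cauchy_rect f (x0 x1 y0 y1 : R) (z0 : R[i]) :
  x0 < complex.Re z0 < x1 -> y0 < complex.Im z0 < y1 ->
  (forall z, rset x0 x1 y0 y1 z -> derivable f z 1) ->
  contour_integral (rect x0 x1 y0 y1) (fun z => f z * (z - z0)^-1) = two_pi_i * f z0.
Proof.
case: z0 => a b /= /andP[xa ax] /andP[yb by1] fd; set z0 := a +i* b.
have z0in : rset x0 x1 y0 y1 z0 by split; rewrite /= ?ltW.
have := derivable_cder (fd _ z0in); set l := derive1 f z0 => fl.
have [d d0 Hd] := fl 1 ltr01.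
apply: subr0_eq; apply: rnorm_small => eps eps0.
pose M := rnorm l + 1; have M0 : 0 < M by rewrite ltr_wpDl ?rnorm_ge0.
(* small enough for the square to fit in the rectangle, to lie where the
   quotient is bounded by M, and for the final estimate *)
pose eta := Num.min (Num.min ((a - x0) / 2) ((x1 - a) / 2))
  (Num.min (Num.min ((b - y0) / 2) ((y1 - b) / 2)) (Num.min (d / 8) (eps / (16 * M)))).
have eta0 : 0 < eta.
  by rewrite !lt_min !divr_gt0 ?subr_gt0// mulr_gt0.
have : eta <= eta by [].
rewrite {2}/eta !le_min => /andP[/andP[ex0 ex1] /andP[/andP[ey0 ey1] /andP[ed eeps]]].
have dd (z : R[i]) : z != z0 -> derivable (fun z => (z - z0)^-1) z 1 by exact: derivable_inv_at.
rewrite (@rect_shrink _ x0 x1 y0 y1 a b eta)//; [|lra..|]; last first.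
  by move=> z rz zz0; apply: derivableM; [exact: fd|exact: dd].
set Q := rect _ _ _ _.
have Qsub : ctrace Q `<=` rset (a - eta) (a + eta) (b - eta) (b + eta).
  by apply: ctrace_rect; lra.
have Qz0 : ~ ctrace Q z0.
  by move=> [e]; rewrite !inE => /or4P[] /eqP -> /on_segE[t /andP[t0 t1] [/= A B]];
  [move: B|move: A|move: B|move: A]; case: (lerP t (1/2)) => ?; nra.
have Qr z : ctrace Q z -> rset x0 x1 y0 y1 z.
  by move=> /Qsub; apply: rset_sub; lra.
have ic : cont_on (ctrace Q) (fun z => (z - z0)^-1) by exact: inv_at_cont.
have fc : cont_on (ctrace Q) f.
  by move=> z /Qr /fd; exact: derivable_continuous_at.
have mc : cont_on (ctrace Q) (fun z => f z * (z - z0)^-1) by exact: cont_onM.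
have nc : cont_on (ctrace Q) (fun z => - f z0 * (z - z0)^-1).
  by apply: (cont_onM (@cont_on_cst _ _ (- f z0)) ic).
have -> : contour_integral Q (fun z => f z * (z - z0)^-1) - two_pi_i * f z0 =
    contour_integral Q (fun z => f z * (z - z0)^-1 + - f z0 * (z - z0)^-1).
  rewrite (cintD mc nc) (cintZ (- f z0) ic) rect_square_index//.
  by rewrite mulNr (mulrC two_pi_i).
have bd z : ctrace Q z -> rnorm (f z * (z - z0)^-1 + - f z0 * (z - z0)^-1) <= M.
  move=> Qz.
  have zz0 : z - z0 != 0 by rewrite subr_eq0; apply/eqP => E; apply: Qz0; rewrite -E.
  have zd : rnorm (z - z0) < d.
    have z0Q : rset (a - eta) (a + eta) (b - eta) (b + eta) z0.
      by split => /=; apply/andP; split; lra.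
    by apply: (le_lt_trans (rset_diam (Qsub _ Qz) z0Q)); lra.
  rewrite -mulrDl rnormM rnormV ler_pdivrMr ?rnorm_gt0//.
  have := Hd z zd; rewrite mul1r => H.
  have -> : f z - f z0 = (f z - f z0 - l * (z - z0)) + l * (z - z0) by ring.
  by rewrite (le_trans (ler_rnormD _ _))// rnormM /M mulrDl mul1r addrC lerD.
have c1 : cont_on (ctrace Q) (fun z => f z * (z - z0)^-1 + - f z0 * (z - z0)^-1).
  exact: (cont_onD mc nc).
apply: (le_trans (cint_bound c1 bd)).
have l1 : a - eta <= a + eta by lra.
have l2 : b - eta <= b + eta by lra.
have cl := clength_rect l1 l2.
have M2 : 0 <= 2 * M by lra.
apply: (le_trans (ler_wpM2l M2 cl)).
have : eta * (16 * M) <= eps by rewrite -ler_pdivlMr// mulr_gt0.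
by lra.
Qed.

End CauchyRect.

(** * The border of a union of grid cells *)

Section GridBoundary.
Variables (T : eqType) (P : nat -> nat -> T) (S : nat -> nat -> bool) (n : nat).
Hypothesis S_inner : forall i j, S i j -> (0 < i < n)%N && (0 < j < n)%N.

Definition hedge i j := (P i j, P i.+1 j).
Definition vedge i j := (P i j, P i j.+1).
Definition redge (e : T * T) := (e.2, e.1).

Definition cell_boundary i j : seq (T * T) :=
  [:: hedge i j; vedge i.+1 j; redge (hedge i j.+1); redge (vedge i j)].

(** An edge shared by two selected cells is left out: it is run through in both
directions. *)
Definition cell_border i j : seq (T * T) :=
  if S i j then
    (if S i j.-1 then [::] else [:: hedge i j]) ++
    (if S i.+1 j then [::] else [:: vedge i.+1 j]) ++
    (if S i j.+1 then [::] else [:: redge (hedge i j.+1)]) ++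
    (if S i.-1 j then [::] else [:: redge (vedge i j)])
  else [::].

Definition border : seq (T * T) :=
  flatten [seq flatten [seq cell_border i j | j <- iota 0 n] | i <- iota 0 n].

(** The edges shared by two selected cells contribute opposite values; collected
in a (horizontal edges) and b (vertical edges), these contributions telescope
along columns and rows. *)
Lemma sum_border (M : comNzRingType) (F : T * T -> M) :
  (forall i j, S i j -> S i j.+1 -> F (redge (hedge i j.+1)) = - F (hedge i j.+1)) ->
  (forall i j, S i j -> S i.+1 j -> F (redge (vedge i.+1 j)) = - F (vedge i.+1 j)) ->
  \sum_(e <- border) F e =
  \sum_(0 <= i < n) \sum_(0 <= j < n | S i j) \sum_(e <- cell_boundary i j) F e.
Proof.
move=> FH FV.
have S0r i j : (n <= j)%N -> S i j = false.
  by move=> nj; apply/negP => /S_inner /andP[_ /andP[_]]; rewrite ltnNge nj.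
have S0l i j : (n <= i)%N -> S i j = false.
  by move=> nj; apply/negP => /S_inner /andP[/andP[_ +] _]; rewrite ltnNge nj.
have Sr0 i : S i 0%N = false by apply/negP => /S_inner /andP[_].
have Sl0 j : S 0%N j = false by apply/negP => /S_inner.
pose a i j := if S i j && S i j.-1 then F (hedge i j) else 0.
pose b i j := if S i j && S i.-1 j then F (vedge i j) else 0.
have cellE i j : (if S i j then \sum_(e <- cell_boundary i j) F e else 0) =
    \sum_(e <- cell_border i j) F e + (a i j - a i j.+1) + (b i.+1 j - b i j).
  rewrite /a /b /cell_border /cell_boundary /=.
  have [Sij|nSij] := boolP (S i j); last first.
    by rewrite big_nil !andbF/= !subrr !addr0.
  have Fh : S i j.+1 -> F (redge (hedge i j.+1)) = - F (hedge i j.+1) by exact: FH.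
  have Fv : S i.+1 j -> F (vedge i.+1 j) = F (vedge i.+1 j) by [].
  have Fv' : S i.-1 j -> F (redge (vedge i j)) = - F (vedge i j).
    case: i Sij {Fh Fv} => [|i] Sij; first by rewrite Sl0.
    by move=> Si; apply: FV.
  rewrite /= !andbT !big_cat/= !big_cons !big_nil.
  case: (S i j.+1) Fh => [/(_ isT) E1|_]; case: (S i.-1 j) Fv' => [/(_ isT) E2|_];
  rewrite ?E1 ?E2;
  case: (S i j.-1); case: (S i.+1 j); rewrite ?big_cons ?big_nil;
  do 4 (try move: (F _) => ?); ring.
rewrite big_flatten/= big_map /index_iota subn0.
under [RHS]eq_bigr do rewrite big_mkcond.
under [RHS]eq_bigr => i _ do (under eq_bigr => j _ do rewrite cellE).
have -> : \sum_(i <- iota 0 n) \sum_(j <- iota 0 n)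
   (\sum_(e <- cell_border i j) F e + (a i j - a i j.+1) + (b i.+1 j - b i j)) =
   \sum_(i <- iota 0 n) \sum_(j <- iota 0 n) \sum_(e <- cell_border i j) F e +
   \sum_(i <- iota 0 n) \sum_(j <- iota 0 n) (a i j - a i j.+1) +
   \sum_(j <- iota 0 n) \sum_(i <- iota 0 n) (b i.+1 j - b i j).
  rewrite [X in _ = _ + X]exchange_big/= -!big_split/=; apply: eq_bigr => i _.
  by rewrite -!big_split.
have tel (f : nat -> M) : \sum_(i <- iota 0 n) (f i.+1 - f i) = f n - f 0%N.
  by have := telescope_sumr f (leq0n n); rewrite /index_iota subn0.
rewrite [X in _ + X + _]big1 ?addr0; last first.
  move=> i _; under eq_bigr do rewrite -opprB.
  by rewrite sumrN tel /a Sr0 S0r// subrr oppr0.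
rewrite [X in _ = _ + X]big1 ?addr0; last first.
  by move=> j _; rewrite (tel (b ^~ j)) /b Sl0 S0l// subrr.
by apply: eq_bigr => i _; rewrite big_flatten/= big_map.
Qed.

(** Counting the starting points minus the end points that lie in a given set is
a sum over the edges; it vanishes over the boundary of each cell, and hence by
sum_border over the border. *)
Lemma closed_border : perm_eq [seq e.1 | e <- border] [seq e.2 | e <- border].
Proof.
apply/permP => a.
have H : \sum_(e <- border) ((a e.1 : nat)%:Z - (a e.2 : nat)%:Z) = 0.
  rewrite (@sum_border int (fun e => (a e.1 : nat)%:Z - (a e.2 : nat)%:Z)).
  - apply: big1 => i _; apply: big1 => j _.
    by rewrite !big_cons big_nil /=; ring.
  - by move=> i j _ _ /=; rewrite opprB.
  - by move=> i j _ _ /=; rewrite opprB.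
move: H; rewrite sumrB => /eqP; rewrite subr_eq0 => /eqP H.
rewrite -!sum1_count !big_map.
have E (g : T * T -> bool) :
    (\sum_(e <- border | g e) 1)%N%:Z = \sum_(e <- border) (g e : nat)%:Z.
  elim: (border) => [|e s IH]; rewrite ?big_nil ?big_cons//.
  by case: (g e); rewrite ?PoszD IH// add0r.
by apply/eqP; rewrite -eqz_nat (E (fun e => a e.1)) (E (fun e => a e.2)) H.
Qed.

Lemma border_edge e : e \in border -> exists i j, S i j /\
  [\/ e = hedge i j /\ ~~ S i j.-1,
      e = vedge i.+1 j /\ ~~ S i.+1 j,
      e = redge (hedge i j.+1) /\ ~~ S i j.+1 |
      e = redge (vedge i j) /\ ~~ S i.-1 j].
Proof.
move=> /flattenP[s /mapP[i _ ->] /flattenP[s' /mapP[j _ ->]]].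
rewrite /cell_border; case: ifP => // Sij H; exists i, j; split => //.
move: H; rewrite !mem_cat; case/or4P; case: ifPn => //; rewrite inE => nS /eqP ->.
- by constructor 1.
- by constructor 2.
- by constructor 3.
- by constructor 4.
Qed.

End GridBoundary.

(** * Contours around compact sets *)

Section Compactness.
Variable (R : realType).

Definition rbounded (K : set R[i]) := exists M : R, forall z, K z -> rnorm z <= M.

Lemma closed_bounded_compact (K : set R[i]) : closed K -> rbounded K -> compact K.
Proof.
move=> Kc [M KM].
pose c (p : R * R) : R[i] := p.1 +i* p.2.
have cc : continuous c.
  move=> p P /nbhs_rnormP[e e0 He].
  have : nbhs p [set q | `|q.1 - p.1| < e / 2 /\ `|q.2 - p.2| < e / 2].
    have e2 : 0 < e / 2 by rewrite divr_gt0.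
    exists (ball p.1 (e / 2), ball p.2 (e / 2)) => /=.
      by split; exact: nbhsx_ballx.
    by move=> q /= [q1 q2]; split; rewrite distrC.
  apply: filterS => q [q1 q2]; apply: He.
  by apply: (le_lt_trans (ler_rnorm_ReIm _)); rewrite ReB ImB /=; lra.
apply: (subclosed_compact Kc (B := c @` (`[-M, M] `*` `[-M, M]))).
  apply: continuous_compact; first exact: continuous_subspaceT.
  by apply: compact_setX; exact: segment_compact.
move=> z Kz; exists (complex.Re z, complex.Im z); last by case: (z).
have zM := KM _ Kz.
split; rewrite /= in_itv/= -ler_norml; apply: le_trans zM.
  exact: ler_Re_rnorm.
exact: ler_Im_rnorm.
Qed.

(** Compactness as near covering: the radii that work around the points of K have
a common positive value. *)
Lemma compact_margin (K U : set R[i]) : compact K -> open U -> K `<=` U ->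
  exists2 d : R, 0 < d & forall z w, K z -> rnorm (w - z) < d -> U w.
Proof.
move=> /compact_near_coveringP Kc Uo KU.
have := Kc R (0^'+) (fun d z => forall w, rnorm (w - z) < d -> U w) _.
case.
  move=> x Kx.
  have /nbhs_rnormP[e e0 He] : nbhs x U by apply: open_nbhs_nbhs; split => //; exact: KU.
  have e2 : 0 < e / 2 by rewrite divr_gt0.
  exists ([set y | rnorm (y - x) < e / 2], [set d | d < e / 2]) => /=.
    split; first by apply/nbhs_rnormP; exists (e / 2).
    exact: nbhs_right_lt.
  move=> [y d] /= [yx de] w wy; apply: He.
  by apply: (le_lt_trans (ler_rdistD y _ _)); lra.
move=> d /= d0 Hd; exists (d / 2); first by rewrite divr_gt0.
move=> z w Kz; apply: (Hd (d / 2)) => //=; last by rewrite divr_gt0.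
by rewrite sub0r normrN gtr0_norm ?divr_gt0//; lra.
Qed.

Lemma ctrace_max (G : contour R) (k : R[i] -> R) :
  (forall w, ctrace G w -> {for w, continuous k}) ->
  exists M, forall w, ctrace G w -> k w <= M.
Proof.
elim: G => [|e G IH] kc; first by exists 0 => w [].
have [|M HM] := IH.
  by move=> w [e' eG ew]; apply: kc; exists e' => //; rewrite inE eG orbT.
have [|c c01 Hc] := @EVT_max R (fun t => k (segment_pt e t)) 0 1 ler01.
  apply: continuous_in_subspaceT => t; rewrite inE/= in_itv/= => t01.
  apply: (@continuous_comp _ _ _ (segment_pt e) k).
    exact: continuous_segment_pt.
  by apply: kc; exists e; [rewrite inE eqxx|exists t].
exists (Num.max M (k (segment_pt e c))) => w [e']; rewrite inE => /orP[/eqP ->|eG].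
  by move=> [t t01 <-]; rewrite le_max Hc ?orbT// in_itv.
by move=> ew; rewrite le_max HM//; exists e'.
Qed.

Lemma ctrace_bounded (G : contour R) (f : R[i] -> R[i]) : cont_on (ctrace G) f ->
  exists2 M : R, 0 <= M & forall w, ctrace G w -> rnorm (f w) <= M.
Proof.
move=> fc; have [|M HM] := @ctrace_max G (fun w => rnorm (f w)).
  move=> w Gw; apply: (@continuous_comp _ _ _ f (@rnorm R _)); first exact: fc.
  exact: continuous_rnorm.
exists (Num.max 0 M); first by rewrite le_max lexx.
by move=> w Gw; rewrite le_max HM ?orbT.
Qed.

Lemma ctrace_away (G : contour R) (f : R[i] -> R[i]) : cont_on (ctrace G) f ->
  (forall w, ctrace G w -> f w != 0) ->
  exists2 m : R, 0 < m & forall w, ctrace G w -> m <= rnorm (f w).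
Proof.
move=> fc f0; have [M M0 HM] := ctrace_bounded (cont_onV fc f0).
exists (M + 1)^-1; first by rewrite invr_gt0 ltr_wpDl.
move=> w Gw; have := HM _ Gw; rewrite rnormV => H.
have p : 0 < rnorm (f w) by rewrite rnorm_gt0 f0.
rewrite -[leRHS]invrK lef_pV2 ?posrE ?invr_gt0 ?ltr_wpDl//.
by rewrite (le_trans H)// lerDl.
Qed.

Lemma ctrace_dist (G : contour R) z0 : ~ ctrace G z0 ->
  exists2 m : R, 0 < m & forall w, ctrace G w -> m <= rnorm (w - z0).
Proof.
move=> Gz0; apply: ctrace_away.
  by apply: cont_onD; [exact: cont_on_id|exact: cont_on_cst].
by move=> w Gw; rewrite subr_eq0; apply/eqP => E; apply: Gz0; rewrite -E.
Qed.

(** The difference of the integrands at z and at z0 is z - z0 times a function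
that stays bounded, since z0 has a positive distance to the trace. *)
Lemma cauchy_transform_cont (G : contour R) h z0 :
  cont_on (ctrace G) h -> ~ ctrace G z0 ->
  {for z0, continuous (fun z => contour_integral G (fun w => h w * (w - z)^-1))}.
Proof.
move=> hc Gz0; have [m m0 Hm] := ctrace_dist Gz0.
have [M M0 HM] := ctrace_bounded hc.
apply/continuous_rnormP => e e0.
pose C := 2 * (M * (2 / m ^+ 2)) * clength G.
have C0 : 0 <= C.
  by rewrite mulr_ge0 ?clength_ge0// mulr_ge0// mulr_ge0// divr_ge0// exprn_ge0// ltW.
exists (Num.min (m / 2) (e / (C + 1))).
  by rewrite lt_min !divr_gt0// ltr_wpDl.
move=> z; rewrite lt_min => /andP[zm ze].
have wz w : ctrace G w -> m / 2 <= rnorm (w - z).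
  by move=> /Hm; have := ler_rdistD z w z0; lra.
have wz0 w : ctrace G w -> w - z0 != 0.
  by move=> /Hm; rewrite -rnorm_gt0; exact: lt_le_trans.
have wz0' w : ctrace G w -> w - z != 0.
  by move=> /wz; rewrite -rnorm_gt0; apply: lt_le_trans; rewrite divr_gt0.
have c1 (v : R[i]) : (forall w, ctrace G w -> w - v != 0) ->
    cont_on (ctrace G) (fun w => h w * (w - v)^-1).
  move=> H; apply: (cont_onM hc); apply: cont_onV; last exact: H.
  by apply: cont_onD; [exact: cont_on_id|exact: cont_on_cst].
have cz := c1 z wz0'; have cz0 := c1 z0 wz0.
have cn : cont_on (ctrace G) (fun w => - 1 * (h w * (w - z0)^-1)).
  by apply: (cont_onM (@cont_on_cst _ _ (- 1)) cz0).
have -> : contour_integral G (fun w => h w * (w - z)^-1) -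
   contour_integral G (fun w => h w * (w - z0)^-1) =
   contour_integral G (fun w => h w * (w - z)^-1 + - 1 * (h w * (w - z0)^-1)).
  by rewrite (cintD cz cn) (cintZ (- 1) cz0) mulN1r.
have bd w : ctrace G w ->
    rnorm (h w * (w - z)^-1 + - 1 * (h w * (w - z0)^-1)) <=
    M * (2 / m ^+ 2) * rnorm (z - z0).
  move=> Gw; have a1 := wz0 _ Gw; have a2 := wz0' _ Gw.
  have -> : h w * (w - z)^-1 + - 1 * (h w * (w - z0)^-1) =
     h w * ((w - z)^-1 * (w - z0)^-1) * (z - z0).
    have -> : z - z0 = (w - z0) - (w - z) by ring.
    by move: a1 a2; move: (w - z) (w - z0) (h w) => a b c a1 a2; field; rewrite a1 a2.
  rewrite !rnormM !rnormV ler_wpM2r ?rnorm_ge0// ler_pM ?rnorm_ge0//.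
  - by rewrite mulr_ge0// invr_ge0 rnorm_ge0.
  - exact: HM.
  have := Hm _ Gw; have := wz _ Gw => b1 b2.
  have -> : 2 / m ^+ 2 = (m / 2)^-1 * m^-1 by field; rewrite gt_eqF.
  apply: ler_pM; rewrite ?invr_ge0 ?rnorm_ge0// lef_pV2// ?posrE ?rnorm_gt0//.
  by rewrite divr_gt0.
apply: (le_lt_trans (cint_bound (cont_onD cz cn) bd)).
have -> : 2 * (M * (2 / m ^+ 2) * rnorm (z - z0)) * clength G = C * rnorm (z - z0).
  by rewrite /C; ring.
rewrite (@le_lt_trans _ _ ((C + 1) * rnorm (z - z0)))//.
  by rewrite ler_wpM2r ?rnorm_ge0// lerDl.
by rewrite mulrC -ltr_pdivlMr// ltr_wpDl.
Qed.

End Compactness.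

Section GridContour.
Variable (R : realType).
Variables (K U : set R[i]).
Hypotheses (Kc : closed K) (Kb : rbounded K) (Uo : open U) (KU : K `<=` U).

(** Cut the plane into squares so small that each closed cell which meets K lies
in U, and take the border of the union of these cells.  For z in the interior
of a selected cell, Cauchy's formula for this cell and Goursat's theorem for
the others add up to the claim.  A point of K may lie on a grid line, but not
on the border; it is a limit of interior points, and both sides are continuous
there. *)
Lemma grid_contour : exists G : contour R, surrounds G K U /\
  forall f, holomorphic_on U f -> forall z, K z ->
    contour_integral G (fun w => f w * (w - z)^-1) = two_pi_i R * f z.
Proof.
have [M0 KM0] := Kb.
pose M : R := `|M0|.
have KM z : K z -> rnorm z <= M by move=> /KM0 /le_trans; apply; exact: ler_norm.
have MM : 0 <= M by exact: normr_ge0.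
have [d d0 Hd] := compact_margin (closed_bounded_compact Kc Kb) Uo KU.
(* the diameter of a cell is then less than d *)
pose h := d / 4; have h0 : 0 < h by rewrite divr_gt0.
(* two more cells on each side keep the selected cells inside the grid *)
pose L := M + 2 * h.
pose x (i : nat) : R := - L + i%:R * h.
have xS i : x i.+1 = x i + h by rewrite /x -natr1 mulrDl mul1r addrA.
have xlt i : x i < x i.+1 by rewrite xS ltrDl.
have xmono i j : (i <= j)%N -> x i <= x j.
  by move=> ij; rewrite /x lerD2l ler_wpM2r ?ler_nat ?(ltW h0).
pose cell i j := rset (x i) (x i.+1) (x j) (x j.+1).
pose P i j : R[i] := x i +i* x j.
pose S i j := `[< exists2 z, K z & cell i j z >].
pose n := (Num.truncn ((2 * M + 4 * h) / h)).+1.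
have nh : 2 * M + 4 * h < n%:R * h.
  by rewrite -ltr_pdivrMr// /n truncnS_gt// divr_ge0 ?ltW//; lra.
have xbd i (t : R) : - M <= t <= M -> x i <= t <= x i.+1 -> (0 < i < n)%N.
  move=> /andP[t1 t2] /andP[x1 x2]; apply/andP; split.
    case: i x1 x2 => // _; rewrite xS /x mul0r /L; lra.
  rewrite ltnNge; apply/negP => ni; have := xmono _ _ ni; move: nh x1; rewrite /x /L; lra.
have KR z : K z -> (- M <= complex.Re z <= M) /\ (- M <= complex.Im z <= M).
  move=> /KM zM; split; rewrite -ler_norml; apply: le_trans zM.
    exact: ler_Re_rnorm.
  exact: ler_Im_rnorm.
have S_inner i j : S i j -> (0 < i < n)%N && (0 < j < n)%N.
  by move=> /asboolP[z /KR[z1 z2] [c1 c2]]; rewrite (xbd _ _ z1 c1) (xbd _ _ z2 c2).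
have cover (t : R) : - M <= t <= M -> exists i, x i <= t <= x i.+1.
  move=> /andP[t1 t2]; exists (Num.truncn ((t + L) / h)).
  have tL : 0 <= (t + L) / h by rewrite divr_ge0 ?ltW// /L; lra.
  have /andP[] := truncn_itv tL.
  move: (Num.truncn _) => i; rewrite ler_pdivlMr// ltr_pdivrMr// /x -natr1 mulrDl.
  by move=> i1 i2; apply/andP; split; lra.
have cellU i j : S i j -> cell i j `<=` U.
  move=> /asboolP[z Kz cz] w cw; apply: (Hd _ _ Kz).
  by apply: (le_lt_trans (rset_diam cw cz)); rewrite !xS /h; lra.
have SK i j z : K z -> cell i j z -> S i j.
  by move=> Kz cz; apply/asboolP; exists z.
pose G : contour R := border P S n.
have cP i j i' j' : (i <= i' <= i.+1)%N -> (j <= j' <= j.+1)%N -> cell i j (P i' j').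
  move=> /andP[i1 i2] /andP[j1 j2].
  by split; rewrite /= !xmono.
have edge_cell i j a b : cell i j a -> cell i j b -> on_seg (a, b) `<=` cell i j.
  exact: on_seg_rset.
have le1 k : (k <= k <= k.+1)%N by rewrite leqnn leqnSn.
have le2 k : (k <= k.+1 <= k.+1)%N by rewrite leqnn leqnSn.
have le3 k : (0 < k)%N -> (k.-1 <= k <= k.-1.+1)%N by case: k.
have Gedge e : e \in G -> on_seg e `<=` [set w | U w /\ ~ K w].
  move=> eG w ew.
  suff [i [j [i' [j' [Sij nS c1 c2]]]]] : exists i j i' j', [/\ S i j, ~~ S i' j', cell i j w & cell i' j' w].
    split; first exact: cellU c1.
    by move=> Kw; move: nS; rewrite (SK i' j' w).
  have := border_edge eG; move=> [i [j [Sij H]]].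
  have /andP[/andP[i0 _] /andP[j0 _]] := S_inner _ _ Sij.
  case: H => -[eE nS]; [exists i, j, i, j.-1|exists i, j, i.+1, j|exists i, j, i, j.+1|exists i, j, i.-1, j];
  split => //; move: ew; rewrite eE; apply: edge_cell; apply: cP;
  by [exact: le1 | exact: le2 | exact: le3].
have Gtr w : ctrace G w -> U w /\ ~ K w by move=> [e eG]; exact: Gedge.
have bcell i j e : e \in cell_boundary P i j -> on_seg e `<=` cell i j.
  by rewrite !inE => /or4P[] /eqP ->; apply: edge_cell; apply: cP; rewrite ?leqnn ?leqnSn.
have sumG g : (forall i j e, S i j -> e \in cell_boundary P i j -> cont_on (on_seg e) g) ->
    contour_integral G g = \sum_(0 <= i < n) \sum_(0 <= j < n | S i j)
      contour_integral (rect (x i) (x i.+1) (x j) (x j.+1)) g.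
  move=> gc; rewrite contour_integralE (@sum_border _ P S n S_inner _ (eint g))//.
    move=> i j Sij Sij1; apply: eint_rev; apply: (gc i j.+1) => //.
    by rewrite inE eqxx.
  move=> i j Sij Sij1; apply: eint_rev; apply: (gc i j) => //.
  by rewrite !inE eqxx orbT.
have noline i j (t : R) : x i < t < x i.+1 -> t != x j.
  move=> /andP[t1 t2]; apply/eqP => tj; case: (leqP j i) => ij.
    by have := xmono _ _ ij; lra.
  by have := xmono _ _ ij; lra.
have onb i j e w : e \in cell_boundary P i j -> on_seg e w ->
    exists k, complex.Re w = x k \/ complex.Im w = x k.
  rewrite !inE => /or4P[] /eqP -> /on_segE[t _ [/= wR wI]].
  - by exists j; right; rewrite wI subrr mulr0 addr0.
  - by exists i.+1; left; rewrite wR subrr mulr0 addr0.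
  - by exists j.+1; right; rewrite wI subrr mulr0 addr0.
  - by exists i; left; rewrite wR subrr mulr0 addr0.
have offline i j z e : x i < complex.Re z < x i.+1 -> x j < complex.Im z < x j.+1 ->
    forall i' j', e \in cell_boundary P i' j' -> ~ on_seg e z.
  move=> zR zI i' j' eb /(onb _ _ _ _ eb)[k [] /eqP]; apply/negP.
    exact: (noline i k _ zR).
  exact: (noline j k _ zI).
have other i j i' j' z : x i < complex.Re z < x i.+1 -> x j < complex.Im z < x j.+1 ->
    cell i' j' z -> i' = i /\ j' = j.
  have aux k k' (t : R) : x k < t < x k.+1 -> x k' <= t <= x k'.+1 -> k' = k.
    move=> /andP[t1 t2] /andP[t3 t4]; apply/eqP; case: ltngtP => // kk.
      by have := xmono _ _ kk; lra.
    by have := xmono _ _ kk; lra.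
  by move=> zR zI [/(aux _ _ _ zR) -> /(aux _ _ _ zI) ->].
have derinv z (w : R[i]) : w != z -> derivable (fun w => (w - z)^-1) w 1.
  exact: derivable_inv_at.
have interior f i j z : holomorphic_on U f -> S i j ->
    x i < complex.Re z < x i.+1 -> x j < complex.Im z < x j.+1 ->
    contour_integral G (fun w => f w * (w - z)^-1) = two_pi_i R * f z.
  move=> fU Sij zR zI.
  have /andP[/andP[_ iN] /andP[_ jN]] := S_inner _ _ Sij.
  rewrite sumG; last first.
    move=> i' j' e Sij' eb; apply: cont_onM.
      move=> w ew; apply: derivable_continuous_at; apply: fU.
      by apply: (cellU _ _ Sij'); exact: bcell ew.
    by apply: inv_at_cont; exact: (offline i j z e zR zI i' j' eb).
  have termE i' j' : S i' j' ->
      contour_integral (rect (x i') (x i'.+1) (x j') (x j'.+1)) (fun w => f w * (w - z)^-1) =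
      if (i' == i) && (j' == j) then two_pi_i R * f z else 0.
    move=> Sij'; case: ifPn => [/andP[/eqP -> /eqP ->]|ne].
      by apply: cauchy_rect => // w cw; apply: fU; exact: cellU cw.
    apply: goursat => // w cw; apply: derivableM.
      by apply: fU; exact: (cellU _ _ Sij').
    apply: derinv; apply/eqP => wz; move: ne; rewrite wz in cw.
    by have [-> ->] := other _ _ _ _ _ zR zI cw; rewrite !eqxx.
  under eq_bigr => i' _ do (under eq_bigr => j' Sij' do rewrite (termE _ _ Sij')).
  rewrite (bigD1_seq i) ?mem_index_iota ?iota_uniq//= big_mkcond/=.
  rewrite (bigD1_seq j) ?mem_index_iota ?iota_uniq//= Sij !eqxx/=.
  rewrite big1 ?addr0; last by move=> k /negbTE ->; case: (S i k).
  by rewrite big1 ?addr0// => k /negbTE ->; rewrite big1.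
have formula f z : holomorphic_on U f -> K z ->
    contour_integral G (fun w => f w * (w - z)^-1) = two_pi_i R * f z.
  move=> fU Kz.
  have [[zR zI]] := (KR _ Kz, tt); move=> _.
  have [i Hi] := cover _ zR; have [j Hj] := cover _ zI.
  have cz : cell i j z by [].
  have Sij := SK _ _ _ Kz cz.
  have fc : cont_on (ctrace G) f.
    by move=> w /Gtr[Uw _]; apply: derivable_continuous_at; exact: fU.
  have zG : ~ ctrace G z by move=> /Gtr[].
  have tc := cauchy_transform_cont fc zG.
  have fz : {for z, continuous f}.
    by apply: derivable_continuous_at; apply: fU; exact: KU.
  pose Phi z := contour_integral G (fun w => f w * (w - z)^-1) + - (two_pi_i R) * f z.
  have Pc : {for z, continuous Phi}.
    apply: (continuousD tc); exact: (continuousM (@cst_continuous _ _ (- two_pi_i R) z) fz).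
  suff : Phi z = 0.
    by move=> /eqP; rewrite /Phi mulNr subr_eq0 => /eqP.
  apply: rnorm_small => eps eps0.
  move/continuous_rnormP: Pc => /(_ eps eps0)[dl dl0 Hdl].
  pose c0 : R[i] := (x i + h / 2) +i* (x j + h / 2).
  have cc : cell i j c0 by split; rewrite /= xS; apply/andP; split; lra.
  pose s := Num.min 1 (dl / (4 * h)).
  have s0 : 0 < s by rewrite lt_min ltr01 divr_gt0// mulr_gt0.
  have s1 : s <= 1 by rewrite ge_min lexx.
  have s2 : s * (4 * h) <= dl by rewrite -ler_pdivlMr ?mulr_gt0// ge_min lexx orbT.
  (* c0 is the centre of the cell; moving towards it leaves the grid lines *)
  pose z' := z + s%:C * (c0 - z).
  have z'R : x i < complex.Re z' < x i.+1.
    rewrite /z' ReD ReM ReB /= mul0r subr0 xS; move: Hi; rewrite xS => /andP[? ?].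
    by apply/andP; split; nra.
  have z'I : x j < complex.Im z' < x j.+1.
    rewrite /z' ImD ImM ImB /= mul0r addr0 xS; move: Hj; rewrite xS => /andP[? ?].
    by apply/andP; split; nra.
  have zz' : rnorm (z' - z) < dl.
    rewrite /z' addrC addKr rnormM rnormR gtr0_norm//.
    have := rset_diam cc cz; rewrite !xS => H; nra.
  have := Hdl _ zz'; rewrite {1}/Phi (interior f i j z' fU Sij z'R z'I) mulNr subrr sub0r.
  by rewrite rnormN => /ltW.
exists G; split; last by move=> f fU z; exact: formula.
split.
- exact: closed_border.
- by move=> e eG t t01; apply: (Gedge e eG); exists t.
- move=> z Kz; rewrite /winding_index -/(two_pi_i R).
  have := formula (fun=> 1) z (fun w _ => cder_derivable (cder_cst 1 w)) Kz.
  rewrite mulr1 (cint_ext (g := fun w => (w - z)^-1)) => [->|w _].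
    by rewrite mulVf// two_pi_i_neq0.
  by rewrite mul1r.
- move=> z Uz; rewrite /winding_index.
  have zc i j : S i j -> ~ cell i j z by move=> Sij /(cellU _ _ Sij).
  rewrite sumG; last first.
    by move=> i j e Sij eb; apply: inv_at_cont => /(bcell _ _ _ eb); exact: zc.
  rewrite big1 ?mulr0// => i _; rewrite big1// => j Sij.
  apply: goursat => // w cw; apply: derinv; apply/eqP => wz.
  by apply: (zc _ _ Sij); rewrite -wz.
Qed.

End GridContour.

(** * Winding numbers *)

Section Index.
Variable (R : realType).
Implicit Types (G : contour R) (f : R[i] -> R[i]).

Lemma geometric_le (a b C t : R) : 0 <= t -> t < 1 ->
  (forall N, a <= b + C * t ^+ N) -> a <= b.
Proof.
move=> t0 t1 H; apply/ler_addgt0Pr => e e0.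
have : (fun N => C * t ^+ N) @ \oo --> C * 0.
  by apply: cvgMr; apply: cvg_expr; rewrite ger0_norm.
rewrite mulr0 => /cvgrPdist_lt/(_ e e0)[N _ HN].
have := HN N (leqnn N); rewrite /= sub0r normrN => h.
apply: (le_trans (H N)); rewrite lerD2l; apply: le_trans (ltW h); exact: ler_norm.
Qed.

Lemma geometric_zero (x : R[i]) (C : R) : (forall N, rnorm x <= C * 2^-1 ^+ N) -> x = 0.
Proof.
move=> H; apply/eqP; rewrite -rnorm_eq0 eq_le rnorm_ge0 andbT.
by apply: (@geometric_le _ _ C 2^-1) => [||N]; rewrite ?add0r//; lra.
Qed.

Lemma cont_onZ (S : set R[i]) (c : R[i]) f : cont_on S f -> cont_on S (fun z => c * f z).
Proof. by move=> fc; exact: (cont_onM (@cont_on_cst _ _ c) fc). Qed.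

Lemma cont_on_sub (S : set R[i]) (a : R[i]) : cont_on S (fun w => w - a).
Proof. by apply: cont_onD; [exact: cont_on_id|exact: cont_on_cst]. Qed.

Lemma cint_sub_pow G (a : R[i]) n : closed_chain G -> ~ ctrace G a ->
  contour_integral G (fun w => (w - a)^-1 ^+ n.+2) = 0.
Proof.
move=> Gc Ga.
have wa w : ctrace G w -> w - a != 0.
  by move=> Gw; rewrite subr_eq0; apply/eqP => E; apply: Ga; rewrite -E.
apply: (@cint_FTC _ G (fun w => - n.+1%:R^-1 * (w - a)^-1 ^+ n.+1)) => //.
  by apply: cont_onX; exact: inv_at_cont.
move=> w Gw.
have d1 : cder (fun w => (w - a)^-1) w (- (w - a) ^- 2 * (1 + 0)).
  apply: cderV; first exact: wa.
  by apply: cderD; [exact: cder_id|exact: cder_cst].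
apply: (cder_eq (cderM (cder_cst (- n.+1%:R^-1) w) (cderX n.+1 d1))).
have n0 : (n.+1%:R : R[i]) != 0 by rewrite pnatr_eq0.
move: n0 (wa _ Gw); rewrite /=; move: (n.+1%:R : R[i]) (w - a) => k v k0 v0.
rewrite !exprS; move: (v^-1 ^+ n) => x.
by field; rewrite k0 v0.
Qed.

(** Expand 1 / (w - z) in powers of (z - a) / (w - a).  All terms but the first
have a primitive along G, and the remainder decreases geometrically. *)
Lemma index_locally_constant G (a : R[i]) : closed_chain G -> ~ ctrace G a ->
  exists2 d : R, 0 < d & forall z, rnorm (z - a) < d -> ~ ctrace G z /\
    contour_integral G (fun w => (w - z)^-1) =
    contour_integral G (fun w => (w - a)^-1).
Proof.
move=> Gc Ga; have [m m0 Hm] := ctrace_dist Ga.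
exists (m / 2); first by rewrite divr_gt0.
move=> z za.
have wz w : ctrace G w -> m / 2 <= rnorm (w - z).
  by move=> /Hm; have := ler_rdistD z w a; lra.
have m2 : 0 < m / 2 by rewrite divr_gt0.
have Gz : ~ ctrace G z.
  by move=> /wz; rewrite subrr rnorm0; lra.
split => //.
have wa0 w : ctrace G w -> w - a != 0.
  by move=> Gw; rewrite subr_eq0; apply/eqP => E; apply: Ga; rewrite -E.
have wz0 w : ctrace G w -> w - z != 0.
  by move=> Gw; rewrite subr_eq0; apply/eqP => E; apply: Gz; rewrite -E.
pose u : R[i] := z - a.
have ca := inv_at_cont Ga; have cz := inv_at_cont Gz.
pose P (N : nat) (w : R[i]) : R[i] := u ^+ N * (w - a)^-1 ^+ N.
have Pc N : cont_on (ctrace G) (P N).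
  exact: (cont_onZ (cont_onX ca)).
(* the remainder of order N of the expansion *)
pose D N := contour_integral G (fun w => P N w * (w - z)^-1).
have DS N : D N = D N.+1 + u ^+ N * contour_integral G (fun w => (w - a)^-1 ^+ N.+1).
  rewrite -(cintZ (u ^+ N) (cont_onX ca)) -cintD.
  - apply: cint_ext => w Gw; rewrite /P; have := wa0 _ Gw; have := wz0 _ Gw.
    have -> : w - z = (w - a) - u by rewrite /u; ring.
    rewrite !exprS; move: (_^-1 ^+ N) (u ^+ N) => x y; move: (w - a) => v v1 v0.
    by field; rewrite v0 v1.
  - exact: (cont_onM (Pc N.+1) cz).
  - exact: (cont_onZ (cont_onX ca)).
have D1 N : D N.+1 = D 1%N.
  by elim: N => // N <-; rewrite [RHS]DS cint_sub_pow// mulr0 addr0.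
have D0 : D 1%N = 0.
  apply: (@geometric_zero _ (2 * (m / 2)^-1 * clength G)) => N.
  rewrite -(D1 N).
  have -> : 2 * (m / 2)^-1 * clength G * 2^-1 ^+ N = 2 * (2^-1 ^+ N * (m / 2)^-1) * clength G by ring.
  apply: cint_bound; first exact: (cont_onM (Pc N.+1) cz).
  move=> w Gw; rewrite !rnormM !rnormX !rnormV.
  apply: ler_pM; rewrite ?invr_ge0 ?rnorm_ge0//.
  - by rewrite mulr_ge0// exprn_ge0// ?invr_ge0 rnorm_ge0.
  - rewrite -exprMn; apply: (@le_trans _ _ (2^-1 ^+ N.+1)).
      apply: lerXn2r; rewrite ?nnegrE ?invr_ge0 ?mulr_ge0 ?invr_ge0 ?rnorm_ge0//.
      have p : 0 < rnorm (w - a) by apply: lt_le_trans (Hm _ Gw).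
      rewrite ler_pdivrMr//; have := Hm _ Gw; move: za; rewrite -/u; lra.
    by rewrite exprS ler_piMl ?exprn_ge0 ?invr_ge0//; lra.
  - by rewrite lef_pV2 ?posrE//; [exact: wz|exact: lt_le_trans (wz _ Gw)].
have := DS 0%N; rewrite D0 add0r expr0 mul1r /D /P.
rewrite (cint_ext (g := fun w => (w - z)^-1)); last by move=> w _; rewrite !expr0 !mul1r.
by move=> ->; apply: cint_ext => w _; rewrite expr1.
Qed.

(** Expand 1 / (w - z) in powers of w / z: polynomials integrate to 0, and the
remainder decreases geometrically. *)
Lemma index_far G : closed_chain G -> exists M : R, forall z, M < rnorm z ->
  ~ ctrace G z /\ contour_integral G (fun w => (w - z)^-1) = 0.
Proof.
move=> Gc; have [M M0 HM] := ctrace_bounded (@cont_on_id _ (ctrace G)).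
exists (2 * (M + 1)) => z Mz.
have M1 : 0 < M + 1 by rewrite ltr_wpDl.
have Gz : ~ ctrace G z by move=> /HM; lra.
split => //.
have zz : 0 < rnorm z by lra.
have z0 : z != 0 by rewrite -rnorm_gt0.
have wz w : ctrace G w -> M + 1 <= rnorm (w - z).
  by move=> /HM wM; rewrite rdistC; have := lerB_rnorm z w; lra.
have wz0 w : ctrace G w -> w - z != 0.
  by move=> Gw; rewrite subr_eq0; apply/eqP => E; apply: Gz; rewrite -E.
have cz := inv_at_cont Gz.
pose P (N : nat) (w : R[i]) : R[i] := (z^-1 ^+ N) * w ^+ N.
have Pc N : cont_on (ctrace G) (P N).
  exact: (cont_onZ (cont_onX (@cont_on_id _ _))).
pose D N := contour_integral G (fun w => P N w * (w - z)^-1).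
have DS N : D N = D N.+1.
  suff : D N = D N.+1 + contour_integral G (horner (- (z^-1 ^+ N.+1) *: 'X^N)).
    by rewrite cint_horner// addr0.
  rewrite -cintD.
  - apply: cint_ext => w Gw; rewrite /P !hornerE; have := wz0 _ Gw.
    rewrite !exprS; move: (w ^+ N) (_^-1 ^+ N) => x y; move: (w) z0 => v z0 v1.
    by field; rewrite z0 v1.
  - exact: (cont_onM (Pc N.+1) cz).
  - exact: cont_on_horner.
have D1 N : D N = D 0%N by elim: N => // N <-; rewrite [RHS]DS.
have -> : contour_integral G (fun w => (w - z)^-1) = D 0%N.
  by apply: cint_ext => w _; rewrite /P !expr0 !mul1r.
apply: (@geometric_zero _ (2 * (M + 1)^-1 * clength G)) => N.
rewrite -(D1 N).
have -> : 2 * (M + 1)^-1 * clength G * 2^-1 ^+ N = 2 * (2^-1 ^+ N * (M + 1)^-1) * clength G by ring.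
apply: cint_bound; first exact: (cont_onM (Pc N) cz).
move=> w Gw; rewrite !rnormM !rnormX !rnormV.
apply: ler_pM; rewrite ?invr_ge0 ?rnorm_ge0//.
- by rewrite mulr_ge0// exprn_ge0// ?invr_ge0 rnorm_ge0.
- rewrite -exprMn; apply: lerXn2r; rewrite ?nnegrE ?invr_ge0 ?mulr_ge0 ?invr_ge0 ?rnorm_ge0//.
  by rewrite mulrC ler_pdivrMr//; have := HM _ Gw; lra.
- by rewrite lef_pV2 ?posrE//; [exact: wz|exact: lt_le_trans (wz _ Gw)].
Qed.

End Index.

(** * Cauchy's theorem in homology form *)

Section HomologyCauchy.
Variable (R : realType).
Implicit Types (G : contour R) (f : R[i] -> R[i]).

(** The modulus of continuity in the first variable does not depend on the
second one. *)
Definition equicont_on (T S : set R[i]) (h : R[i] -> R[i] -> R[i]) :=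
  forall w0, T w0 -> forall e : R, 0 < e -> exists2 d : R, 0 < d &
    forall w z, rnorm (w - w0) < d -> T w -> S z -> rnorm (h w z - h w0 z) <= e.

Lemma uniform_modulus (e : R[i] * R[i]) S h : equicont_on (on_seg e) S h ->
  forall eps : R, 0 < eps -> exists2 d : R, 0 < d &
    forall t t' z, 0 <= t <= 1 -> 0 <= t' <= 1 -> `|t' - t| < d -> S z ->
      rnorm (h (segment_pt e t') z - h (segment_pt e t) z) <= eps.
Proof.
move=> hc eps eps0.
have /compact_near_coveringP Kc := @segment_compact R 0 1.
have := Kc R (0^'+) (fun d t => forall t' z, 0 <= t <= 1 -> 0 <= t' <= 1 -> `|t' - t| < d -> S z ->
      rnorm (h (segment_pt e t') z - h (segment_pt e t) z) <= eps) _.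
case.
  move=> t0 /=; rewrite in_itv/= => t01.
  have [d d0 Hd] := hc (segment_pt e t0) (ex_intro2 _ _ t0 t01 erefl) (eps / 2) (divr_gt0 eps0 (ltr0Sn _ 1)).
  pose L := rnorm (e.2 - e.1) + 1.
  have L0 : 0 < L by rewrite ltr_wpDl ?rnorm_ge0.
  have near0 t : `|t - t0| < d / L -> rnorm (segment_pt e t - segment_pt e t0) < d.
    have -> : segment_pt e t - segment_pt e t0 = (t - t0)%:C * (e.2 - e.1).
      by rewrite /segment_pt rmorphB/=; ring.
    rewrite rnormM rnormR ltr_pdivlMr// => H; apply: le_lt_trans H.
    by rewrite ler_wpM2l// /L lerDl.
  have d2 : 0 < d / L / 2 by rewrite !divr_gt0.
  exists ([set t | `|t - t0| < d / L / 2], [set d' | d' < d / L / 2]) => /=.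
    split; last exact: nbhs_right_lt.
    by apply/nbhs_normP; exists (d / L / 2) => // t; rewrite /ball_/= distrC.
  move=> [t d'] /= [tt0 dd'] t' z t01' t'01 tt' Sz.
  have b1 : rnorm (segment_pt e t - segment_pt e t0) < d by apply: near0; lra.
  have b2 : rnorm (segment_pt e t' - segment_pt e t0) < d.
    by apply: near0; apply: (le_lt_trans (ler_distD t _ _)); lra.
  have on t1 : 0 <= t1 <= 1 -> on_seg e (segment_pt e t1) by move=> ?; exists t1.
  have h1 := Hd _ _ b1 (on _ t01') Sz; have h2 := Hd _ _ b2 (on _ t'01) Sz.
  apply: (le_trans (ler_rdistD (h (segment_pt e t0) z) _ _)).
  by rewrite [X in _ + X]rdistC; lra.
move=> d /= d0 Hd; exists (d / 2); first by rewrite divr_gt0.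
move=> t t' z t01 t'01 tt' Sz; apply: (Hd (d / 2)) => //=; last by rewrite divr_gt0.
  by rewrite sub0r normrN gtr0_norm ?divr_gt0//; lra.
Qed.

(** Riemann sums with an error that is uniform in z; in the proof of
homology_cauchy they take the place of an exchange of two integrals. *)
Lemma riemann_edge (e : R[i] * R[i]) S h :
  (forall z, S z -> cont_on (on_seg e) (h^~ z)) -> equicont_on (on_seg e) S h ->
  forall eps : R, 0 < eps -> exists s : seq (R[i] * R[i]),
    (forall p, p \in s -> on_seg e p.2) /\
    forall z, S z -> rnorm (eint (h^~ z) e - \sum_(p <- s) p.1 * h p.2 z) <= eps.
Proof.
move=> hc he eps eps0.
pose L := rnorm (e.2 - e.1) + 1.
have L0 : 0 < L by rewrite ltr_wpDl ?rnorm_ge0.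
have [d d0 Hd] := uniform_modulus he (divr_gt0 eps0 (mulr_gt0 (ltr0Sn _ 1) L0)).
pose n := (Num.truncn d^-1).+1.
have n0 : 0 < n%:R :> R by rewrite ltr0n.
have nd : n%:R^-1 < d.
  rewrite -[d]invrK ltf_pV2 ?posrE ?invr_gt0//.
  by rewrite /n truncnS_gt// invr_ge0 ltW.
pose T (k : nat) : R := k%:R / n%:R.
have T01 k : (k <= n)%N -> 0 <= T k <= 1.
  by move=> kn; rewrite divr_ge0 ?ler0n//= ler_pdivrMr// mul1r ler_nat.
have TS k : T k.+1 = T k + n%:R^-1 by rewrite /T -natr1 mulrDl mul1r.
pose s := [seq (segment_pt e (T k.+1) - segment_pt e (T k), segment_pt e (T k)) | k <- iota 0 n].
exists s; split.
  move=> p /mapP[k]; rewrite mem_iota add0n => /andP[_ kn] -> /=.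
  by exists (T k) => //=; apply: T01; exact: ltnW.
move=> z Sz; have hz := hc z Sz.
have [P HP] := eint_primitive hz.
have sumE : eint (h^~ z) e = \sum_(k <- iota 0 n) eint (h^~ z) (segment_pt e (T k), segment_pt e (T k.+1)).
  transitivity (\sum_(k <- iota 0 n) (P (T k.+1) - P (T k))).
    have := telescope_sumr (fun k => P (T k)) (leq0n n); rewrite /index_iota subn0 => ->.
    rewrite -HP; [|exact: T01..].
    have -> : T n = 1 by rewrite /T mulfV// gt_eqF.
    by rewrite /T mul0r segment_pt0 segment_pt1 -surjective_pairing.
  apply: eq_big_seq => k; rewrite mem_iota add0n => /andP[_ kn].
  by rewrite HP//; [exact: T01 (ltnW kn)|exact: T01].
rewrite sumE big_map -sumrB.
apply: (le_trans (ler_rnorm_sum _ _ _)).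
have term k : k \in iota 0 n ->
   rnorm (eint (h^~ z) (segment_pt e (T k), segment_pt e (T k.+1)) -
      (segment_pt e (T k.+1) - segment_pt e (T k)) * h (segment_pt e (T k)) z) <= eps * n%:R^-1.
  rewrite mem_iota add0n => /andP[_ kn].
  pose e' := (segment_pt e (T k), segment_pt e (T k.+1)).
  have sub : on_seg e' `<=` on_seg e.
    by apply: on_seg_sub; [exact: T01 (ltnW kn)|exact: T01].
  have hz' : cont_on (on_seg e') (h^~ z) := sub_cont_on sub hz.
  pose c := h (segment_pt e (T k)) z.
  have cc : cont_on (on_seg e') (fun=> - c) := @cont_on_cst _ _ (- c).
  have -> : eint (h^~ z) e' - (segment_pt e (T k.+1) - segment_pt e (T k)) * c =
      eint (fun w => h w z + - c) e'.
    rewrite (eintD hz' cc); congr (_ + _).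
    rewrite (@eint_FTC _ (fun w => - c * w) (fun=> - c) e')//=.
      by rewrite -mulrBr mulNr mulrC.
    move=> w _; apply: (cder_eq (cderM (cder_cst (- c) w) (cder_id w))).
    by rewrite mulr1 mulr0 addr0.
  have bd w : on_seg e' w -> rnorm (h w z + - c) <= eps / (2 * L).
    move=> [t t01 <-]; rewrite /e' segment_pt_affine.
    have tn : 0 <= t / n%:R <= n%:R^-1.
      case/andP: t01 => t0 t1; rewrite divr_ge0 ?ler0n//=.
      by rewrite ler_piMl ?invr_ge0 ?ler0n.
    have E : T k + t * (T k.+1 - T k) = T k + t / n%:R by rewrite TS [T k + n%:R^-1]addrC addrK.
    apply: Hd => //; first exact: T01 (ltnW kn).
      by have /andP[] := T01 _ (ltnW kn); have /andP[] := T01 _ kn; rewrite E TS; case/andP: tn; lra.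
    by rewrite E [T k + _]addrC addrK ger0_norm; case/andP: tn; lra.
  apply: (le_trans (eint_bound (cont_onD hz' cc) bd)).
  have -> : e'.2 - e'.1 = (n%:R^-1)%:C * (e.2 - e.1).
    by rewrite /e' /= TS /segment_pt rmorphD/=; ring.
  rewrite rnormM rnormR ger0_norm ?invr_ge0 ?ler0n//.
  have -> : 2 * (eps / (2 * L)) * (n%:R^-1 * rnorm (e.2 - e.1)) =
     eps * n%:R^-1 * (rnorm (e.2 - e.1) / L) by field; rewrite !gt_eqF.
  rewrite ler_piMr// ?mulr_ge0 ?invr_ge0 ?ler0n ?(ltW eps0)//.
  by rewrite ler_pdivrMr// mul1r /L lerDl.
rewrite big_seq; apply: (@le_trans _ _ (\sum_(k <- iota 0 n | k \in iota 0 n) eps * n%:R^-1)).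
  by apply: ler_sum => k; exact: term.
rewrite -big_seq big_const_seq count_predT size_iota.
by rewrite iter_addr_0 -(mulr_natr (eps / n%:R) n) mulfVK// gt_eqF.
Qed.

Lemma riemann_contour G S h :
  (forall z, S z -> cont_on (ctrace G) (h^~ z)) -> equicont_on (ctrace G) S h ->
  forall eps : R, 0 < eps -> exists s : seq (R[i] * R[i]),
    (forall p, p \in s -> ctrace G p.2) /\
    forall z, S z -> rnorm (contour_integral G (h^~ z) - \sum_(p <- s) p.1 * h p.2 z) <= eps.
Proof.
elim: G => [|e G IH] hc he eps eps0.
  exists [::]; split => // z Sz; rewrite contour_integralE !big_nil subrr rnorm0.
  exact: ltW.
have sub1 : on_seg e `<=` ctrace (e :: G) by move=> w ew; exists e => //; rewrite inE eqxx.
have sub2 : ctrace G `<=` ctrace (e :: G).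
  by move=> w [e' eG ew]; exists e' => //; rewrite inE eG orbT.
have sube (T T' : set R[i]) : T `<=` T' -> equicont_on T' S h -> equicont_on T S h.
  move=> TT H w0 /TT Tw ep /(H w0 Tw ep)[d d0 Hd]; exists d => // w z wd /TT; exact: Hd.
have eps2 : 0 < eps / 2 by rewrite divr_gt0.
have [s1 [s1in Hs1]] := riemann_edge (fun z Sz => sub_cont_on sub1 (hc z Sz)) (sube _ _ sub1 he) eps2.
have [s2 [s2in Hs2]] := IH (fun z Sz => sub_cont_on sub2 (hc z Sz)) (sube _ _ sub2 he) _ eps2.
exists (s1 ++ s2); split.
  by move=> p; rewrite mem_cat => /orP[/s1in|/s2in]; [exact: sub1|exact: sub2].
move=> z Sz; have a1 := Hs1 z Sz; have a2 := Hs2 z Sz.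
rewrite contour_integralE big_cons big_cat/= -contour_integralE opprD addrACA.
by apply: (le_trans (ler_rnormD _ _)); lra.
Qed.

(** The set K of the points on G or of nonzero index is compact and lies in W.
Cauchy's formula on a grid contour Gam around K writes f on G as an average of
the functions f w / (w - z) of z, for w on Gam.  Since w has index 0, each of
them integrates to 0 over G.  Replacing the average by a Riemann sum, uniformly
for z on G, shows that f integrates to 0 as well. *)
Theorem homology_cauchy (W : set R[i]) G f : open W -> closed_chain G ->
  ctrace G `<=` W -> (forall z, ~ W z -> contour_integral G (fun w => (w - z)^-1) = 0) ->
  holomorphic_on W f -> contour_integral G f = 0.
Proof.
move=> Wo Gc GW ind fW.
(* K is closed because the index is locally constant off the trace *)
pose K := [set z | ctrace G z \/ contour_integral G (fun w => (w - z)^-1) != 0].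
have Kc : closed K.
  rewrite -[K]setCK; apply: open_closedC; rewrite openE => a /= Ka.
  have Ga : ~ ctrace G a by move=> Ga; apply: Ka; left.
  have a0 : contour_integral G (fun w => (w - a)^-1) = 0.
    by apply/eqP; apply: contra_notT Ka => H; right.
  have [d d0 Hd] := index_locally_constant Gc Ga.
  apply/nbhs_rnormP; exists d => // z /Hd[Gz E] [//|]; by rewrite E a0 eqxx.
have Kb : rbounded K.
  have [M HM] := index_far Gc; exists M => z Kz.
  rewrite leNgt; apply/negP => /HM[Gz E]; case: Kz => //; by rewrite E eqxx.
have KW : K `<=` W.
  move=> z [/GW//|] H; apply: contrapT => Wz; by rewrite ind// eqxx in H.
have [Gam [[_ Gam1 _ _] Gamf]] := grid_contour Kc Kb Wo KW.
have GamW w : ctrace Gam w -> W w /\ ~ K w by move=> [e eG [t t01 <-]]; exact: Gam1.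
have fG : cont_on (ctrace G) f.
  by move=> z /GW/fW; exact: derivable_continuous_at.
have fGam : cont_on (ctrace Gam) f.
  by move=> z /GamW[/fW + _]; exact: derivable_continuous_at.
have dis z w : ctrace G z -> ctrace Gam w -> w != z.
  by move=> Gz /GamW[_ Kw]; apply/eqP => E; apply: Kw; left; rewrite E.
pose h (w z : R[i]) : R[i] := f w * (w - z)^-1.
have hc z : ctrace G z -> cont_on (ctrace Gam) (h^~ z).
  move=> Gz; apply: (cont_onM fGam); apply: inv_at_cont => Gw.
  by have := dis _ _ Gz Gw; rewrite eqxx.
have he : equicont_on (ctrace Gam) (ctrace G) h.
  move=> w0 Gw0 eps eps0.
  have Gw0' : ~ ctrace G w0 by move=> H; have := dis _ _ H Gw0; rewrite eqxx.
  have [m m0 Hm] := ctrace_dist Gw0'.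
  pose F := rnorm (f w0) + 1; have F0 : 0 < F by rewrite ltr_wpDl ?rnorm_ge0.
  have e1 : 0 < eps * m / 4 by rewrite divr_gt0// mulr_gt0.
  have /continuous_rnormP/(_ _ e1)[d1 d10 Hd1] := fGam _ Gw0.
  exists (Num.min d1 (Num.min (m / 2) (eps * m ^+ 2 / (4 * F)))).
    by rewrite !lt_min d10 !divr_gt0// ?mulr_gt0// exprn_gt0.
  move=> w z; rewrite !lt_min => /andP[wd1 /andP[wm we]] Gw Gz.
  have b0 : m <= rnorm (w0 - z) by rewrite rdistC; exact: Hm.
  have b1 : m / 2 <= rnorm (w - z).
    by have := ler_rdistD w w0 z; rewrite (rdistC w0 w); lra.
  have n0 : w0 - z != 0 by rewrite -rnorm_gt0; exact: lt_le_trans b0.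
  have n1 : w - z != 0 by rewrite -rnorm_gt0; apply: lt_le_trans b1; rewrite divr_gt0.
  have -> : h w z - h w0 z = (f w - f w0) * (w - z)^-1 +
      f w0 * (w0 - w) * ((w - z)^-1 * (w0 - z)^-1).
    rewrite /h; have -> : w0 - w = (w0 - z) - (w - z) by ring.
    by move: (f w) (f w0) (w - z) (w0 - z) n1 n0 => a b u v u0 v0; field; rewrite u0 v0.
  apply: (le_trans (ler_rnormD _ _)); rewrite !rnormM !rnormV.
  have i1 : (rnorm (w - z))^-1 <= 2 / m.
    by rewrite -[2 / m]invrK lef_pV2 ?posrE ?rnorm_gt0// ?invr_gt0 ?divr_gt0// invf_div.
  have i0 : (rnorm (w0 - z))^-1 <= m^-1 by rewrite lef_pV2 ?posrE ?rnorm_gt0.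
  have t1 : rnorm (f w - f w0) * (rnorm (w - z))^-1 <= eps / 2.
    have -> : eps / 2 = eps * m / 4 * (2 / m) by field; rewrite gt_eqF.
    by apply: ler_pM; rewrite ?invr_ge0 ?rnorm_ge0//; apply: ltW; exact: Hd1.
  have t2 : rnorm (f w0) * rnorm (w0 - w) * ((rnorm (w - z))^-1 * (rnorm (w0 - z))^-1) <= eps / 2.
    have -> : eps / 2 = F * (eps * m ^+ 2 / (4 * F)) * (2 / m * m^-1).
      by field; rewrite !gt_eqF.
    apply: ler_pM; rewrite ?mulr_ge0 ?invr_ge0 ?rnorm_ge0//.
      by apply: ler_pM; rewrite ?rnorm_ge0// ?lerDl// rdistC ltW.
    by apply: ler_pM; rewrite ?invr_ge0 ?rnorm_ge0.
  lra.
have tp0 := two_pi_i_neq0 R.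
apply: rnorm_small => eps eps0.
pose c := rnorm (two_pi_i R)^-1.
have c0 : 0 < c by rewrite rnorm_gt0 invr_eq0.
pose ell := clength G + 1.
have ell0 : 0 < ell by rewrite ltr_wpDl ?clength_ge0.
have eps' : 0 < eps / (2 * c * ell) by rewrite divr_gt0// !mulr_gt0.
have [s [sin Hs]] := riemann_contour hc he eps'.
pose g (z : R[i]) : R[i] := \sum_(p <- s) p.1 * h p.2 z.
have gp p : p \in s -> cont_on (ctrace G) (h p.2).
  move=> /sin Gp; apply: cont_onZ.
  apply: cont_onV; first by apply: cont_onD; [exact: cont_on_cst|exact: (cont_onN (@cont_on_id _ _))].
  by move=> z Gz; rewrite subr_eq0; exact: dis.
have hint p : p \in s -> contour_integral G (h p.2) = 0.
  move=> ps; have := sin _ ps => Gp.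
  have Kp : ~ K p.2 by have [] := GamW _ Gp.
  have Gp' : ~ ctrace G p.2 by move=> H; apply: Kp; left.
  rewrite (cint_ext (g := fun z => - f p.2 * (z - p.2)^-1)); last first.
    by move=> z _; rewrite /h -[p.2 - z]opprB invrN mulrN mulNr.
  rewrite (cintZ (- f p.2) (inv_at_cont Gp')).
  have -> : contour_integral G (fun w => (w - p.2)^-1) = 0.
    by apply/eqP; apply: contra_notT Kp => H; right.
  by rewrite mulr0.
have gcint : cont_on (ctrace G) g /\ contour_integral G g = 0.
  rewrite /g; elim: (s) gp hint => [|p s' IH] gp hint.
    have -> : (fun z => \sum_(p <- [::]) p.1 * h p.2 z) = fun=> 0.
      by apply/funext => z; rewrite big_nil.
    split; first exact: cont_on_cst.
    rewrite (cint_ext (g := horner 0)) ?cint_horner// => z _.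
    by rewrite horner0.
  have -> : (fun z => \sum_(p <- p :: s') p.1 * h p.2 z) =
      fun z => p.1 * h p.2 z + \sum_(p <- s') p.1 * h p.2 z.
    by apply/funext => z; rewrite big_cons.
  have pin : p \in p :: s' by rewrite inE eqxx.
  have sin' p' : p' \in s' -> p' \in p :: s' by move=> H; rewrite inE H orbT.
  have [c1 c2] := IH (fun p' H => gp p' (sin' _ H)) (fun p' H => hint p' (sin' _ H)).
  have c3 : cont_on (ctrace G) (fun z => p.1 * h p.2 z) by exact: cont_onZ (gp p pin).
  split; first exact: cont_onD.
  by rewrite (cintD c3 c1) c2 (cintZ p.1 (gp p pin)) hint// mulr0 addr0.
have [gc gi] := gcint.
have gc' : cont_on (ctrace G) (fun z => - (two_pi_i R)^-1 * g z) by exact: cont_onZ gc.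
have -> : contour_integral G f = contour_integral G (fun z => f z + - (two_pi_i R)^-1 * g z).
  by rewrite (cintD fG gc') (cintZ (- (two_pi_i R)^-1) gc) gi mulr0 addr0.
have bd z : ctrace G z -> rnorm (f z + - (two_pi_i R)^-1 * g z) <= c * (eps / (2 * c * ell)).
  move=> Gz; have Kz : K z by left.
  have -> : f z = (two_pi_i R)^-1 * contour_integral Gam (h^~ z).
    by rewrite /h Gamf// mulrA mulVf// mul1r.
  rewrite mulNr -mulrBr rnormM ler_wpM2l ?rnorm_ge0//.
  exact: Hs.
apply: (le_trans (cint_bound (cont_onD fG gc') bd)).
have -> : 2 * (c * (eps / (2 * c * ell))) * clength G = eps * (clength G / ell).
  by field; rewrite !gt_eqF.
by rewrite ler_piMr ?(ltW eps0)// ler_pdivrMr// mul1r /ell lerDl.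
Qed.

End HomologyCauchy.

(** * Bounded operators and resolvents *)

Section Operators.
Variables (R : realType) (V : completeNormedModType R[i]).
Implicit Types (x y : V) (T S B : {linear V -> V}).

Lemma linear_bounded T : continuous T ->
  exists2 k : R, 0 <= k & forall x, rnorm (T x) <= k * rnorm x.
Proof.
move=> Tc; have /continuous_rnormP/(_ 1 ltr01)[d d0 Hd] := Tc 0.
have d2 : 0 < d / 2 by rewrite divr_gt0.
exists (d / 2)^-1; first by rewrite invr_ge0 ltW.
move=> x; have [->|x0] := eqVneq x 0; first by rewrite linear0 !rnorm0 mulr0.
have nx : 0 < rnorm x by rewrite rnorm_gt0.
have T0 : T 0 = 0 := linear0 T.
have := Hd (((d / 2) / rnorm x)%:C *: x).
rewrite T0 (subr0 (_ *: x)) (subr0 (T _)) linearZ/= !rnormZ rnormR ger0_norm; last first.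
  by rewrite divr_ge0 ?rnorm_ge0 ?ltW.
rewrite mulfVK ?gt_eqF// => H.
have {}H : d / 2 / rnorm x * rnorm (T x) < 1 by apply: H; lra.
rewrite ler_pdivlMl// -[leRHS]mul1r -ler_pdivrMr// mulrAC.
exact: ltW.
Qed.

Lemma bounded_linear_continuous T (k : R) :
  (forall x, rnorm (T x) <= k * rnorm x) -> continuous T.
Proof.
move=> Tk x; apply/continuous_rnormP => e e0.
have k0 : 0 < `|k| + 1 by rewrite ltr_wpDl.
exists (e / (`|k| + 1)); first by rewrite divr_gt0.
move=> y; rewrite ltr_pdivlMr// -linearB mulrC => H; apply: le_lt_trans H.
apply: (le_trans (Tk _)); rewrite ler_wpM2r ?rnorm_ge0//.
by rewrite (le_trans (ler_norm _))// lerDl.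
Qed.

Lemma opnorm_has_ubound T : continuous T ->
  has_ubound [set rnorm (T x) | x in [set x : V | rnorm x <= 1]].
Proof.
move=> /linear_bounded[k k0 Tk]; exists k => _ [x /= x1 <-].
by rewrite (le_trans (Tk x))// ler_piMr.
Qed.

Lemma opnorm_ge0 T : continuous T -> 0 <= opnorm T.
Proof.
move=> Tc; apply: ub_le_sup; first exact: opnorm_has_ubound.
by exists 0; rewrite /= ?linear0 rnorm0.
Qed.

Lemma le_opnorm T x : continuous T -> rnorm (T x) <= opnorm T * rnorm x.
Proof.
move=> Tc; have [->|x0] := eqVneq x 0; first by rewrite linear0 !rnorm0 mulr0.
have nx : 0 < rnorm x by rewrite rnorm_gt0.
rewrite -ler_pdivrMr//; apply: ub_le_sup; first exact: opnorm_has_ubound.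
exists (((rnorm x)^-1)%:C *: x) => /=.
  by rewrite rnormZ rnormR ger0_norm ?invr_ge0 ?rnorm_ge0// mulVf ?gt_eqF.
by rewrite linearZ/= rnormZ rnormR ger0_norm ?invr_ge0 ?rnorm_ge0// mulrC.
Qed.

Lemma opnorm_le T (k : R) : 0 <= k -> (forall x, rnorm (T x) <= k * rnorm x) ->
  opnorm T <= k.
Proof.
move=> k0 Tk; apply: ge_sup.
  by exists (rnorm (T 0)); exists 0 => //=; rewrite rnorm0.
by move=> _ [x /= x1 <-]; rewrite (le_trans (Tk x))// ler_piMr.
Qed.

(** Banach's fixed point theorem.  It solves equations with perturbed operators,
in place of Neumann series. *)
Lemma contraction_fixpoint (T : V -> V) (k : R) : 0 <= k -> k < 1 ->
  (forall x y, rnorm (T x - T y) <= k * rnorm (x - y)) -> exists x, T x = x.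
Proof.
move=> k0 k1 Tk.
pose s n := iter n T 0.
have sS n : rnorm (s n.+1 - s n) <= k ^+ n * rnorm (T 0).
  elim: n => [|n IH]; first by rewrite expr0 mul1r subr0.
  by rewrite exprS -mulrA; apply: (le_trans (Tk _ _)); rewrite ler_wpM2l.
pose C := rnorm (T 0) / (1 - k).
have k1' : 0 < 1 - k by rewrite subr_gt0.
have C0 : 0 <= C by rewrite divr_ge0 ?rnorm_ge0 ?ltW.
have sm n m : rnorm (s (n + m)%N - s n) <= k ^+ n * C * (1 - k ^+ m).
  elim: m => [|m IH]; first by rewrite addn0 subrr rnorm0 expr0 subrr mulr0.
  apply: (le_trans (ler_rdistD (s (n + m)%N) _ _)); rewrite addnS.
  have := sS (n + m)%N; have E : k ^+ (n + m) * rnorm (T 0) = k ^+ n * C * (k ^+ m - k ^+ m.+1).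
    by rewrite exprD exprS /C; field; rewrite gt_eqF.
  by rewrite E; lra.
have kC n m : (n <= m)%N -> rnorm (s m - s n) <= k ^+ n * C.
  move=> nm; rewrite -(subnKC nm); apply: (le_trans (sm _ _)).
  apply: ler_piMr; first by rewrite mulr_ge0// exprn_ge0.
  by rewrite lerBlDr lerDl exprn_ge0.
have small (e : R) : 0 < e -> exists n, k ^+ n * C < e.
  move=> e0; have : (fun n => k ^+ n * C) @ \oo --> 0 * C.
    by apply: cvgMl; apply: cvg_expr; rewrite ger0_norm.
  rewrite mul0r => /cvgrPdist_lt/(_ e e0)[n _ Hn]; exists n.
  have := Hn n (leqnn n); rewrite /= sub0r normrN ger0_norm//.
  by rewrite mulr_ge0 ?exprn_ge0.
have cs : cauchy (s @ \oo).
  apply: cauchy_exP => -[a b]; rewrite ltcE /= => /andP[/eqP -> a0].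
  have [n Hn] := small a a0; exists (s n); exists n => // m /= nm.
  rewrite -ball_normE /= rnormE ltcR rdistC.
  exact: le_lt_trans (kC _ _ nm) Hn.
have /cauchy_cvg/cvg_ex[x Hx] := cs.
exists x; apply: subr0_eq; apply: rnorm_small => e e0.
have e2 : 0 < (e / 2)%:C :> R[i] by rewrite ltcR divr_gt0.
move/cvgrPdist_lt: Hx => /(_ _ e2)[n _ Hn].
have a1 := Hn n (leqnn n); have a2 := Hn n.+1 (leqnSn n).
move: a1 a2; rewrite /= !rnormE !ltcR => a1 a2.
apply: (le_trans (ler_rdistD (s n.+1) _ _)).
have a3 := Tk x (s n); have a4 : k * rnorm (x - s n) <= rnorm (x - s n).
  by rewrite ler_piMl ?rnorm_ge0// ltW.
rewrite [X in _ + X]rdistC; rewrite /s /= in a2 a3 *; rewrite -/(s n) in a2 a3 *; lra.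
Qed.

(** The lower bound makes the inverse single valued, and bounded by 1 / m. *)
Lemma bounded_inverse (S : V -> V) (m : R) : 0 < m -> linear S ->
  (forall x, m * rnorm x <= rnorm (S x)) -> (forall y, exists x, S x = y) ->
  exists B : {linear V -> V}, [/\ continuous B, forall x, B (S x) = x & forall x, S (B x) = x].
Proof.
move=> m0 Sl Sm Ss; have [g Hg] := choice Ss.
have inj x y : S x = S y -> x = y.
  move=> E; apply/eqP; rewrite -subr_eq0 -rnorm_eq0 eq_le rnorm_ge0 andbT.
  have := Sm (x - y); have -> : S (x - y) = 0.
    by rewrite -[x - y]addrC -scaleN1r Sl E scaleN1r addNr.
  by rewrite rnorm0 pmulr_rle0.
have gl : linear g.
  by move=> a x y; apply: inj; rewrite Hg Sl !Hg.
pose B : {linear V -> V} := HB.pack g (GRing.isLinear.Build R[i] V V *:%R g gl).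
exists B; split => [|x|x]; last exact: Hg.
  apply: (@bounded_linear_continuous B m^-1) => x.
  by rewrite ler_pdivlMl// (le_trans (Sm _))// [S _]Hg.
by apply: inj; rewrite [LHS]Hg.
Qed.

End Operators.

Section Resolvent.
Variables (R : realType) (V : completeNormedModType R[i]).
Variable (A : {linear V -> V}).
Hypothesis Ac : continuous A.
Implicit Types (x y : V) (z w : R[i]).

Local Notation Rz := (resolvent A).

Lemma resolventP z : ~ spectrum A z -> is_resolvent A z (Rz z).
Proof. by move=> /contrapT [B HB]; exact: getI HB. Qed.

Lemma shift_linear z : linear (fun x => z *: x - A x).
Proof.
move=> a x y; rewrite linearP scalerDr scalerBr opprD !scalerA mulrC.
by rewrite addrACA.
Qed.

Lemma resolvent_exists z (m : R) : 0 < m ->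
  (forall x, m * rnorm x <= rnorm (z *: x - A x)) ->
  (forall y, exists x, z *: x - A x = y) -> ~ spectrum A z.
Proof.
move=> m0 Hm Hs; apply.
by have [B [? ? ?]] := bounded_inverse m0 (shift_linear z) Hm Hs; exists B.
Qed.

Lemma resolvent_below z : ~ spectrum A z ->
  exists2 m : R, 0 < m & forall x, m * rnorm x <= rnorm (z *: x - A x).
Proof.
move=> /resolventP[Bc B1 B2]; have [k k0 Hk] := linear_bounded Bc.
have k1 : 0 < k + 1 by rewrite ltr_wpDl.
exists (k + 1)^-1; first by rewrite invr_gt0.
move=> x; rewrite ler_pdivrMl// -{1}[x]B1; apply: (le_trans (Hk _)).
by rewrite ler_wpM2r ?rnorm_ge0// lerDl.
Qed.

Lemma shift_diff z w x : w *: x - A x = (z *: x - A x) + (w - z) *: x.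
Proof. by rewrite scalerBl [RHS]addrC addrA subrK. Qed.

(** If m is a lower bound of z - A, then m / 2 is one of w - A for all w within
m / 2 of z, which bounds the resolvents there uniformly. *)
Lemma spectrum_open_compl z : ~ spectrum A z ->
  exists2 d : R, 0 < d & exists2 k : R, 0 < k & forall w, rnorm (w - z) < d ->
    ~ spectrum A w /\ forall x, rnorm (Rz w x) <= k * rnorm x.
Proof.
move=> nz; have [m m0 Hm] := resolvent_below nz.
have [Bc B1 B2] := resolventP nz.
exists (m / 2); first by rewrite divr_gt0.
exists (m / 2)^-1; first by rewrite invr_gt0 divr_gt0.
move=> w wz.
have low x : m / 2 * rnorm x <= rnorm (w *: x - A x).
  rewrite (shift_diff z).
  have := lerB_rnorm (z *: x - A x) (- ((w - z) *: x)); rewrite opprK rnormN rnormZ.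
  have := Hm x; have : rnorm (w - z) * rnorm x <= m / 2 * rnorm x.
    by rewrite ler_wpM2r ?rnorm_ge0// ltW.
  lra.
have nw : ~ spectrum A w.
  apply: (@resolvent_exists _ (m / 2)) => //; first by rewrite divr_gt0.
  move=> y.
  have RB x : rnorm (Rz z x) <= m^-1 * rnorm x.
    by rewrite ler_pdivlMl// (le_trans (Hm _))// B2.
  have [|||x Hx] := @contraction_fixpoint _ _ (fun x => Rz z y - (w - z) *: Rz z x) 2^-1.
  - by rewrite invr_ge0.
  - by rewrite invf_lt1// ltr1n.
  - move=> u v; have -> : Rz z y - (w - z) *: Rz z u - (Rz z y - (w - z) *: Rz z v) =
        (w - z) *: Rz z (v - u).
      by rewrite (linearB (Rz z)) scalerBr opprB addrC addrA subrK.
    rewrite rnormZ [rnorm (u - v)]rdistC; apply: (@le_trans _ _ (m / 2 * (m^-1 * rnorm (v - u)))).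
      by apply: ler_pM; [exact: rnorm_ge0|exact: rnorm_ge0|exact: ltW|exact: RB].
    have -> // : m / 2 * (m^-1 * rnorm (v - u)) = 2^-1 * rnorm (v - u).
    by field; rewrite gt_eqF.
  exists x; rewrite (shift_diff z).
  have Ex : x = Rz z (y - (w - z) *: x) by rewrite linearB linearZ /= Hx.
  by rewrite {1 2}Ex B2 subrK.
split => // x; have [Cc C1 C2] := resolventP nw.
by rewrite ler_pdivlMl ?divr_gt0// (le_trans (low _))// C2.
Qed.

Lemma closed_spectrum : closed (spectrum A).
Proof.
rewrite -[spectrum A]setCK; apply: open_closedC; rewrite openE => z /= nz.
have [d d0 [k _ Hd]] := spectrum_open_compl nz.
by apply/nbhs_rnormP; exists d => // w /Hd[].
Qed.

Lemma resolvent_far (k : R) : 0 <= k -> (forall x, rnorm (A x) <= k * rnorm x) ->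
  forall z, k < rnorm z -> ~ spectrum A z /\
    forall x, rnorm (Rz z x) <= (rnorm z - k)^-1 * rnorm x.
Proof.
move=> k0 Ak z kz.
have zk : 0 < rnorm z - k by rewrite subr_gt0.
have zz : 0 < rnorm z by exact: le_lt_trans kz.
have z0 : z != 0 by rewrite -rnorm_gt0.
have low x : (rnorm z - k) * rnorm x <= rnorm (z *: x - A x).
  by apply: le_trans (lerB_rnorm _ _); rewrite rnormZ mulrBl lerB.
have nz : ~ spectrum A z.
  apply: (resolvent_exists zk low) => y.
  have [|||x Hx] := @contraction_fixpoint _ _ (fun x => z^-1 *: (y + A x)) (k / rnorm z).
  - by rewrite divr_ge0// ltW.
  - by rewrite ltr_pdivrMr// mul1r.
  - move=> u v; rewrite -scalerBr opprD addrACA subrr add0r -linearB rnormZ rnormV mulrC.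
    by rewrite [leRHS]mulrAC; apply: ler_wpM2r; [rewrite invr_ge0 ltW|exact: Ak].
  by exists x; rewrite -{1}Hx scalerA mulfV// scale1r addrK.
split => // x; have [Cc C1 C2] := resolventP nz.
by rewrite ler_pdivlMl// (le_trans (low _))// C2.
Qed.

Lemma spectrum_bounded : exists M : R, forall z, spectrum A z -> rnorm z <= M.
Proof.
have [k k0 Hk] := linear_bounded Ac; exists k => z sz.
by rewrite leNgt; apply/negP => /(resolvent_far k0 Hk)[].
Qed.

Lemma resolvent_eq w z x : ~ spectrum A z -> ~ spectrum A w ->
  Rz w x - Rz z x = (z - w) *: Rz w (Rz z x).
Proof.
move=> nz nw; have [_ _ C2] := resolventP nz; have [_ D1 D2] := resolventP nw.
set a := Rz z x.
transitivity (Rz w (z *: a - A a) - Rz w (w *: a - A a)); first by rewrite C2 D1.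
have -> : (z - w) *: Rz w a = Rz w ((z - w) *: a) by rewrite linearZ.
rewrite -linearB; have -> // : z *: a - A a - (w *: a - A a) = (z - w) *: a.
by rewrite opprB addrA subrK scalerBl.
Qed.

Lemma resolvent_comm (B : {linear V -> V}) z x : ~ spectrum A z ->
  (forall x, A (B x) = B (A x)) -> Rz z (B x) = B (Rz z x).
Proof.
move=> nz AB; have [_ D1 D2] := resolventP nz.
rewrite -[in LHS](D2 x); have -> : B (z *: Rz z x - A (Rz z x)) = z *: B (Rz z x) - A (B (Rz z x)).
  by rewrite linearB linearZ/= AB.
by rewrite D1.
Qed.

End Resolvent.

(** * Integrals of the resolvent *)

Section Chains.
Variable (R : realType).
Implicit Types (z w : R[i]).

Lemma cint_cat (G1 G2 : contour R) (f : R[i] -> R[i]) : contour_integral (G1 ++ G2) f =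
  contour_integral G1 f + contour_integral G2 f.
Proof. by rewrite !contour_integralE big_cat. Qed.

Definition rev_chain (G : contour R) : contour R := [seq (e.2, e.1) | e <- G].

Lemma ctrace_rev (G : contour R) : ctrace (rev_chain G) `<=` ctrace G.
Proof.
move=> z [_ /mapP[[a b] eG ->] /on_seg_rev ez]; by exists (a, b).
Qed.

Lemma ctrace_cat (G1 G2 : contour R) : ctrace (G1 ++ G2) `<=` ctrace G1 `|` ctrace G2.
Proof. by move=> z [e]; rewrite mem_cat => /orP[] eG ez; [left|right]; exists e. Qed.

Lemma cint_rev (G : contour R) (f : R[i] -> R[i]) : cont_on (ctrace G) f ->
  contour_integral (rev_chain G) f = - contour_integral G f.
Proof.
move=> fc; rewrite !contour_integralE big_map -sumrN; apply: eq_big_seq => -[a b] eG.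
by apply: eint_rev; exact: (ctrace_edge eG).
Qed.

Lemma closed_rev_cat (G1 G2 : contour R) : closed_chain G1 -> closed_chain G2 ->
  closed_chain (G1 ++ rev_chain G2).
Proof.
rewrite /closed_chain => h1 h2; rewrite !map_cat -!map_comp /=.
by rewrite perm_cat// perm_sym.
Qed.

(** The difference of the two chains is a cycle of index 0 off W. *)
Lemma cint_homologous (W : set R[i]) (G1 G2 : contour R) (f : R[i] -> R[i]) : open W ->
  closed_chain G1 -> closed_chain G2 -> ctrace G1 `<=` W -> ctrace G2 `<=` W ->
  (forall z, ~ W z -> contour_integral G1 (fun w => (w - z)^-1) =
                      contour_integral G2 (fun w => (w - z)^-1)) ->
  holomorphic_on W f -> contour_integral G1 f = contour_integral G2 f.
Proof.
move=> Wo c1 c2 s1 s2 ind fW.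
have fc : cont_on (ctrace G2) f.
  by move=> z /s2/fW; exact: derivable_continuous_at.
apply/eqP; rewrite -subr_eq0 -(cint_rev fc) -cint_cat; apply/eqP.
apply: (@homology_cauchy _ W) => //.
- exact: closed_rev_cat.
- by apply: subset_trans (@ctrace_cat _ _) _ => z [/s1//|/ctrace_rev/s2].
- move=> z Wz; have iz : cont_on (ctrace G2) (fun w => (w - z)^-1).
    by apply: inv_at_cont => /s2.
  by rewrite cint_cat (cint_rev iz) (ind _ Wz) subrr.
Qed.

Lemma surroundsP (G : contour R) (K U : set R[i]) : surrounds G K U ->
  [/\ closed_chain G, ctrace G `<=` [set z | U z /\ ~ K z],
    forall z, K z -> contour_integral G (fun w => (w - z)^-1) = two_pi_i R &
    forall z, ~ U z -> contour_integral G (fun w => (w - z)^-1) = 0].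
Proof.
move=> [h1 h2 h3 h4]; split => //.
- by move=> z [e eG [t t01 <-]]; exact: h2.
- move=> z /h3; rewrite /winding_index -/(two_pi_i R) => /(congr1 ( *%R (two_pi_i R))).
  by rewrite mulrA mulfV ?two_pi_i_neq0// mul1r mulr1.
- move=> z /h4 /eqP; rewrite /winding_index -/(two_pi_i R).
  by rewrite mulf_eq0 invr_eq0 (negbTE (two_pi_i_neq0 R)) => /eqP.
Qed.

End Chains.

Lemma conj_real (R : realType) (r : R) : Num.conj (r%:C : R[i]) = r%:C.
Proof. by apply: CrealP; apply/complex_realP; exists r. Qed.

Lemma conj_divR (R : realType) (s : R[i]) (r : R) :
  Num.conj (s / r%:C) = Num.conj s / r%:C.
Proof. by rewrite -fmorphV rmorphM /= conj_real. Qed.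

Lemma real_complexV_M (R : realType) (a b : R) : (a / b)%:C = a%:C / b%:C :> R[i].
Proof. by rewrite -fmorphV -rmorphM. Qed.

Section InnerProduct.
Variables (R : realType) (V : completeNormedModType R[i]).
Variable (ip : {dot V for Num.conj}).
Hypothesis ip_norm : forall x : V, ip x x = `|x| ^+ 2.
Implicit Types (x y u v : V).

Lemma ipDl x y u : ip (x + y) u = ip x u + ip y u.
Proof. exact: linearDl. Qed.
Lemma ipBl x y u : ip (x - y) u = ip x u - ip y u.
Proof. exact: linearBl. Qed.
Lemma ipZl (a : R[i]) x u : ip (a *: x) u = a * ip x u.
Proof. by rewrite linearZl_LR. Qed.
Lemma ip_suml (I : Type) (r : seq I) (P : pred I) (F : I -> V) u :
  ip (\sum_(i <- r | P i) F i) u = \sum_(i <- r | P i) ip (F i) u.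
Proof. exact: linear_sumlz. Qed.
Lemma ip0l u : ip 0 u = 0.
Proof. exact: linear0l. Qed.

Lemma ip_rnorm x : ip x x = (rnorm x ^+ 2)%:C.
Proof. by rewrite ip_norm rnormE -rmorphXn. Qed.

Lemma cauchy_schwarz x y : rnorm (ip x y) <= rnorm x * rnorm y.
Proof.
have [->|y0] := eqVneq y 0; first by rewrite linear0r !rnorm0 mulr0.
have ny : 0 < rnorm y by rewrite rnorm_gt0.
pose c := ip x y / ip y y.
have yy0 : ip y y != 0.
  by rewrite ip_rnorm (inj_eq (@complexI R) _ 0) expf_eq0/= gt_eqF.
pose t : R := rnorm (ip x y) ^+ 2 / rnorm y ^+ 2.
have ny2 : rnorm y ^+ 2 != 0 by rewrite expf_eq0/= gt_eqF.
have nyE : ip y y = (rnorm y ^+ 2)%:C := ip_rnorm y.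
have d1 : ip x (c *: y) = t%:C.
  have -> : ip x (c *: y) = Num.conj c * ip x y by rewrite linearZr_LR.
  have -> : Num.conj c = Num.conj (ip x y) / (rnorm y ^+ 2)%:C.
    by rewrite /c nyE; exact: conj_divR.
  rewrite mulrAC [X in X / _]mulrC -normCK rnormE /t.
  by rewrite real_complexV_M !rmorphXn.
have d2 : ip (c *: y) (c *: y) = t%:C.
  rewrite ip_rnorm rnormZ /c rnormM rnormV nyE rnormR ger0_norm ?exprn_ge0 ?rnorm_ge0//.
  congr (_%:C); rewrite /t; move: ny; move: (rnorm y) (rnorm _) => b a b0.
  by field; rewrite gt_eqF.
have := dnormB ip x (c *: y); rewrite /= d1 d2 !ip_rnorm.
have -> := conj_real t.
rewrite opprD addrA addrK -rmorphB => /complexI E.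
have : 0 <= rnorm x ^+ 2 - t by rewrite -E exprn_ge0 ?rnorm_ge0.
rewrite subr_ge0 /t ler_pdivrMr ?exprn_gt0// -exprMn.
by rewrite ler_pXn2r ?nnegrE ?mulr_ge0 ?rnorm_ge0.
Qed.

End InnerProduct.

Section ResolventIntegral.
Variables (R : realType) (V : completeNormedModType R[i]).
Variable (ip : {dot V for Num.conj}).
Hypothesis ip_norm : forall x : V, ip x x = `|x| ^+ 2.
Variable (A : {linear V -> V}).
Hypothesis Ac : continuous A.
Implicit Types (x y u v : V) (z w : R[i]).

Local Notation Rz := (resolvent A).
Local Notation g x y := (fun z => ip (Rz z x) y).

(** Two applications of the resolvent identity leave an error quadratic in
w - z. *)
Lemma resolvent_cder x y z : ~ spectrum A z ->
  cder (g x y) z (- ip (Rz z (Rz z x)) y).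
Proof.
move=> nz; have [d d0 [k k0 Hd]] := spectrum_open_compl nz.
move=> e e0; pose C := k * k * rnorm (Rz z x) * rnorm y.
have kz u : rnorm (Rz z u) <= k * rnorm u by have [] := Hd z; rewrite ?subrr ?rnorm0//.
have C0 : 0 <= C by rewrite !mulr_ge0 ?rnorm_ge0// ltW.
have C1 : 0 < C + 1 by rewrite ltr_wpDl.
exists (Num.min d (e / (C + 1))); first by rewrite lt_min d0 divr_gt0.
move=> w; rewrite lt_min => /andP[wd we].
have [nw kw] := Hd w wd.
have E : g x y w - g x y z - - ip (Rz z (Rz z x)) y * (w - z) =
   ip ((z - w) *: ((z - w) *: Rz w (Rz z (Rz z x)))) y.
  rewrite -(resolvent_eq (Rz z x) nz nw) scalerBr -(resolvent_eq x nz nw).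
  rewrite !ipBl ipZl; ring.
rewrite E; apply: (le_trans (cauchy_schwarz ip_norm _ _)).
rewrite !rnormZ (rdistC z w).
have b : rnorm (Rz w (Rz z (Rz z x))) <= k * (k * rnorm (Rz z x)).
  by apply: (le_trans (kw _)); rewrite ler_wpM2l ?(ltW k0).
have n0 : 0 <= rnorm (w - z) by exact: rnorm_ge0.
apply: (@le_trans _ _ (rnorm (w - z) * (rnorm (w - z) * (k * (k * rnorm (Rz z x)))) * rnorm y)).
  by rewrite ler_wpM2r ?rnorm_ge0// ler_wpM2l// ler_wpM2l.
have -> : rnorm (w - z) * (rnorm (w - z) * (k * (k * rnorm (Rz z x)))) * rnorm y =
  (rnorm (w - z) * C) * rnorm (w - z) by rewrite /C; ring.
rewrite ler_wpM2r//; move: we; rewrite ltr_pdivlMr// => /ltW we.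
by apply: le_trans we; rewrite ler_wpM2l// lerDl.
Qed.

Lemma resolvent_holomorphic x y z : ~ spectrum A z -> derivable (g x y) z 1.
Proof. by move=> /(resolvent_cder x y)/cder_derivable. Qed.

Lemma resolvent_cont (S : set R[i]) x y : (forall z, S z -> ~ spectrum A z) ->
  cont_on S (g x y).
Proof.
by move=> Sn z /Sn nz; apply: derivable_continuous_at; exact: resolvent_holomorphic.
Qed.

Lemma resolvent_norm_cont x z : ~ spectrum A z ->
  {for z, continuous (fun w => rnorm (Rz w x))}.
Proof.
move=> nz; have [d d0 [k k0 Hd]] := spectrum_open_compl nz.
apply/continuous_rnormrP => e e0.
pose C := k * rnorm (Rz z x).
have C0 : 0 <= C by rewrite mulr_ge0 ?rnorm_ge0// ltW.
have C1 : 0 < C + 1 by rewrite ltr_wpDl.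
exists (Num.min d (e / (C + 1))); first by rewrite lt_min d0 divr_gt0.
move=> w; rewrite lt_min => /andP[wd we].
have [nw kw] := Hd w wd.
apply: (@le_lt_trans _ _ (rnorm (Rz w x - Rz z x))).
  by rewrite ler_norml lerB_rnorm andbT lerNl opprB rdistC lerB_rnorm.
rewrite (resolvent_eq x nz nw) rnormZ (rdistC z w).
apply: (@le_lt_trans _ _ (rnorm (w - z) * C)); first by rewrite ler_wpM2l ?rnorm_ge0.
move: we; rewrite ltr_pdivlMr//; apply: le_lt_trans.
by rewrite ler_wpM2l ?rnorm_ge0// lerDl.
Qed.

(** Move the contour to a large square.  There R(z) x = x / z + R(z) A x / z,
and the second term is of order 1 / |z| ^ 2. *)
Lemma resolvent_integral (G : contour R) (U : set R[i]) x y :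
  surrounds G (spectrum A) U -> contour_integral G (g x y) = two_pi_i R * ip x y.
Proof.
move=> /surroundsP[Gc GU Gi _].
have [k k0 Ak] := linear_bounded Ac.
have [M M0 HM] := ctrace_bounded (@cont_on_id _ (ctrace G)).
have far := resolvent_far k0 Ak.
have oW : open (~` spectrum A) by apply: closed_openC; exact: closed_spectrum.
have out (L : R) z : 0 < L -> ctrace (rect (- L) L (- L) L) z -> L <= rnorm z.
  move=> L0 [e]; rewrite !inE => /or4P[] /eqP -> /on_segE[t _ [/= zR zI]].
  - by apply: le_trans (ler_Im_rnorm z); rewrite zI subrr mulr0 addr0 normrN ger0_norm// ltW.
  - by apply: le_trans (ler_Re_rnorm z); rewrite zR subrr mulr0 addr0 ger0_norm// ltW.
  - by apply: le_trans (ler_Im_rnorm z); rewrite zI subrr mulr0 addr0 ger0_norm// ltW.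
  - by apply: le_trans (ler_Re_rnorm z); rewrite zR subrr mulr0 addr0 normrN ger0_norm// ltW.
have step (L : R) : k + 1 < L ->
    contour_integral G (g x y) = contour_integral (rect (- L) L (- L) L) (g x y).
  move=> kL; have L0 : 0 < L by lra.
  apply: (@cint_homologous _ (~` spectrum A)) => //.
  - exact: closed_rect.
  - by move=> z /GU[].
  - by move=> z /(out _ _ L0) Lz; apply: (far z _).1; lra.
  - move=> z /contrapT sz; rewrite Gi//.
    have zk : rnorm z <= k.
      by rewrite leNgt; apply/negP => /far[].
    have zR := le_trans (ler_Re_rnorm z) zk; have zI := le_trans (ler_Im_rnorm z) zk.
    move: zR zI; rewrite !ler_norml => /andP[? ?] /andP[? ?].
    have := @cauchy_rect R (fun=> 1) (- L) L (- L) L z.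
    rewrite mulr1 (cint_ext (g := fun w => (w - z)^-1)); last by move=> w _; rewrite mul1r.
    move=> H; rewrite H; [by []|apply/andP; split; lra|apply/andP; split; lra|].
    by move=> w _; exact: cder_derivable (cder_cst 1 w).
  - by move=> z nz; exact: resolvent_holomorphic.
apply: subr0_eq; apply: rnorm_small => eps eps0.
(* the error is at most 16 k |x| |y| / (L - k) *)
pose L : R := k + 2 + 16 * (k * rnorm x * rnorm y) / eps.
have Q0 : 0 <= 16 * (k * rnorm x * rnorm y) / eps.
  by rewrite divr_ge0 ?(ltW eps0)// mulr_ge0// !mulr_ge0// rnorm_ge0.
have kL : k + 1 < L by rewrite /L; lra.
have L0 : 0 < L by lra.
pose Q := rect (- L) L (- L) L.
rewrite (step L kL) -/Q.
have Qout z : ctrace Q z -> L <= rnorm z by exact: out.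
have Qn z : ctrace Q z -> ~ spectrum A z by move=> /Qout Lz; apply: (far z _).1; lra.
have gc : cont_on (ctrace Q) (g x y) by apply: resolvent_cont.
have Q00 : ~ ctrace Q 0 by move=> /Qout; rewrite rnorm0; lra.
have ic := inv_at_cont Q00.
have tE : contour_integral Q (fun w => (w - 0)^-1) = two_pi_i R.
  have := @cauchy_rect R (fun=> 1) (- L) L (- L) L 0.
  rewrite mulr1 -/Q (cint_ext (g := fun w => (w - 0)^-1)); last by move=> w _; rewrite mul1r.
  move=> H; rewrite H; [by []|rewrite /=; apply/andP; split; lra|rewrite /=; apply/andP; split; lra|].
  by move=> w _; exact: cder_derivable (cder_cst 1 w).
have mc : cont_on (ctrace Q) (fun w => - ip x y * (w - 0)^-1) by exact: cont_onZ ic.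
rewrite -tE mulrC -mulNr -(cintZ (- ip x y) ic) -(cintD gc mc).
have bd z : ctrace Q z -> rnorm (g x y z + - ip x y * (z - 0)^-1) <=
    L^-1 * ((L - k)^-1 * (k * rnorm x) * rnorm y).
  move=> Qz; have Lz := Qout _ Qz; have nz := Qn _ Qz.
  have z0 : z != 0 by rewrite -rnorm_gt0; exact: lt_le_trans Lz.
  have [_ _ D2] := resolventP nz.
  have -> : g x y z + - ip x y * (z - 0)^-1 = z^-1 * ip (Rz z (A x)) y.
    rewrite (resolvent_comm (B := A) x nz) // subr0.
    have -> : A (Rz z x) = z *: Rz z x - x by rewrite -[X in _ = _ - X](D2 x) opprB addrC subrK.
    by rewrite ipBl ipZl mulrBr mulrA mulVf// mul1r mulNr mulrC.
  rewrite rnormM rnormV; apply: ler_pM; rewrite ?invr_ge0 ?rnorm_ge0//.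
    by rewrite lef_pV2 ?posrE// rnorm_gt0.
  apply: (le_trans (cauchy_schwarz ip_norm _ _)); rewrite ler_wpM2r ?rnorm_ge0//.
  have kz : k < rnorm z by lra.
  apply: (le_trans ((far z kz).2 _)); apply: ler_pM; rewrite ?invr_ge0 ?rnorm_ge0//.
    by rewrite subr_ge0 ltW.
  by rewrite lef_pV2 ?posrE ?subr_gt0//; lra.
apply: (le_trans (cint_bound (cont_onD gc mc) bd)).
have LL : - L <= L by lra.
have cl := clength_rect LL LL.
have kL' : 0 < L - k by lra.
have B0 : 0 <= 2 * (L^-1 * ((L - k)^-1 * (k * rnorm x) * rnorm y)).
  by rewrite !mulr_ge0 ?invr_ge0 ?rnorm_ge0// ltW.
apply: (le_trans (ler_wpM2l B0 cl)).
have -> : 2 * (L^-1 * ((L - k)^-1 * (k * rnorm x) * rnorm y)) * (2 * (L - - L + (L - - L))) =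
   16 * (k * rnorm x * rnorm y) / (L - k).
  by field; rewrite !gt_eqF.
have : 16 * (k * rnorm x * rnorm y) / eps <= L - k by rewrite /L; lra.
by rewrite ler_pdivrMr// ler_pdivrMr// [leRHS]mulrC.
Qed.

End ResolventIntegral.

(** * Rational functions of an operator *)

Section PolyOp.
Variables (R : realType) (V : completeNormedModType R[i]).
Variable (A : {linear V -> V}).
Implicit Types (x y : V) (p q s : {poly R[i]}).

(** The vector p(A) x. *)
Definition pop p x : V := \sum_(i < size p) p`_i *: iter i A x.

Lemma pop_wide n p x : (size p <= n)%N -> pop p x = \sum_(i < n) p`_i *: iter i A x.
Proof.
move=> pn; rewrite /pop (big_ord_widen _ (fun i => p`_i *: iter i A x) pn) big_mkcond/=.
by apply: eq_bigr => i _; case: ltnP => // /leq_sizeP/(_ i (leqnn _)) ->; rewrite scale0r.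
Qed.

Lemma popD p q x : pop (p + q) x = pop p x + pop q x.
Proof.
pose n := maxn (size p) (size q).
rewrite (@pop_wide n p) ?leq_maxl// (@pop_wide n q) ?leq_maxr//.
rewrite (@pop_wide n (p + q)) ?size_polyD// -big_split/=.
by apply: eq_bigr => i _; rewrite coefD scalerDl.
Qed.

Lemma popZ (c : R[i]) p x : pop (c *: p) x = c *: pop p x.
Proof.
rewrite (@pop_wide (size p) (c *: p)) ?size_scale_leq// /pop scaler_sumr.
by apply: eq_bigr => i _; rewrite coefZ scalerA.
Qed.

Lemma popC (c : R[i]) x : pop c%:P x = c *: x.
Proof. by rewrite (@pop_wide 1) ?size_polyC_leq1// big_ord1 coefC. Qed.

Lemma pop0 x : pop 0 x = 0.
Proof. by rewrite -polyC0 popC scale0r. Qed.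

Lemma popMX p x : pop (p * 'X) x = pop p (A x).
Proof.
rewrite (@pop_wide (size p).+1); last first.
  by have [->|p0] := eqVneq p 0; rewrite ?mul0r ?size_poly0// size_mulX.
rewrite big_ord_recl coefMX eqxx scale0r add0r /pop.
by apply: eq_bigr => i _; rewrite coefMX/= -iterS iterSr.
Qed.

Lemma pop_cons p (c : R[i]) x : pop (p * 'X + c%:P) x = pop p (A x) + c *: x.
Proof. by rewrite popD popMX popC. Qed.

Lemma pop_linear p : linear (pop p).
Proof.
move=> a x y; elim/poly_ind: p x y => [|p c IH] x y; first by rewrite !pop0 scaler0 addr0.
by rewrite !pop_cons linearP IH !scalerDr !scalerA (mulrC a) addrACA.
Qed.

HB.instance Definition _ p := GRing.isLinear.Build R[i] V V *:%R (pop p) (pop_linear p).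

Lemma pop_comm (B : {linear V -> V}) p x : (forall x, A (B x) = B (A x)) ->
  pop p (B x) = B (pop p x).
Proof.
move=> AB; elim/poly_ind: p x => [|p c IH] x; first by rewrite !pop0 linear0.
by rewrite !pop_cons AB IH linearD linearZ.
Qed.

Lemma pop_A p x : A (pop p x) = pop p (A x).
Proof. by rewrite -pop_comm. Qed.

Lemma popM p q x : pop (p * q) x = pop p (pop q x).
Proof.
elim/poly_ind: p x => [|p c IH] x; first by rewrite mul0r !pop0.
rewrite mulrDl popD mulrAC popMX IH pop_cons -pop_A; congr (_ + _).
by rewrite mul_polyC popZ.
Qed.

Lemma pop_sum (I : Type) (r : seq I) (F : I -> {poly R[i]}) x :
  pop (\sum_(i <- r) F i) x = \sum_(i <- r) pop (F i) x.
Proof.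
elim: r => [|i r IH]; first by rewrite !big_nil pop0.
by rewrite !big_cons popD IH.
Qed.

Hypothesis Ac : continuous A.

Lemma pop_bounded p : exists2 k : R, 0 <= k & forall x, rnorm (pop p x) <= k * rnorm x.
Proof.
have [a a0 Ha] := linear_bounded Ac.
elim/poly_ind: p => [|p c [k k0 Hk]].
  by exists 0 => // x; rewrite pop0 rnorm0 mul0r.
exists (k * a + rnorm c); first by rewrite addr_ge0 ?mulr_ge0 ?rnorm_ge0.
move=> x; rewrite pop_cons (le_trans (ler_rnormD _ _))// mulrDl rnormZ lerD2r.
by rewrite (le_trans (Hk _))// -mulrA ler_wpM2l.
Qed.

Lemma pop_continuous p : continuous (pop p).
Proof. by have [k _ Hk] := pop_bounded p; exact: (bounded_linear_continuous (T := pop p) Hk). Qed.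

(** Over the complex numbers q splits into linear factors, and the factor with
root z gives the operator A - z, z being off the spectrum. *)
Lemma pop_inverse q : q != 0 -> (forall z, spectrum A z -> q.[z] != 0) ->
  exists Q : {linear V -> V}, [/\ continuous Q, forall x, Q (pop q x) = x &
    forall x, pop q (Q x) = x].
Proof.
move=> q0 qs.
pose inv s := exists Q : {linear V -> V}, [/\ continuous Q, forall x, Q (pop s x) = x &
    forall x, pop s (Q x) = x].
have invM s t : inv s -> inv t -> inv (s * t).
  move=> [Q [Qc Q1 Q2]] [T [Tc T1 T2]]; exists (T \o Q); split.
  - by move=> x; apply: continuous_comp; [exact: Qc|exact: Tc].
  - by move=> x /=; rewrite popM Q1 T1.
  - by move=> x /=; rewrite popM T2 Q2.
have invC (c : R[i]) : c != 0 -> inv c%:P.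
  move=> c0; exists (pop (c^-1)%:P); split.
  - exact: pop_continuous.
  - by move=> x /=; rewrite (popC c^-1) (popC c) scalerA mulVf// scale1r.
  - by move=> x /=; rewrite (popC c) (popC c^-1) scalerA mulfV// scale1r.
have invX z : ~ spectrum A z -> inv ('X - z%:P).
  move=> nz; have [Bc B1 B2] := resolventP nz.
  have E x : pop ('X - z%:P) x = - (z *: x - A x).
    by rewrite -['X]mul1r -polyCN pop_cons popC scale1r scaleNr opprB.
  exists (resolvent A z \o pop (-1)%:P); split.
  - by move=> x; apply: continuous_comp; [exact: pop_continuous|exact: Bc].
  - by move=> x /=; rewrite E popC scaleN1r opprK B1.
  - by move=> x /=; rewrite E popC scaleN1r B2 opprK.
have [rs qE] := closed_field_poly_normal q.
have : inv q.
  rewrite qE -mul_polyC; refine (invM _ _ _ _); first by apply: invC; rewrite lead_coef_eq0.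
  have : forall z, z \in rs -> ~ spectrum A z.
    move=> z zr /qs; rewrite qE hornerZ horner_prod mulf_eq0 => /norP[_].
    by rewrite prodf_seq_neq0 => /allP/(_ z zr); rewrite !hornerE subrr eqxx.
  elim: (rs) => [|z r IH] Hr; first by rewrite big_nil -polyC1; apply: invC; exact: oner_neq0.
  rewrite big_cons; refine (invM _ _ _ _); first by apply: invX; apply: Hr; rewrite inE eqxx.
  by apply: IH => w wr; apply: Hr; rewrite inE wr orbT.
by [].
Qed.

End PolyOp.

Section RationalCalculus.
Variables (R : realType) (V : completeNormedModType R[i]).
Variable (ip : {dot V for Num.conj}).
Hypothesis ip_norm : forall x : V, ip x x = `|x| ^+ 2.
Variable (A : {linear V -> V}).
Hypothesis Ac : continuous A.
Implicit Types (x y u v : V) (z w : R[i]) (p q s : {poly R[i]}).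

Local Notation Rz := (resolvent A).

(** The operators s(z) - s(A) are divisible by z - A, so (s(z) - s(A)) R(z) is a
polynomial in z. *)
Lemma resolvent_pop s v y : exists h : {poly R[i]}, forall z, ~ spectrum A z ->
  s.[z] * ip (Rz z v) y = ip (Rz z (pop A s v)) y + h.[z].
Proof.
elim/poly_ind: s v => [|s c IH] v.
  by exists 0 => z nz; rewrite pop0 linear0 ip0l !horner0 mul0r addr0.
have [h Hh] := IH (A v); exists (ip v y *: s + h) => z nz.
have [_ _ D2] := resolventP nz.
have E : z * ip (Rz z v) y = ip v y + ip (Rz z (A v)) y.
  rewrite -ipZl -ipDl; congr (ip _ y).
  by rewrite (resolvent_comm (B := A) v nz)// -[X in _ = X + _](D2 v) subrK.
rewrite pop_cons linearD linearZ/= ipDl ipZl hornerMXaddC hornerD hornerZ mulrDl -mulrA E.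
by rewrite mulrDr (Hh z nz); ring.
Qed.

Lemma open_neq0 q : open [set z | q.[z] != 0].
Proof.
rewrite openE => z /= qz.
have /continuous_rnormP/(_ (rnorm q.[z])) : {for z, continuous (horner q)}.
  exact: (@cont_on_horner _ setT q z I).
rewrite rnorm_gt0 => /(_ qz)[d d0 Hd]; apply/nbhs_rnormP; exists d => // w /Hd.
by move=> H; apply/eqP => E; move: H; rewrite E sub0r rnormN ltxx.
Qed.

Lemma cder_ratio p q z : q.[z] != 0 ->
  cder (fun w => p.[w] / q.[w]) z (p.[z] * (- q.[z] ^- 2 * q^`().[z]) + q.[z]^-1 * p^`().[z]).
Proof.
by move=> qz; apply: cderM; [exact: cder_horner|apply: cderV => //; exact: cder_horner].
Qed.

Lemma cder_local (f g : R[i] -> R[i]) z l : cder g z l -> nbhs z [set w | f w = g w] -> cder f z l.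
Proof.
move=> gl /nbhs_rnormP[d d0 Hd] e e0; have [d' d'0 Hd'] := gl e e0.
have fz : f z = g z by apply: Hd; rewrite subrr rnorm0.
exists (Num.min d d'); first by rewrite lt_min d0.
by move=> w; rewrite lt_min => /andP[/Hd -> /Hd']; rewrite fz.
Qed.

Lemma nonroot_near q z (d : R) : q != 0 -> 0 < d ->
  exists w, rnorm (w - z) < d /\ q.[w] != 0.
Proof.
move=> q0 d0.
pose pt (k : nat) : R[i] := z + (d / k.+2%:R)%:C.
have ptz k : rnorm (pt k - z) < d.
  rewrite /pt addrC addKr rnormR ger0_norm ?divr_ge0 ?ltW//.
  by rewrite ltr_pdivrMr// ltr_pMr// ltr1n.
apply: contrapT => H.
have rt k : root q (pt k).
  by apply/negPn/negP => nk; apply: H; exists (pt k); split.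
have inj : injective pt.
  move=> i j /addrI/complexI/(mulfI (lt0r_neq0 d0))/invr_inj/eqP.
  by rewrite eqr_nat => /eqP[].
pose s := [seq pt k | k <- iota 0 (size q)].
have : (size s < size q)%N.
  apply: max_poly_roots => //; first by apply/allP => _ /mapP[k _ ->].
  by rewrite map_inj_uniq ?iota_uniq.
by rewrite size_map size_iota ltnn.
Qed.

Variables (q u : {poly R[i]}) (f : R[i] -> R[i]).
Hypotheses (q0 : q != 0) (fE : forall z, q.[z] != 0 -> f z = u.[z] / q.[z])
  (uq : forall z, q.[z] = 0 -> u.[z] != 0).

(** At a zero of q the function cannot even be continuous: f q = u holds at points
arbitrarily close to it, so in the limit u would vanish with q.  Hence f is
holomorphic exactly on the sets without zeros of q, whatever its values at
these. *)
Lemma ratio_holomorphic z : derivable f z 1 <-> q.[z] != 0.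
Proof.
split=> [fz|qz].
  apply/eqP => qz0.
  have fc : {for z, continuous f} := derivable_continuous_at fz.
  have fS : cont_on [set z] f by move=> _ ->.
  pose F (w : R[i]) : R[i] := f w * q.[w] + - 1 * u.[w].
  have FS : cont_on [set z] F.
    apply: cont_onD; first exact: (cont_onM fS (@cont_on_horner _ _ q)).
    exact: (cont_onZ (@cont_on_horner _ _ u)).
  have Fc : {for z, continuous F} by exact: FS.
  have uz := uq qz0.
  have := Fc; move/continuous_rnormP => /(_ (rnorm u.[z])); rewrite rnorm_gt0 => /(_ uz)[d d0 Hd].
  have [w [wz qw]] := nonroot_near z q0 d0.
  have := Hd w wz; rewrite /F qz0 mulr0 add0r fE// mulfVK// mulN1r subrr sub0r rnormN.
  by rewrite mulN1r rnormN ltxx.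
apply: cder_derivable; apply: (cder_local (cder_ratio u qz)).
have : nbhs z [set w | q.[w] != 0] by apply: open_nbhs_nbhs; split => //; exact: open_neq0.
by apply: filterS => w /= /fE.
Qed.

Variable Q : {linear V -> V}.
Hypotheses (Qc : continuous Q) (Q1 : forall x, Q (pop A q x) = x)
  (Q2 : forall x, pop A q (Q x) = x) (qs : forall z, spectrum A z -> q.[z] != 0).

(** Write x = q(A) w.  Up to polynomials in z, q(z) R(z) w is R(z) x and
u(z) R(z) w is R(z) u(A) w.  So f R x and R u(A) w, paired with y, differ by a
rational function H / q, which integrates to 0 because G has index 0 around
the zeros of q. *)
Lemma hfc_ratio_integral (G : contour R) (U : set R[i]) x y :
  surrounds G (spectrum A) U -> U `<=` [set z | q.[z] != 0] ->
  contour_integral G (fun z => f z * ip (Rz z x) y) = two_pi_i R * ip (pop A u (Q x)) y.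
Proof.
move=> GU Uq; have [Gc Gt _ Go] := surroundsP GU.
pose w := Q x.
have [hq Hq] := resolvent_pop q w y; have [hu Hu] := resolvent_pop u w y.
pose H := hu * q - u * hq.
have Gq z : ctrace G z -> q.[z] != 0 by move=> /Gt[/Uq].
have Gn z : ctrace G z -> ~ spectrum A z by move=> /Gt[].
rewrite (cint_ext (g := fun z => ip (Rz z (pop A u w)) y + H.[z] / q.[z])); last first.
  move=> z Gz; have qz := Gq _ Gz; have nz := Gn _ Gz.
  have := Hq _ nz; have := Hu _ nz; rewrite /w Q2 -/w fE// => E1 E2.
  have -> : ip (Rz z x) y = q.[z] * ip (Rz z w) y - hq.[z] by rewrite E2 addrK.
  have -> : ip (Rz z (pop A u w)) y = u.[z] * ip (Rz z w) y - hu.[z] by rewrite E1 addrK.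
  rewrite /H !hornerE; move: qz; move: (q.[z]) (u.[z]) (hu.[z]) (hq.[z]) (ip _ _) => a b c e t a0.
  by field.
rewrite cintD; first last.
- by move=> z Gz; apply: derivable_continuous_at; exact: cder_derivable (cder_ratio H (Gq _ Gz)).
- exact: (resolvent_cont ip_norm).
rewrite (resolvent_integral ip_norm Ac _ _ GU).
rewrite (@homology_cauchy _ [set z | q.[z] != 0] G (fun z => H.[z] / q.[z])) ?addr0//.
- exact: open_neq0.
- by move=> z qz; apply: Go => /Uq.
- by move=> z qz; exact: cder_derivable (cder_ratio H qz).
Qed.

Lemma ip_inj x x' : (forall y, ip x y = ip x' y) -> x = x'.
Proof.
move=> E; apply/eqP; rewrite -subr_eq0 -rnorm_eq0 -sqrf_eq0.
rewrite -(inj_eq (@complexI R)) -(ip_rnorm ip_norm) ipBl E subrr.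
by rewrite eqxx.
Qed.

(** The operator chosen by hfc comes with some unknown contour; since f is not
holomorphic at the zeros of q, the contour stays off them and the weak
integrals are those of u(A) q(A) ^ - 1. *)
Theorem hfc_ratio x : hfc ip A f x = pop A u (Q x).
Proof.
pose T : {linear V -> V} := pop A u \o Q.
have HT : is_hfc ip A f T.
  split; first by move=> v; apply: continuous_comp; [exact: Qc|exact: pop_continuous].
  have Uo : open [set z | q.[z] != 0] by exact: open_neq0.
  have [G [GU _]] := grid_contour (closed_spectrum (A := A)) (spectrum_bounded Ac) Uo qs.
  exists [set z | q.[z] != 0], G; split => //.
    by move=> z /ratio_holomorphic.
  move=> v y; rewrite -/(two_pi_i R) (hfc_ratio_integral _ _ GU)//.
  by rewrite mulrA mulVf ?two_pi_i_neq0// mul1r.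
have [_ [U [G [Uo sU fU GU Hip]]]] : is_hfc ip A f (hfc ip A f) by exact: (getI HT).
apply: ip_inj => y; rewrite Hip -/(two_pi_i R) (hfc_ratio_integral _ _ GU).
  by rewrite mulrA mulVf ?two_pi_i_neq0// mul1r.
by move=> z /fU /ratio_holomorphic.
Qed.

End RationalCalculus.

(** * Von Neumann's inequality *)

Lemma prim_root_exists (R : realType) n : (0 < n)%N -> exists z : R[i], n.-primitive_root z.
Proof.
move=> n_gt0; pose p : {poly R[i]} := 'X^n - 1.
have [r Dp] := closed_field_poly_normal p.
rewrite (monicP _) ?monicXnsubC // scale1r in Dp.
have rn1 : all n.-unity_root r by apply/allP=> z; rewrite -root_prod_XsubC -Dp.
have sz_r : (n < (size r).+1)%N.
  by rewrite -(size_prod_XsubC r id) -Dp size_XnsubC.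
have [|z] := hasP (cyclic.has_prim_root n_gt0 rn1 _ sz_r); last by exists z.
by rewrite -separable_prod_XsubC -Dp cyclotomic.separable_Xn_sub_1 // pnatr_eq0 -lt0n.
Qed.

Lemma prim_root_rnorm (R : realType) n (z : R[i]) : n.-primitive_root z -> rnorm z = 1.
Proof.
move=> pz; have n0 := prim_order_gt0 pz.
have := congr1 (@rnorm R _) (prim_expr_order pz); rewrite rnormX rnorm1 => /eqP.
by rewrite pexpr_eq1 ?rnorm_ge0// => /eqP.
Qed.

Section Fourier.
Variables (R : realType) (V : completeNormedModType R[i]).
Variable (ip : {dot V for Num.conj}).
Hypothesis ip_norm : forall x : V, ip x x = `|x| ^+ 2.
Implicit Types (x y : V).

Variables (n : nat) (zeta : R[i]).
Hypothesis pz : n.-primitive_root zeta.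

Lemma prim_root_sum (k l : 'I_n) :
  \sum_(s < n) (zeta ^+ s) ^+ k * Num.conj ((zeta ^+ s) ^+ l) = n%:R * (k == l)%:R.
Proof.
have z1 : rnorm zeta = 1 by exact: prim_root_rnorm pz.
have z0 : zeta != 0 by rewrite -rnorm_gt0 z1.
have cz : Num.conj zeta = zeta^-1.
  by apply: (mulfI z0); rewrite mulfV// -normCK rnormE z1 expr1n.
pose x := zeta ^+ k * zeta^-1 ^+ l.
have E (s : 'I_n) : (zeta ^+ s) ^+ k * Num.conj ((zeta ^+ s) ^+ l) = x ^+ s.
  rewrite !rmorphXn /= cz /x exprMn -!exprM (mulnC s k) (mulnC s l).
  by [].
under eq_bigr do rewrite E.
have [kl|kl] := eqVneq k l.
  have x1 : x = 1 by rewrite /x kl exprVn mulfV// expf_neq0.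
  rewrite x1; under eq_bigr do rewrite expr1n.
  by rewrite sumr_const card_ord mulr1.
have x1 : x != 1.
  apply/eqP => xE; move/negP: kl; apply; rewrite -val_eqE /=.
  have : zeta ^+ k = zeta ^+ l.
    by have := congr1 ( *%R^~ (zeta ^+ l)) xE; rewrite /x /= exprVn mulfVK ?expf_neq0// mul1r.
  by move/eqP; rewrite (eq_prim_root_expr pz) !modn_small.
have xn : x ^+ n = 1.
  by rewrite /x exprMn -!exprM mulnC exprM (prim_expr_order pz) expr1n mul1r mulnC exprM exprVn (prim_expr_order pz) invr1 expr1n.
rewrite mulr0; apply: (mulfI (_ : x - 1 != 0)); first by rewrite subr_eq0.
by rewrite -subrX1 xn subrr mulr0.
Qed.

Definition dft (v : nat -> V) (s : nat) : V := \sum_(k < n) (zeta ^+ s) ^+ k *: v k.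

Lemma parseval (v : nat -> V) :
  \sum_(s < n) rnorm (dft v s) ^+ 2 = n%:R * \sum_(k < n) rnorm (v k) ^+ 2.
Proof.
apply: (@complexI R).
have -> : (\sum_(s < n) rnorm (dft v s) ^+ 2)%:C = \sum_(s < n) ip (dft v s) (dft v s).
  by rewrite rmorph_sum/=; apply: eq_bigr => s _; rewrite (ip_rnorm ip_norm).
have -> : (n%:R * \sum_(k < n) rnorm (v k) ^+ 2)%:C = n%:R * \sum_(k < n) ip (v k) (v k).
  rewrite rmorphM rmorph_nat rmorph_sum/=; congr (_ * _).
  by apply: eq_bigr => s _; rewrite (ip_rnorm ip_norm).
have E s : ip (dft v s) (dft v s) = \sum_(k < n) \sum_(l < n)
    ((zeta ^+ s) ^+ k * Num.conj ((zeta ^+ s) ^+ l)) * ip (v k) (v l).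
  rewrite /dft ip_suml; apply: eq_bigr => k _.
  rewrite ipZl linear_sumr mulr_sumr; apply: eq_bigr => l _.
  by rewrite linearZr_LR /= mulrA.
under eq_bigr do rewrite E.
rewrite exchange_big/= mulr_sumr; apply: eq_bigr => k _.
rewrite exchange_big/= (bigD1 k)//= -mulr_suml prim_root_sum eqxx mulr1.
by rewrite big1 ?addr0// => l /negbTE lk; rewrite -mulr_suml prim_root_sum eq_sym lk mulr0 mul0r.
Qed.

End Fourier.

Section VonNeumann.
Variables (R : realType) (V : completeNormedModType R[i]).
Variable (ip : {dot V for Num.conj}).
Hypothesis ip_norm : forall x : V, ip x x = `|x| ^+ 2.
Implicit Types (x y : V) (B : {linear V -> V}) (P : {poly R[i]}).

(** The square of a Hilbert seminorm if B is a contraction; along an orbit of B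
it telescopes. *)
Definition defect B x : R := rnorm x ^+ 2 - rnorm (B x) ^+ 2.

(** The i-th coefficient of the product of P with the polynomial whose
coefficients are the vectors a 0, ..., a (N - 1). *)
Definition conv P N (a : nat -> V) i : V :=
  \sum_(j < size P) \sum_(k < N) if (j + k == i)%N then P`_j *: a k else 0.

(** The discrete Fourier transform turns multiplication by P into multiplication
by its values at the n-th roots of unity, where |P| <= M; n is so large that
no coefficients wrap around.  Parseval's identity holds for x and for B x,
hence for the defect. *)
Lemma conv_defect B P N (a : nat -> V) (M : R) n : (0 < n)%N -> (N + size P <= n)%N ->
  (forall w, rnorm w = 1 -> rnorm P.[w] <= M) ->
  (forall x, rnorm (B x) <= rnorm x) ->
  \sum_(i < n) defect B (conv P N a i) <= M ^+ 2 * \sum_(k < N) defect B (a k).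
Proof.
move=> n0 nn PM Bc; have [z pz] := prim_root_exists R n0.
have z1 := prim_root_rnorm pz.
pose a' k : V := if (k < N)%N then a k else 0.
have Nn : (N <= n)%N by apply: leq_trans nn; exact: leq_addr.
have D0 x : 0 <= defect B x by rewrite subr_ge0 lerXn2r ?nnegrE ?rnorm_ge0.
have M0 : 0 <= M by apply: le_trans (PM 1 (rnorm1 _)); exact: rnorm_ge0.
have sumN (W : zmodType) (F : nat -> W) : (forall k, (N <= k)%N -> F k = 0) -> \sum_(k < n) F k = \sum_(k < N) F k.
  move=> F0; rewrite (big_ord_widen _ F Nn) [RHS]big_mkcond/=.
  by apply: eq_bigr => k _; case: ltnP => // /F0.
have par (v : nat -> V) : \sum_(s < n) defect B (dft n z v s) = n%:R * \sum_(k < n) defect B (v k).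
  rewrite /defect sumrB [in RHS]sumrB mulrBr -(parseval ip_norm pz) -(parseval ip_norm pz (fun k => B (v k))).
  congr (_ - _); apply: eq_bigr => s _; congr (rnorm _ ^+ 2).
  by rewrite /dft linear_sum; apply: eq_bigr => k _; rewrite linearZ.
have dconv s : dft n z (conv P N a) s = P.[z ^+ s] *: dft n z a' s.
  rewrite /dft horner_coef scaler_suml.
  under eq_bigr do rewrite /conv scaler_sumr.
  rewrite exchange_big/=; apply: eq_bigr => j _.
  under eq_bigr do rewrite scaler_sumr.
  rewrite exchange_big/= scaler_sumr.
  rewrite (sumN _ (fun k => (P`_j * (z ^+ s) ^+ j) *: ((z ^+ s) ^+ k *: a' k))); last first.
    by move=> k Nk; rewrite /a' ltnNge Nk/= !scaler0.
  apply: eq_bigr => k _.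
  have jk : (j + k < n)%N.
    by apply: leq_trans nn; rewrite addnC -addnS leq_add// ltnW.
  rewrite (bigD1 (Ordinal jk))//= eqxx big1 ?addr0; last first.
    by move=> i; rewrite -val_eqE/= eq_sym => /negbTE ->; rewrite scaler0.
  by rewrite /a' ltn_ord !scalerA exprD; congr (_ *: _); ring.
have Dz (c : R[i]) x : defect B (c *: x) = rnorm c ^+ 2 * defect B x.
  have E y : rnorm (c *: y) ^+ 2 = rnorm c ^+ 2 * rnorm y ^+ 2.
    by rewrite rnormZ exprMn.
  by rewrite /defect (_ : B (c *: x) = c *: B x) ?E ?mulrBr//; exact: linearZ_LR.
have nR : 0 < n%:R :> R by rewrite ltr0n.
rewrite -(ler_pM2l nR) -par.
have -> : n%:R * (M ^+ 2 * \sum_(k < N) defect B (a k)) = M ^+ 2 * \sum_(s < n) defect B (dft n z a' s).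
  rewrite par mulrCA (sumN _ (fun k => defect B (a' k))); last first.
    by move=> k Nk; rewrite /a' ltnNge Nk/= /defect linear0 subrr.
  by congr (_ * (_ * _)); apply: eq_bigr => k _; rewrite /a' ltn_ord.
rewrite mulr_sumr; apply: ler_sum => s _.
rewrite dconv Dz ler_wpM2r// lerXn2r ?nnegrE ?rnorm_ge0//.
by apply: PM; rewrite rnormX z1 expr1n.
Qed.

Lemma telescope_defect B x N :
  \sum_(k < N) defect B (iter k B x) = rnorm x ^+ 2 - rnorm (iter N B x) ^+ 2.
Proof.
elim: N => [|N IH]; first by rewrite big_ord0 subrr.
by rewrite big_ord_recr/= IH /defect addrA subrK.
Qed.

(** Let a be the reversed orbit a k = B ^ (N - 1 - k) x, with total defect at
most |x| ^ 2.  For j < K the coefficient of index N - 1 - j of the product of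
P with a is B ^ j P(B) x.  The defects of these add up to
|P(B) x| ^ 2 - |B ^ K P(B) x| ^ 2, which tends to |P(B) x| ^ 2 for large K
because B is a strict contraction. *)
Lemma von_neumann_strict B P (M k : R) : 0 <= k -> k < 1 ->
  (forall x, rnorm (B x) <= k * rnorm x) ->
  (forall w, rnorm w = 1 -> rnorm P.[w] <= M) ->
  forall x, rnorm (pop B P x) <= M * rnorm x.
Proof.
move=> k0 k1 Bk PM x.
have Bc y : rnorm (B y) <= rnorm y.
  by apply: (le_trans (Bk y)); rewrite ler_piMl ?rnorm_ge0// ltW.
have D0 y : 0 <= defect B y by rewrite subr_ge0 lerXn2r ?nnegrE ?rnorm_ge0.
have M0 : 0 <= M by apply: le_trans (PM 1 (rnorm1 _)); exact: rnorm_ge0.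
pose y := pop B P x.
have main K : rnorm y ^+ 2 - rnorm (iter K B y) ^+ 2 <= M ^+ 2 * rnorm x ^+ 2.
  (* for the K indices N - 1 - j, j < K, all coefficients of P contribute *)
  pose N := (K + size P)%N; pose n := (N + size P).+1.
  pose a k := iter (N.-1 - k) B x.
  have := @conv_defect B P N a M n isT (leqnSn _) PM Bc.
  have aE : \sum_(k < N) defect B (a k) <= rnorm x ^+ 2.
    rewrite (reindex_inj rev_ord_inj)/=.
    have -> : \sum_(j < N) defect B (a (N - j.+1)%N) = \sum_(j < N) defect B (iter j B x).
      apply: eq_bigr => j _; rewrite /a; congr (defect B (iter _ B x)).
      by have := ltn_ord j; rewrite /N; lia.
    by rewrite telescope_defect lerBlDr lerDl exprn_ge0 ?rnorm_ge0.
  move=> H; have {}H := le_trans H (ler_wpM2l (exprn_ge0 2 M0) aE).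
  apply: le_trans H; rewrite -telescope_defect.
  have pN : (size P <= N)%N by rewrite /N leq_addl.
  have KN : (K <= N)%N by rewrite /N leq_addr.
  have cE (j : 'I_K) : conv P N a (N.-1 - j)%N = iter j B y.
    have itl (m : nat) u v (c : R[i]) : iter m B (c *: u + v) = c *: iter m B u + iter m B v.
      by elim: m => //= m ->; rewrite linearP.
    have its (m : nat) (I : Type) (r : seq I) (c : I -> R[i]) (F : I -> V) :
        iter m B (\sum_(i <- r) c i *: F i) = \sum_(i <- r) c i *: iter m B (F i).
      elim: r => [|i r IH]; last by rewrite !big_cons itl IH.
      by rewrite !big_nil; elim: m => //= m ->; rewrite linear0.
    rewrite /y /pop its /conv; apply: eq_bigr => i _.
    have ijN : (N.-1 - j - i < N)%N by have := ltn_ord i; have := ltn_ord j; lia.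
    have iN : (i + (N.-1 - j - i) = N.-1 - j)%N.
      by have := ltn_ord i; have := ltn_ord j; rewrite /N; lia.
    rewrite (bigD1 (Ordinal ijN))//= iN eqxx big1 ?addr0; last first.
      move=> l /negP nl; case: eqP => // E; exfalso; apply: nl; rewrite -val_eqE/=.
      by apply/eqP; lia.
    rewrite /a -iterD; congr (_ *: iter _ B x).
    have aux (K' s' i' j' : nat) : (i' < s')%N -> (j' < K')%N ->
        ((K' + s').-1 - ((K' + s').-1 - j' - i') = j' + i')%N by lia.
    exact: aux (ltn_ord i) (ltn_ord j).
  have Nn : (N <= n)%N by rewrite /n -addnS leq_addr.
  apply: (@le_trans _ _ (\sum_(j < N) defect B (conv P N a j))).
    rewrite [leRHS](reindex_inj rev_ord_inj)/=.
    rewrite (big_ord_widen _ (fun j => defect B (iter j B y)) KN) big_mkcond/=.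
    apply: ler_sum => j _; case: ifP => // jK.
    rewrite -(cE (Ordinal jK)) /=.
    have -> // : (N - j.+1 = N.-1 - j)%N by clear; lia.
  rewrite (big_ord_widen _ (fun j => defect B (conv P N a j)) Nn) big_mkcond/=.
  by apply: ler_sum => j _; case: ifP.
have ny : forall K : nat, rnorm (iter K B y) <= k ^+ K * rnorm y.
  elim=> [|K IH]; first by rewrite expr0 mul1r.
  by rewrite /= exprS -mulrA; apply: (le_trans (Bk _)); rewrite ler_wpM2l.
rewrite -/y -(@ler_pXn2r _ 2) ?nnegrE ?mulr_ge0 ?rnorm_ge0// exprMn.
apply/ler_addgt0Pr => e e0.
have : (fun K => k ^+ K * rnorm y) @ \oo --> 0 * rnorm y.
  by apply: cvgMl; apply: cvg_expr; rewrite ger0_norm.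
rewrite mul0r => /cvgrPdist_lt/(_ (Num.min 1 e)); rewrite lt_min ltr01 e0 => /(_ isT)[K _ HK].
have := HK K (leqnn K); rewrite /= sub0r normrN ger0_norm; last by rewrite mulr_ge0 ?exprn_ge0 ?rnorm_ge0.
rewrite lt_min => /andP[h1 h2].
have t0 : 0 <= rnorm (iter K B y) by exact: rnorm_ge0.
have t1 : rnorm (iter K B y) <= 1 by apply: (le_trans (ny K)); exact: ltW.
have t2 : rnorm (iter K B y) <= e by apply: (le_trans (ny K)); exact: ltW.
have t3 : rnorm (iter K B y) ^+ 2 <= e.
  by rewrite expr2; apply: (le_trans (ler_wpM2l t0 t1)); rewrite mulr1.
by have := main K; lra.
Qed.

Lemma horner_lipschitz P (r : R) : 0 <= r -> exists L : R, 0 <= L /\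
  forall z w : R[i], rnorm z <= r -> rnorm w <= r ->
    rnorm (P.[z] - P.[w]) <= L * rnorm (z - w).
Proof.
move=> r0.
have [S [S0 PS]] : exists S : R, 0 <= S /\ forall z : R[i], rnorm z <= r -> rnorm P.[z] <= S.
  elim/poly_ind: P => [|P c [S [S0 PS]]].
    by exists 0; split=> // z _; rewrite horner0 rnorm0.
  exists (S * r + rnorm c); split; first by rewrite addr_ge0 ?mulr_ge0 ?rnorm_ge0.
  move=> z zr; rewrite hornerMXaddC; apply: (le_trans (ler_rnormD _ _)).
  rewrite lerD2r rnormM; apply: ler_pM; [exact: rnorm_ge0|exact: rnorm_ge0|exact: PS|exact: zr].
clear S S0 PS.
elim/poly_ind: P => [|P c [L [L0 PL]]].
  by exists 0; split=> // z w _ _; rewrite !horner0 subrr rnorm0 mul0r.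
have [S [S0 PS]] : exists S : R, 0 <= S /\ forall z : R[i], rnorm z <= r -> rnorm P.[z] <= S.
  exists (L * r + rnorm P.[0]); split; first by rewrite addr_ge0 ?mulr_ge0 ?rnorm_ge0.
  move=> z zr; rewrite -[X in rnorm X](subrK P.[0]); apply: (le_trans (ler_rnormD _ _)).
  rewrite lerD2r; have r00 : rnorm (0 : R[i]) <= r by rewrite rnorm0.
  apply: (le_trans (PL _ _ zr r00)); rewrite subr0.
  exact: ler_wpM2l.
exists (L * r + S); split; first by rewrite addr_ge0 ?mulr_ge0.
move=> z w zr wr; rewrite !hornerMXaddC.
have -> : P.[z] * z + c - (P.[w] * w + c) = (P.[z] - P.[w]) * z + P.[w] * (z - w).
  by move: P.[z] P.[w] => a b; ring.
apply: (le_trans (ler_rnormD _ _)); rewrite !rnormM mulrDl; apply: lerD.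
  rewrite mulrAC; apply: ler_pM; [exact: rnorm_ge0|exact: rnorm_ge0|exact: PL|exact: zr].
by apply: ler_wpM2r; [exact: rnorm_ge0|exact: PS].
Qed.

(** B / t is a strict contraction for every t > r; let t tend to r. *)
Lemma von_neumann B P (M r : R) : 0 <= r ->
  (forall x, rnorm (B x) <= r * rnorm x) ->
  (forall w, rnorm w <= r -> rnorm P.[w] <= M) ->
  forall x, rnorm (pop B P x) <= M * rnorm x.
Proof.
move=> r0 Br PM x.
have r10 : 0 <= r + 1 by rewrite addr_ge0.
have [L [L0 PL]] := horner_lipschitz P r10.
have main (t : R) : r < t -> t < r + 1 -> rnorm (pop B P x) <= (M + L * (t - r)) * rnorm x.
  move=> rt tr; have t0 : 0 < t by exact: le_lt_trans rt.
  have tn0 : t%:C != 0 :> R[i] by rewrite -rnorm_gt0 rnormR normr_gt0 gt_eqF.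
  pose B' : {linear V -> V} := (t%:C^-1 \*: B).
  have B'E y : B' y = t%:C^-1 *: B y by [].
  pose Q : {poly R[i]} := P \Po (t%:C *: 'X).
  have QE : pop B' Q = pop B P :> (V -> V).
    rewrite /Q; elim/poly_ind: (P) => [|P0 c IH].
      by rewrite comp_poly0; apply/funext => y; rewrite !pop0.
    apply/funext => y; rewrite comp_polyD comp_polyM comp_polyX comp_polyC.
    rewrite -scalerAr.
    rewrite !popD !popC popZ !popMX IH B'E; congr (_ + _).
    by rewrite linearZ_LR scalerA mulfV// scale1r.
  rewrite -QE.
  have nt : rnorm (t%:C : R[i]) = t by rewrite rnormR ger0_norm// ltW.
  have k0 : 0 <= r / t by rewrite divr_ge0// ltW.
  have k1 : r / t < 1 by rewrite ltr_pdivrMr// mul1r.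
  apply: (von_neumann_strict k0 k1).
    move=> y; rewrite B'E rnormZ rnormV nt mulrAC mulrC.
    by rewrite ler_pM2r ?invr_gt0.
  move=> w w1; rewrite /Q horner_comp hornerZ hornerX.
  have E : t%:C * w = r%:C * w + (t - r)%:C * w.
    by rewrite -mulrDl -rmorphD/= addrC subrK.
  have nrw : rnorm (r%:C * w) = r by rewrite rnormM w1 mulr1 rnormR ger0_norm.
  have ntw : rnorm (t%:C * w) = t by rewrite rnormM w1 mulr1.
  have d : rnorm (t%:C * w - r%:C * w) = t - r.
    by rewrite E addrC addKr rnormM w1 mulr1 rnormR ger0_norm// subr_ge0 ltW.
  rewrite -[X in rnorm X](subrK P.[r%:C * w]); apply: (le_trans (ler_rnormD _ _)).
  rewrite addrC; apply: lerD; first by apply: PM; rewrite nrw.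
  rewrite -d; apply: PL; first by rewrite ntw ltW.
  by rewrite nrw lerDl.
have [->|xn] := eqVneq x 0; first by rewrite linear0 rnorm0 mulr0.
have x0 : 0 < rnorm x by rewrite rnorm_gt0.
apply/ler_addgt0Pr => e e0.
pose s := Num.min (1/2) (e / ((L + 1) * rnorm x)).
have D0 : 0 < (L + 1) * rnorm x by rewrite mulr_gt0// ltr_wpDl.
have s0 : 0 < s by rewrite lt_min divr_gt0//= divr_gt0.
have s1 : s < 1 by rewrite gt_min; apply/orP; left; lra.
have se : s * ((L + 1) * rnorm x) <= e.
  by rewrite -ler_pdivlMr// ge_min lexx orbT.
apply: (le_trans (main (r + s) _ _)); [by rewrite ltrDl|by rewrite ltrD2l|].
rewrite addrAC subrr add0r mulrDl lerD2l.
apply: le_trans se; rewrite mulrA (mulrC s) ler_pM2r//.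
by rewrite ler_pM2r// lerDl.
Qed.

End VonNeumann.

(** * Partial fractions with the functions delta *)

Section Lagrange.
Variables (R : realType) (d : nat) (p q : {poly R[i]}) (lambda : 'I_d -> R[i]).
Hypotheses (size_p : size p = d.+1) (lambda_inj : injective lambda)
  (lambda_root : forall j, root p (lambda j)) (size_q : (size q <= d)%N)
  (q_lambda : forall j, q.[lambda j] != 0).
Implicit Types (z w : R[i]) (j k : 'I_d).

Let p_neq0 : p != 0. Proof. by rewrite -size_poly_eq0 size_p. Qed.

Lemma uniq_nodes : uniq [seq lambda j | j <- enum 'I_d].
Proof. by rewrite map_inj_uniq ?enum_uniq. Qed.

Lemma root_node z : p.[z] = 0 -> exists j, z = lambda j.
Proof.
move=> pz; apply: contrapT => nz.
have := @max_poly_roots _ p (z :: [seq lambda j | j <- enum 'I_d]) p_neq0.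
rewrite /= uniq_nodes size_map size_enum_ord size_p ltnn andbT => H.
have : false; last by []; apply: H.
  rewrite rootE pz eqxx/=; apply/allP => _ /mapP[j _ ->]; exact: lambda_root.
by apply/negP => /mapP[j _ zj]; apply: nz; exists j.
Qed.

Lemma interpolation_unique (P : {poly R[i]}) : (size P <= d)%N ->
  (forall j, P.[lambda j] = 0) -> P = 0.
Proof.
move=> sP P0; apply/eqP; apply/negPn/negP => Pn.
have := @max_poly_roots _ P [seq lambda j | j <- enum 'I_d] Pn.
rewrite uniq_nodes size_map size_enum_ord => /(_ _ isT).
have -> : all (root P) [seq lambda j | j <- enum 'I_d].
  by apply/allP => _ /mapP[j _ ->]; apply/rootP.
by move=> /(_ isT); rewrite ltnNge sP.
Qed.

Definition deflated j : {poly R[i]} := p %/ ('X - (lambda j)%:P).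

Lemma deflatedE j : p = deflated j * ('X - (lambda j)%:P).
Proof. by rewrite /deflated divpK// dvdp_XsubCl; exact: lambda_root. Qed.

Lemma deflated_other j k : k != j -> (deflated j).[lambda k] = 0.
Proof.
move=> kj; have := lambda_root k; rewrite rootE {1}(deflatedE j) hornerM hornerXsubC.
by rewrite mulf_eq0 subr_eq0 (inj_eq lambda_inj) (negbTE kj) orbF => /eqP.
Qed.

Lemma size_deflated j : size (deflated j) = d.
Proof. by rewrite /deflated size_divp ?polyXsubC_eq0// size_XsubC size_p subn1. Qed.

Lemma deflated_at j : (deflated j).[lambda j] != 0.
Proof.
apply/eqP => E; move/eqP: p_neq0; apply.
rewrite (deflatedE j) (interpolation_unique (P := deflated j)) ?mul0r// ?size_deflated//.
by move=> k; have [->//|kj] := eqVneq k j; exact: deflated_other.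
Qed.

(** Up to the factor q(lambda_j), the Lagrange basis polynomial of the node
lambda_j; it is the numerator of delta_j over q (delta_ratio). *)
Definition numer j : {poly R[i]} := (q.[lambda j] / (deflated j).[lambda j]) *: deflated j.

Lemma numer_at j : (numer j).[lambda j] = q.[lambda j].
Proof. by rewrite hornerZ divfK// deflated_at. Qed.

Lemma numer_other j k : k != j -> (numer j).[lambda k] = 0.
Proof. by move=> kj; rewrite hornerZ (deflated_other kj) mulr0. Qed.

Lemma numerXE j z : (numer j).[z] * (z - lambda j) = q.[lambda j] / (deflated j).[lambda j] * p.[z].
Proof. by rewrite hornerZ -mulrA [in RHS](deflatedE j) hornerM hornerXsubC. Qed.

Lemma num_at_pole z : q.[z] = 0 -> p.[z] != 0.
Proof.
move=> qz; apply/eqP => /root_node[j zj]; move: (q_lambda j).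
by rewrite -zj qz eqxx.
Qed.

Lemma numer_at_pole j z : q.[z] = 0 -> (numer j).[z] != 0.
Proof.
move=> qz; apply/eqP => E; have /eqP := numerXE j z; rewrite E mul0r eq_sym.
by rewrite !mulf_eq0 invr_eq0 (negbTE (q_lambda j)) (negbTE (deflated_at j)) (negbTE (num_at_pole qz)).
Qed.

(** r'(lambda_j) is p'(lambda_j) / q(lambda_j), and p'(lambda_j) is the value of
p / (X - lambda_j) at lambda_j. *)
Lemma delta_ratio j z : q.[z] != 0 -> delta p q (lambda j) z = (numer j).[z] / q.[z].
Proof.
move=> qz; rewrite /delta; have [->|zj] := eqVneq z (lambda j).
  by rewrite numer_at divff// q_lambda.
have pl : p.[lambda j] = 0 by apply/rootP.
have -> : derive1 (ratfun p q) (lambda j) = (deflated j).[lambda j] / q.[lambda j].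
  apply: cder_unique; apply: cder_eq (cder_ratio p (q_lambda j)) _.
  rewrite pl mul0r add0r mulrC [in p^`()](deflatedE j) derivM hornerD !hornerM.
  by rewrite hornerXsubC subrr mulr0 add0r derivXsubC hornerC mulr1.
have z0 : z - lambda j != 0 by rewrite subr_eq0.
have -> : (numer j).[z] = q.[lambda j] / (deflated j).[lambda j] * p.[z] / (z - lambda j).
  by rewrite -numerXE mulfK.
rewrite /ratfun; move: (deflated_at j) (q_lambda j) z0 qz.
move: (deflated j).[_] q.[lambda j] q.[z] p.[z] (z - _) => a b c e f a0 b0 f0 c0.
by field; rewrite a0 b0 f0 c0.
Qed.

Lemma node_neq z j : p.[z] != 0 -> z - lambda j != 0.
Proof.
move=> pz; rewrite subr_eq0; apply: contraNneq pz => ->; exact: lambda_root.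
Qed.

(** Both sides have degree at most d and agree at z, lambda_1, ..., lambda_d. *)
Lemma partial_fractions z : p.[z] != 0 ->
  p.[z] *: q - q.[z] *: p =
  (z%:P - 'X) * \sum_(j < d) (p.[z] / (z - lambda j)) *: numer j.
Proof.
move=> pz; apply/eqP; rewrite -subr_eq0; set D := _ - _.
have zj j : z - lambda j != 0 by exact: node_neq.
apply/negPn/negP => D0.
have := @max_poly_roots _ D (z :: [seq lambda j | j <- enum 'I_d]) D0.
rewrite /= uniq_nodes size_map size_enum_ord andbT => H.
suff : (d.+1 < size D)%N.
  apply/negP; rewrite -leqNgt; apply: (leq_trans (size_polyD _ _)).
  rewrite size_polyN geq_max; apply/andP; split.
    apply: (leq_trans (size_polyD _ _)); rewrite size_polyN geq_max.
    rewrite (leq_trans (size_scale_leq _ _) (leqW size_q)).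
    by rewrite (leq_trans (size_scale_leq _ _)) ?size_p.
  apply: (leq_trans (size_polyMleq _ _)).
  have -> : size (z%:P - 'X : {poly R[i]}) = 2 by rewrite -opprB size_polyN size_XsubC.
  rewrite /= ltnS; apply: (leq_trans (size_sum _ _ _)); apply/bigmax_leqP => j _.
  apply: (leq_trans (size_scale_leq _ _)); apply: (leq_trans (size_scale_leq _ _)).
  by rewrite size_deflated.
apply: H; last first.
  by apply/negP => /mapP[j _ E]; move: (zj j); rewrite E subrr eqxx.
rewrite rootE /D hornerD hornerN hornerM !hornerD !hornerN hornerC hornerX subrr mul0r subr0.
rewrite !hornerZ [q.[z] * _]mulrC subrr eqxx/=.
apply/allP => _ /mapP[k _ ->]; rewrite rootE hornerD hornerN hornerM !hornerD !hornerN hornerC hornerX !hornerZ.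
rewrite (rootP (lambda_root k)) mulr0 subr0 horner_sum (bigD1 k)//= big1; last first.
  by move=> j jk; rewrite hornerZ numer_other ?mulr0// eq_sym.
rewrite hornerZ numer_at addr0 subr_eq0; apply/eqP.
move: (zj k); move: (z - _) p.[z] q.[_] => a b c a0.
by field.
Qed.

(** The identity behind the expansion: multiplied by (r(z) / r(w)) ^ k, its right
side telescopes in k. *)
Lemma delta_partial_fractions z w : p.[w] != 0 -> q.[w] != 0 -> q.[z] != 0 -> w != z ->
  \sum_(j < d) delta p q (lambda j) z / (w - lambda j) =
  (1 - ratfun p q z / ratfun p q w) / (w - z).
Proof.
move=> pw qw qz wz; have := congr1 (horner^~ z) (partial_fractions pw).
rewrite /= hornerD hornerN hornerM !hornerZ hornerD hornerN hornerC hornerX horner_sum => E.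
have wz0 : w - z != 0 by rewrite subr_eq0.
have -> : \sum_(j < d) delta p q (lambda j) z / (w - lambda j) =
   (\sum_(j < d) (p.[w] / (w - lambda j) *: numer j).[z]) / (p.[w] * q.[z]).
  rewrite mulr_suml; apply: eq_bigr => j _; rewrite delta_ratio// hornerZ.
  have := node_neq j pw; move: pw qz; move: (w - _) p.[w] q.[z] (numer j).[z] => a b c e b0 c0 a0.
  by field; rewrite a0 b0 c0.
have -> : \sum_(j < d) (p.[w] / (w - lambda j) *: numer j).[z] =
   (p.[w] * q.[z] - q.[w] * p.[z]) / (w - z).
  by rewrite E mulrC mulKf.
rewrite /ratfun; move: pw qw qz wz0; move: (w - z) p.[w] q.[w] p.[z] q.[z] => a b c e f b0 c0 f0 a0.
by field; rewrite a0 b0 c0 f0.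
Qed.

End Lagrange.

(** * Expansion in powers of r *)

Section Expansion.
Variables (R : realType) (d : nat) (G : contour R) (phi r : R[i] -> R[i])
  (lambda : 'I_d -> R[i]).
Hypotheses (phi_cont : cont_on (ctrace G) phi) (r_cont : cont_on (ctrace G) r)
  (r_neq0 : forall w, ctrace G w -> r w != 0)
  (off_nodes : forall j w, ctrace G w -> w - lambda j != 0).

(** The coefficient of delta_j r ^ k in the expansion of phi. *)
Definition acoef (j : 'I_d) k : R[i] := (two_pi_i R)^-1 *
  contour_integral G (fun w => phi w * ((r w)^-1 ^+ k * (w - lambda j)^-1)).

Let rV_cont k : cont_on (ctrace G) (fun w => phi w * (r w)^-1 ^+ k).
Proof. apply: cont_onM phi_cont _; apply: cont_onX; exact: cont_onV r_cont r_neq0. Qed.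

Let node_cont j : cont_on (ctrace G) (fun w => (w - lambda j)^-1).
Proof. apply: cont_onV; [exact: cont_on_sub|by move=> w Gw; exact: off_nodes]. Qed.

(** The relation between m and g covers two cases: the scalar one, with
g k w = r(z) ^ k / (w - z), and the operator one, with g k w the inner product
of R(w) r(A) ^ k x and y. *)
Lemma expansion_telescope (m : 'I_d -> nat -> R[i]) (g : nat -> R[i] -> R[i]) N :
  (forall k, cont_on (ctrace G) (g k)) ->
  (forall k w, ctrace G w ->
    \sum_(j < d) m j k / (w - lambda j) = g k w - g k.+1 w / r w) ->
  \sum_(k < N) \sum_(j < d) acoef j k * m j k =
  (two_pi_i R)^-1 * contour_integral G (fun w => phi w * g 0%N w) -
  (two_pi_i R)^-1 * contour_integral G (fun w => (phi w * (r w)^-1 ^+ N) * g N w).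
Proof.
move=> gc gm; elim: N => [|N IH].
  rewrite big_ord0; apply/eqP; rewrite eq_sym subr_eq0; apply/eqP; congr (_ * _).
  by apply: cint_ext => w _; rewrite expr0 mulr1.
rewrite big_ord_recr/= {}IH -addrA; congr (_ + _).
have c1 j : cont_on (ctrace G) (fun w => m j N * (phi w * ((r w)^-1 ^+ N * (w - lambda j)^-1))).
  apply: cont_onZ; apply: cont_onM phi_cont _; apply: cont_onM _ (@node_cont j).
  by apply: cont_onX; exact: cont_onV r_cont r_neq0.
have -> : \sum_(j < d) acoef j N * m j N = (two_pi_i R)^-1 *
    contour_integral G (fun w => \sum_(j < d) m j N * (phi w * ((r w)^-1 ^+ N * (w - lambda j)^-1))).
  rewrite (cint_sum _ c1) mulr_sumr; apply: eq_bigr => j _.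
  rewrite cintZ; first by rewrite /acoef -mulrA [X in _ * X]mulrC.
  apply: cont_onM phi_cont _; apply: cont_onM _ (@node_cont j).
  by apply: cont_onX; exact: cont_onV r_cont r_neq0.
have -> : contour_integral G (fun w => \sum_(j < d) m j N * (phi w * ((r w)^-1 ^+ N * (w - lambda j)^-1))) =
   contour_integral G (fun w => (phi w * (r w)^-1 ^+ N) * g N w) +
   (-1) * contour_integral G (fun w => (phi w * (r w)^-1 ^+ N.+1) * g N.+1 w).
  have c2 k : cont_on (ctrace G) (fun w => (phi w * (r w)^-1 ^+ k) * g k w).
    exact: cont_onM (@rV_cont k) (gc k).
  rewrite -(cintZ (-1) (c2 N.+1)) -(cintD (c2 N) (cont_onZ (c:=-1) (c2 N.+1))).
  apply: cint_ext => w Gw.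
  have -> : \sum_(j < d) m j N * (phi w * ((r w)^-1 ^+ N * (w - lambda j)^-1)) =
     (phi w * (r w)^-1 ^+ N) * \sum_(j < d) m j N / (w - lambda j).
    rewrite mulr_sumr; apply: eq_bigr => j _.
    by rewrite mulrCA -[RHS]mulrA; congr (_ * _); exact: mulrCA.
  rewrite (gm N w Gw) exprS.
  by move: ((r w)^-1 ^+ N) ((r w)^-1) (phi w) (g N w) (g N.+1 w) => a b c e f; ring.
by rewrite mulN1r mulrBr addKr.
Qed.

(** C depends only on G and phi, so the approximation is uniform in whatever
parameters m and g involve. *)
Lemma expansion_tail (rho rho1 : R) : 0 <= rho -> 0 < rho1 ->
  (forall w, ctrace G w -> rho1 <= rnorm (r w)) ->
  exists2 C : R, 0 <= C & forall (m : 'I_d -> nat -> R[i]) (g : nat -> R[i] -> R[i]) (M : R) N,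
  (forall k, cont_on (ctrace G) (g k)) ->
  (forall k w, ctrace G w -> rnorm (g k w) <= M * rho ^+ k) ->
  (forall k w, ctrace G w ->
    \sum_(j < d) m j k / (w - lambda j) = g k w - g k.+1 w / r w) ->
  rnorm (\sum_(k < N) \sum_(j < d) acoef j k * m j k -
         (two_pi_i R)^-1 * contour_integral G (fun w => phi w * g 0%N w)) <=
  C * M * (rho / rho1) ^+ N.
Proof.
move=> rho0 rho10 rr; have [S S0 HS] := ctrace_bounded phi_cont.
exists (rnorm (two_pi_i R)^-1 * (2 * S * clength G)).
  by rewrite mulr_ge0 ?rnorm_ge0 ?mulr_ge0 ?clength_ge0.
move=> m g M N gc gM gm; rewrite (expansion_telescope N gc gm) addrAC subrr add0r rnormN rnormM.
rewrite -!mulrA; apply: ler_wpM2l; first exact: rnorm_ge0.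
have H : rnorm (contour_integral G (fun w => (phi w * (r w)^-1 ^+ N) * g N w)) <=
   2 * (S * (M * (rho / rho1) ^+ N)) * clength G.
  have cN : cont_on (ctrace G) (fun w => (phi w * (r w)^-1 ^+ N) * g N w).
    exact: cont_onM (@rV_cont N) (gc N).
  apply: (cint_bound cN).
  move=> w Gw; rewrite !rnormM rnormX rnormV -mulrA.
  apply: ler_pM; [exact: rnorm_ge0| |exact: HS|].
    by rewrite mulr_ge0 ?rnorm_ge0// exprn_ge0// invr_ge0 rnorm_ge0.
  have -> : M * (rho / rho1) ^+ N = rho1^-1 ^+ N * (M * rho ^+ N).
    by rewrite exprMn; move: (rho ^+ N) (_ ^+ N) => a b; ring.
  apply: ler_pM; [by rewrite exprn_ge0// invr_ge0 rnorm_ge0|exact: rnorm_ge0| |exact: gM].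
  have h := rr w Gw; rewrite lerXn2r ?nnegrE ?invr_ge0 ?rnorm_ge0 ?(ltW rho10)//.
  by rewrite lef_pV2 ?posrE// (lt_le_trans rho10 h).
apply: (le_trans H); rewrite -!mulrA ler_wpM2l// ler_wpM2l//.
by rewrite [leRHS]mulrC -!mulrA.
Qed.

End Expansion.

Section Growth.
Variable (R : realType).
Implicit Types (p q h : {poly R[i]}) (z : R[i]).

Lemma horner_growth h n : (size h <= n)%N -> exists2 S : R, 0 <= S &
  forall z, 1 <= rnorm z -> rnorm z * rnorm h.[z] <= S * rnorm z ^+ n.
Proof.
move=> hn; exists (\sum_(i < n) rnorm h`_i); first by apply: sumr_ge0 => i _; exact: rnorm_ge0.
move=> z z1; rewrite (horner_coef_wide z hn) mulr_suml.
apply: (le_trans (ler_wpM2l (rnorm_ge0 _) (ler_rnorm_sum _ _ _))).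
rewrite mulr_sumr; apply: ler_sum => i _; rewrite rnormM mulrCA rnormX -exprS.
by rewrite ler_wpM2l ?rnorm_ge0// ler_weXn2l.
Qed.

(** After multiplication by |z|, everything but the leading term of p is of order
|z| ^ deg p. *)
Lemma rational_growth p q (rho : R) : (size q < size p)%N -> 0 <= rho ->
  exists M : R, forall z, M < rnorm z -> rho * rnorm q.[z] < rnorm p.[z].
Proof.
move=> qp rho0; pose n := (size p).-1.
have sp : size p = n.+1 by rewrite /n; lia.
have l0 : 0 < rnorm p`_n.
  by rewrite rnorm_gt0 -[p`_n]/(lead_coef p) lead_coef_eq0 -size_poly_eq0 sp.
have [S1 S10 H1] := @horner_growth (\poly_(i < n) p`_i) n (size_poly _ _).
have [S2 S20 H2] := @horner_growth q n (leq_trans qp (eq_leq sp) : (size q <= n)%N).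
exists (Num.max 1 ((S1 + rho * S2) / rnorm p`_n)) => z.
rewrite gt_max => /andP[z1 zM].
have z0 : 0 < rnorm z by exact: lt_trans z1.
have {}H1 := H1 z (ltW z1); have {}H2 := H2 z (ltW z1).
rewrite -(ltr_pM2l z0) mulrCA; apply: (le_lt_trans (ler_wpM2l rho0 H2)).
rewrite ltr_pdivrMr// in zM.
have E : p.[z] = (\poly_(i < n) p`_i).[z] + p`_n * z ^+ n.
  by rewrite [LHS]horner_coef sp big_ord_recr/= horner_poly.
have : rnorm (p`_n * z ^+ n) <= rnorm p.[z] + rnorm (\poly_(i < n) p`_i).[z].
  by rewrite {1}(_ : p`_n * z ^+ n = p.[z] - (\poly_(i < n) p`_i).[z]) ?ler_rnormB// E addrC addKr.
rewrite rnormM rnormX => h; have {}h := ler_wpM2l (ltW z0) h; rewrite mulrDr in h.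
have Z : 0 < rnorm z ^+ n by rewrite exprn_gt0.
have {}zM : (S1 + rho * S2) * rnorm z ^+ n < rnorm z * rnorm p`_n * rnorm z ^+ n by rewrite ltr_pM2r.
move: h H1 zM; rewrite !mulrDl !mulrA; lra.
Qed.

Lemma cont_at_rnorm_horner h (z : R[i]) : {for z, continuous (fun z : R[i] => rnorm h.[z])}.
Proof.
apply: (continuous_comp (f := horner h)); first exact: (@cont_on_horner R setT h z I).
exact: continuous_rnorm.
Qed.

End Growth.

(** * The lemniscate *)

Lemma ratfun_cont (R : realType) (p q : {poly R[i]}) (S : set R[i]) :
  (forall z, S z -> q.[z] != 0) -> cont_on S (ratfun p q).
Proof.
move=> Sq; apply: cont_onM; first exact: cont_on_horner.
by apply: cont_onV Sq; exact: cont_on_horner.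
Qed.

Section Lemniscate.
Variables (R : realType) (p q : {poly R[i]}) (rho : R).
Hypotheses (qp : (size q < size p)%N) (coprime_pq : forall z, q.[z] = 0 -> p.[z] != 0)
  (rho_ge0 : 0 <= rho).
Local Notation r := (ratfun p q).

(** In this form, without denominator, the poles are excluded because p does not
vanish there. *)
Lemma lemniscateE : lemniscate p q rho =
  [set z | 0 <= rho * rnorm q.[z] - rnorm p.[z]].
Proof.
apply/seteqP; split=> z /=; rewrite subr_ge0.
  by case=> qz; rewrite /ratfun rnormM rnormV ler_pdivrMr// rnorm_gt0.
move=> h; have qz : q.[z] != 0.
  apply/eqP => qz; move: (coprime_pq qz); rewrite -rnorm_gt0 ltNge.
  by move: h; rewrite qz rnorm0 mulr0 => ->.
by split=> //; rewrite /ratfun rnormM rnormV ler_pdivrMr// rnorm_gt0.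
Qed.

Lemma closed_lemniscate : closed (lemniscate p q rho).
Proof.
rewrite lemniscateE.
apply: (@closed_comp _ _ (fun z : R[i] => rho * rnorm q.[z] - rnorm p.[z]) [set x | 0 <= x]).
  move=> z _; suff : {for z, continuous (fun z : R[i] => rho * rnorm q.[z] - rnorm p.[z])} by [].
  apply: continuousB; last exact: cont_at_rnorm_horner.
  by apply: continuousM; [exact: cst_continuous|exact: cont_at_rnorm_horner].
exact: closed_ge.
Qed.

Lemma lemniscate_rbounded : rbounded (lemniscate p q rho).
Proof.
have [M HM] := rational_growth qp rho_ge0; exists M => z; rewrite lemniscateE /= subr_ge0.
by rewrite leNgt => h; rewrite leNgt; apply/negP => /HM h2; rewrite h2 in h.
Qed.

(** On the compact trace of G the continuous function |r| exceeds rho, hence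
exceeds it by a fixed amount. *)
Lemma lemniscate_contour (U : set R[i]) : open U -> lemniscate p q rho `<=` U ->
  exists (G : contour R) (rho1 m : R),
  [/\ [/\ surrounds G (lemniscate p q rho) (U `&` [set z | q.[z] != 0]),
     rho < rho1 & 0 < m],
   forall f, holomorphic_on U f -> forall z, lemniscate p q rho z ->
     contour_integral G (fun w => f w * (w - z)^-1) = two_pi_i R * f z,
   forall w, ctrace G w -> q.[w] != 0 /\ rho1 <= rnorm (r w) &
   forall w z, ctrace G w -> lemniscate p q rho z -> m <= rnorm (w - z)].
Proof.
move=> Uo VU; have Wo : open (U `&` [set z | q.[z] != 0]) by apply: openI Uo _; exact: open_neq0.
have VW : lemniscate p q rho `<=` U `&` [set z | q.[z] != 0].
  by move=> z Vz; split; [exact: VU|case: Vz].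
have [G [GW cauchy]] := grid_contour closed_lemniscate lemniscate_rbounded Wo VW.
have [cl Gt _ _] := surroundsP GW.
have Gq w : ctrace G w -> q.[w] != 0 by move=> /Gt[[_ h] _].
have Gr w : ctrace G w -> rho < rnorm (r w).
  move=> Gw; have [_ nV] := Gt w Gw; rewrite ltNge; apply/negP => h; apply: nV.
  by split; [exact: Gq|].
have rc : cont_on (ctrace G) r.
  exact: ratfun_cont Gq.
have [M HM] : exists M, forall w, ctrace G w -> (rnorm (r w) - rho)^-1 <= M.
  apply: ctrace_max => w Gw; apply: continuousV; first by rewrite gt_eqF// subr_gt0 Gr.
  apply: continuousB; last exact: cst_continuous.
  apply: (continuous_comp (f := r)); [exact: rc|exact: continuous_rnorm].
exists G, (rho + (`|M| + 1)^-1).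
have M0 : 0 < `|M| + 1 by rewrite ltr_wpDl.
have H1 w : ctrace G w -> q.[w] != 0 /\ rho + (`|M| + 1)^-1 <= rnorm (r w).
  move=> Gw; split; first exact: Gq.
  rewrite -lerBrDl -[leRHS]invrK lef_pV2 ?posrE ?invr_gt0 ?subr_gt0 ?Gr//.
  apply: (le_trans (HM w Gw)); apply: (le_trans (ler_norm M)); by rewrite lerDl.
have [m m0 Hm] : exists2 m : R, 0 < m &
    forall z w, lemniscate p q rho z -> rnorm (w - z) < m -> (~` ctrace G) w.
  apply: compact_margin.
  - exact: (closed_bounded_compact closed_lemniscate lemniscate_rbounded).
  - rewrite openE => z nGz; have [e e0 He] := ctrace_dist nGz.
    apply/nbhs_rnormP; exists e => // w wz Gw; have := He w Gw.
    by rewrite leNgt wz.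
  - by move=> z Vz /Gt[_].
exists m; split => //.
- by split=> //; rewrite ltrDl invr_gt0.
- move=> f hf; apply: cauchy => z [Uz _]; exact: hf.
- move=> w z Gw Vz; rewrite leNgt; apply/negP => /(Hm z w Vz); exact.
Qed.

End Lemniscate.

Section Bounds.
Variable R : realType.

Lemma sup_on_ge0 (S : set R[i]) (f : R[i] -> R[i]) : 0 <= sup_on S f.
Proof.
rewrite /sup_on; have [[S0 Sb]|/sup_out ->//] := pselect (has_sup [set rnorm (f z) | z in S]).
have [x Sx] := S0; apply: (le_trans _ (ub_le_sup Sb Sx)).
by case: Sx => z _ <-; exact: rnorm_ge0.
Qed.

Lemma sup_on_le (S : set R[i]) (f : R[i] -> R[i]) (M : R) : S !=set0 ->
  (forall z, S z -> rnorm (f z) <= M) -> sup_on S f <= M.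
Proof.
move=> [z Sz] H; apply: ge_sup; first by exists (rnorm (f z)), z.
by move=> _ [w Sw <-]; exact: H.
Qed.

Lemma le_sup_on (S : set R[i]) (f : R[i] -> R[i]) (M : R) z :
  (forall z, S z -> rnorm (f z) <= M) -> S z -> rnorm (f z) <= sup_on S f.
Proof.
by move=> H Sz; apply: ub_le_sup; [exists M => _ [w Sw <-]; exact: H|exists z].
Qed.

Variables (d : nat) (p q : {poly R[i]}) (lambda : 'I_d -> R[i]) (rho c : R).
Hypotheses (rho_ge0 : 0 <= rho) (c_const : multicentric_const p q lambda rho c).

Lemma cdisc0 : cdisc rho 0. Proof. by rewrite /cdisc /= rnorm0. Qed.

(** For the constant functions f_j = 1 the left side of the inequality that
defines c is 1. *)
Lemma multicentric_const_ge0 : (0 < d)%N -> 0 <= c.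
Proof.
move=> d0; rewrite leNgt; apply/negP => c0.
have hol : forall j : 'I_d, holomorphic_in (cdisc rho) (fun=> 1 : R[i]).
  move=> _; exists setT; split=> //; exact: openT.
have /= := c_const hol; rewrite leNgt => /negP; apply.
apply: (@le_lt_trans _ _ 0); first by rewrite nmulr_rle0// sup_on_ge0.
apply: (@lt_le_trans _ _ 1) => //; apply: ub_le_sup.
  exists 1 => _ [w _ <-]; apply: bigmax_le => // j _; by rewrite rnorm1.
exists 0; first exact: cdisc0.
apply/eqP; rewrite eq_le; apply/andP; split.
  by apply: bigmax_le => // j _; rewrite rnorm1.
rewrite -[leLHS](rnorm1 R); exact: (le_bigmax _ (fun _ : 'I_d => rnorm (1 : R[i])) (Ordinal d0)).
Qed.

(** The suprema in the definition of c are taken in R, where that of an unbounded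
set is 0; polynomials are bounded on the disc. *)
Lemma multicentric_poly (P : 'I_d -> {poly R[i]}) (M : R) j w : 0 <= c ->
  lemniscate p q rho !=set0 ->
  (forall z, lemniscate p q rho z ->
    rnorm (\sum_(j < d) delta p q (lambda j) z * (P j).[ratfun p q z]) <= M) ->
  rnorm w <= rho -> rnorm (P j).[w] <= c * M.
Proof.
move=> c0 V0 PM wr.
have hol : forall j : 'I_d, holomorphic_in (cdisc rho) (horner (P j)).
  move=> i; exists setT; split=> //; first exact: openT.
  by move=> z _; apply: cder_derivable; exact: cder_horner.
have H := c_const hol; apply: (le_trans _ (le_trans H _)); last first.
  by apply: ler_wpM2l => //; apply: sup_on_le.
have [S HS] : exists S : 'I_d -> R, forall i z, rnorm z <= rho -> rnorm (P i).[z] <= S i.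
  have /choice[S HS] : forall i, exists S : R, forall z : R[i], rnorm z <= rho -> rnorm (P i).[z] <= S.
    move=> i; have [L [L0 HL]] := horner_lipschitz (P i) rho_ge0.
    exists (L * rho + rnorm (P i).[0]) => z zr.
    rewrite -[X in rnorm X](subrK (P i).[0]); apply: (le_trans (ler_rnormD _ _)).
    rewrite lerD2r; have h0 : rnorm (0 : R[i]) <= rho by rewrite rnorm0.
    apply: (le_trans (HL _ _ zr h0)); rewrite subr0; exact: ler_wpM2l.
  by exists S.
apply: (@le_trans _ _ (\big[Num.max/0]_(i < d) rnorm (P i).[w])).
  exact: (le_bigmax _ (fun i : 'I_d => rnorm (P i).[w]) j).
apply: ub_le_sup; last by exists w.
exists (\big[Num.max/0]_(i < d) S i) => _ [z zr <-].
by apply: le_bigmax2 => i _; exact: HS.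
Qed.

End Bounds.

(** * Approximation of phi and of its value at A *)

Section ScalarExpansion.
Variables (R : realType) (d : nat) (p q : {poly R[i]}) (lambda : 'I_d -> R[i]).
Hypotheses (size_p : size p = d.+1) (lambda_inj : injective lambda)
  (lambda_root : forall j, root p (lambda j)) (size_q : (size q <= d)%N)
  (q_lambda : forall j, q.[lambda j] != 0).
Variables (rho rho1 m : R) (phi : R[i] -> R[i]) (G : contour R).
Local Notation r := (ratfun p q).
Local Notation VR := (lemniscate p q rho).
Hypotheses (rho_ge0 : 0 <= rho) (rho_lt : rho < rho1) (m_gt0 : 0 < m)
  (phi_cont : cont_on (ctrace G) phi)
  (cauchy : forall z, VR z ->
    contour_integral G (fun w => phi w * (w - z)^-1) = two_pi_i R * phi z)
  (G_poles : forall w, ctrace G w -> q.[w] != 0)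
  (G_large : forall w, ctrace G w -> rho1 <= rnorm (r w))
  (G_away : forall w z, ctrace G w -> VR z -> m <= rnorm (w - z)).

Let rho1_gt0 : 0 < rho1. Proof. exact: le_lt_trans rho_lt. Qed.

Lemma ratio_off_zero w : ctrace G w -> r w != 0.
Proof. by move=> /G_large h; rewrite -rnorm_gt0; exact: lt_le_trans h. Qed.

Lemma num_off_zero w : ctrace G w -> p.[w] != 0.
Proof. by move=> /ratio_off_zero; rewrite /ratfun mulf_eq0 negb_or => /andP[]. Qed.

Lemma trace_off_nodes j w : ctrace G w -> w - lambda j != 0.
Proof. by move=> /num_off_zero; exact: (node_neq lambda_root). Qed.

Let inv_cont z : VR z -> cont_on (ctrace G) (fun w => (w - z)^-1).
Proof.
move=> Vz; apply: cont_onV; first exact: cont_on_sub.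
by move=> w Gw; rewrite -rnorm_gt0 (lt_le_trans m_gt0)// G_away.
Qed.

Let inv_bound w z : ctrace G w -> VR z -> rnorm (w - z)^-1 <= m^-1.
Proof.
move=> Gw Vz; have h := G_away Gw Vz.
by rewrite rnormV lef_pV2 ?posrE// (lt_le_trans m_gt0 h).
Qed.

Let phiE z : VR z ->
  phi z = (two_pi_i R)^-1 * contour_integral G (fun w => phi w * (w - z)^-1).
Proof. by move=> Vz; rewrite cauchy// mulrA mulVf ?two_pi_i_neq0// mul1r. Qed.

(** Cauchy's formula bounds phi on the lemniscate, so the supremum is an upper
bound. *)
Lemma le_sup_lemniscate z : VR z -> rnorm (phi z) <= sup_on VR phi.
Proof.
have [B B0 HB] := ctrace_bounded phi_cont => Vz.
apply: (@le_sup_on _ _ _ (rnorm (two_pi_i R)^-1 * (2 * (B * m^-1) * clength G))) Vz => {}z Vz.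
rewrite phiE// rnormM; apply: ler_wpM2l; first exact: rnorm_ge0.
apply: cint_bound; first exact: cont_onM phi_cont (inv_cont Vz).
move=> w Gw; rewrite rnormM.
by apply: ler_pM; [exact: rnorm_ge0|exact: rnorm_ge0|exact: HB|exact: inv_bound].
Qed.

Definition approximant N j : {poly R[i]} := \poly_(k < N) acoef G phi r lambda j k.

(** This is expansion_tail for g k w = r(z) ^ k / (w - z), which is at most
rho ^ k / m. *)
Lemma approximant_lemniscate : exists2 C : R, 0 <= C & forall N z, VR z ->
  rnorm (\sum_(j < d) delta p q (lambda j) z * (approximant N j).[r z] - phi z) <=
  C * (rho / rho1) ^+ N.
Proof.
have rc : cont_on (ctrace G) r by exact: ratfun_cont.
have [C C0 tail] := expansion_tail phi_cont rc ratio_off_zero trace_off_nodes rho_ge0 rho1_gt0 G_large.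
exists (C * m^-1); first by rewrite mulr_ge0// invr_ge0 ltW.
move=> N z Vz; have [qz rz] := Vz.
have := tail (fun j k => delta p q (lambda j) z * r z ^+ k) (fun k w => r z ^+ k * (w - z)^-1) m^-1 N.
have -> : \sum_(k < N) \sum_(j < d) acoef G phi r lambda j k * (delta p q (lambda j) z * r z ^+ k) =
   \sum_(j < d) delta p q (lambda j) z * (approximant N j).[r z].
  rewrite exchange_big; apply: eq_bigr => j _; rewrite horner_poly mulr_sumr.
  by apply: eq_bigr => k _; rewrite mulrCA.
have -> : contour_integral G (fun w => phi w * (r z ^+ 0 / (w - z))) =
   contour_integral G (fun w => phi w * (w - z)^-1).
  by apply: cint_ext => w _; rewrite expr0 mul1r.
rewrite -(phiE Vz); apply.
- by move=> k; apply: cont_onZ; exact: inv_cont.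
- move=> k w Gw; rewrite rnormM rnormX mulrC.
  apply: ler_pM; [exact: rnorm_ge0|by rewrite exprn_ge0// rnorm_ge0|exact: inv_bound|].
  by rewrite lerXn2r ?nnegrE ?rnorm_ge0.
- move=> k w Gw.
  have wz : w != z.
    by have := G_away Gw Vz; apply: contraTneq => ->; rewrite subrr rnorm0 -ltNge.
  have E := delta_partial_fractions size_p lambda_inj lambda_root size_q q_lambda
    (num_off_zero Gw) (G_poles Gw) qz wz.
  have -> : \sum_(j < d) delta p q (lambda j) z * r z ^+ k / (w - lambda j) =
      r z ^+ k * \sum_(j < d) delta p q (lambda j) z / (w - lambda j).
    by rewrite mulr_sumr; apply: eq_bigr => j _; rewrite mulrAC mulrC.
  by rewrite E exprS; move: (r z ^+ k) (r z) (r w)^-1 (w - z)^-1 => X a b e; ring.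
Qed.

End ScalarExpansion.

Section MulticentricOperator.
Variables (R : realType) (d : nat) (p q : {poly R[i]}) (lambda : 'I_d -> R[i]).
Hypotheses (size_p : size p = d.+1) (lambda_inj : injective lambda)
  (lambda_root : forall j, root p (lambda j)) (q_neq0 : q != 0) (size_q : (size q <= d)%N)
  (q_lambda : forall j, q.[lambda j] != 0).
Variables (V : completeNormedModType R[i]) (ip : {dot V for Num.conj}).
Hypothesis ip_norm : forall x : V, ip x x = `|x| ^+ 2.
Variable (A : {linear V -> V}).
Hypotheses (Ac : continuous A) (A_poles : forall z, spectrum A z -> q.[z] != 0).
Implicit Types (x y : V) (z w : R[i]) (j : 'I_d).
Local Notation r := (ratfun p q).
Local Notation Rz := (resolvent A).
Local Notation Tr := (hfc ip A (ratfun p q)).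
Local Notation T j := (hfc ip A (delta p q (lambda j))).
Local Notation u := (numer p q lambda).

Let pole z : q.[z] = 0 -> p.[z] != 0.
Proof. exact: (num_at_pole size_p lambda_inj lambda_root q_lambda). Qed.

Variable Q : {linear V -> V}.
Hypotheses (Qc : continuous Q) (Q1 : forall x, Q (pop A q x) = x)
  (Q2 : forall x, pop A q (Q x) = x).

Lemma ratfun_op x : Tr x = pop A p (Q x).
Proof. by apply: (hfc_ratio ip_norm Ac q_neq0 _ pole Qc Q2 A_poles). Qed.

Lemma delta_op j x : T j x = pop A (u j) (Q x).
Proof.
apply: (hfc_ratio ip_norm Ac q_neq0 _ _ Qc Q2 A_poles).
  exact: (delta_ratio size_p lambda_inj lambda_root q_lambda).
exact: (numer_at_pole size_p lambda_inj lambda_root q_lambda).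
Qed.

Lemma inv_denom_comm x : A (Q x) = Q (A x).
Proof. by rewrite -{2}(Q2 x) pop_A Q1. Qed.

Lemma ratfun_op_comm x : A (Tr x) = Tr (A x).
Proof. by rewrite !ratfun_op pop_A inv_denom_comm. Qed.

Let popQ_continuous s : continuous (pop A s \o Q).
Proof. by move=> v; apply: continuous_comp; [exact: Qc|exact: pop_continuous]. Qed.

Lemma ratfun_op_continuous : continuous Tr.
Proof.
have -> : (Tr : V -> V) = pop A p \o Q by apply/funext => x; exact: ratfun_op.
exact: popQ_continuous.
Qed.

Lemma delta_op_continuous j : continuous (T j).
Proof.
have -> : (T j : V -> V) = pop A (u j) \o Q by apply/funext => x; exact: delta_op.
exact: popQ_continuous.
Qed.

Let S z : {poly R[i]} := \sum_(j < d) (p.[z] / (z - lambda j)) *: u j.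

(** Substitute A for the variable in partial_fractions and apply the result to
q(A) ^ - 1 x. *)
Lemma partial_fractions_shift z x : p.[z] != 0 ->
  z *: pop A (S z) (Q x) - A (pop A (S z) (Q x)) = p.[z] *: x - q.[z] *: Tr x.
Proof.
move=> pz; have popN s v : pop A (- s) v = - pop A s v by rewrite -scaleN1r popZ scaleN1r.
have popX v : pop A 'X v = A v by rewrite -['X]mul1r popMX -[1]/(1%:P) popC scale1r.
have := congr1 (fun s => pop A s (Q x)) (partial_fractions size_p lambda_inj lambda_root size_q pz).
rewrite /= popM !popD !popN !popZ Q2 -ratfun_op => ->.
by rewrite popC popX.
Qed.

(** The operator counterpart of delta_partial_fractions, with the resolvent in
the role of 1 / (w - z). *)
Lemma partial_fractions_op z x : p.[z] != 0 -> ~ spectrum A z ->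
  \sum_(j < d) (z - lambda j)^-1 *: T j x =
  Rz z x - (q.[z] / p.[z]) *: Rz z (Tr x).
Proof.
move=> pz nz; have [_ RA _] := resolventP nz.
have E := RA (pop A (S z) (Q x)); rewrite partial_fractions_shift// in E.
have -> : \sum_(j < d) (z - lambda j)^-1 *: T j x = p.[z]^-1 *: pop A (S z) (Q x).
  rewrite pop_sum scaler_sumr; apply: eq_bigr => j _.
  by rewrite popZ scalerA mulrA mulVf// mul1r delta_op.
rewrite -E (linearB (Rz z)) !(linearZ_LR (Rz z)) scalerBr !scalerA mulVf// scale1r.
by rewrite [q.[z] / _]mulrC.
Qed.

Variable rho : R.
Hypotheses (rho_ge0 : 0 <= rho) (Tr_le : opnorm Tr <= rho).

Lemma ratfun_op_le x : rnorm (Tr x) <= rho * rnorm x.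
Proof.
apply: (le_trans (le_opnorm x ratfun_op_continuous)).
by apply: ler_wpM2r; [exact: rnorm_ge0|].
Qed.

(** If |r(z)| > rho, then p(z) - q(z) r(A) is invertible, r(A) being small, and
partial_fractions_shift factors it through z - A. *)
Lemma spectrum_sub_lemniscate : spectrum A `<=` lemniscate p q rho.
Proof.
move=> z sz; have qz := A_poles sz; split=> //; rewrite leNgt; apply/negP => rz.
have q0 : 0 < rnorm q.[z] by rewrite rnorm_gt0.
have pq : rho * rnorm q.[z] < rnorm p.[z].
  by move: rz; rewrite /ratfun rnormM rnormV ltr_pdivlMr.
have p0 : 0 < rnorm p.[z] by apply: le_lt_trans pq; rewrite mulr_ge0 ?rnorm_ge0.
have pz : p.[z] != 0 by rewrite -rnorm_gt0.
pose L : {linear V -> V} := pop A (S z) \o Q.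
have Lc : continuous L by exact: popQ_continuous.
have LE x : z *: L x - A (L x) = p.[z] *: x - q.[z] *: Tr x by exact: partial_fractions_shift.
have Lcomm x : L (z *: x - A x) = z *: L x - A (L x).
  rewrite (linearB L) (linearZ_LR L); congr (_ - _).
  by rewrite /L /= -inv_denom_comm pop_A.
have [k k0 Lk] := linear_bounded Lc.
have k1 : 0 < k + 1 by rewrite ltr_wpDl.
suff : ~ spectrum A z by apply.
apply: (@resolvent_exists _ _ _ _ ((rnorm p.[z] - rho * rnorm q.[z]) / (k + 1))).
- by rewrite divr_gt0// subr_gt0.
- move=> x; rewrite mulrAC ler_pdivrMr//.
  apply: (@le_trans _ _ (rnorm (L (z *: x - A x)))).
    rewrite Lcomm LE; apply: le_trans (lerB_rnorm _ _); rewrite !rnormZ mulrBl lerD2l lerN2.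
    rewrite mulrAC (mulrC _ (rnorm q.[z])); apply: ler_wpM2l; [exact: rnorm_ge0|exact: ratfun_op_le].
  apply: (le_trans (Lk _)); rewrite mulrC; apply: ler_wpM2l; first exact: rnorm_ge0.
  by rewrite lerDl.
- move=> y; pose F x := p.[z]^-1 *: y + (q.[z] / p.[z]) *: Tr x.
  have [x Fx] : exists x, F x = x.
    apply: (@contraction_fixpoint _ _ F (rho * rnorm q.[z] / rnorm p.[z])).
    + by rewrite divr_ge0 ?mulr_ge0 ?rnorm_ge0.
    + by rewrite ltr_pdivrMr// mul1r.
    + move=> x x'; rewrite /F opprD addrACA subrr add0r -scalerBr -(linearB Tr) rnormZ rnormM rnormV.
      apply: (le_trans (ler_wpM2l _ (ratfun_op_le _))); first by rewrite divr_ge0 ?rnorm_ge0.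
      by rewrite mulrCA !mulrA.
  exists (L x); rewrite LE -{1}Fx /F scalerDr !scalerA mulfV// scale1r.
  by rewrite mulrCA mulfV// mulr1 addrK.
Qed.

Variables (phi : R[i] -> R[i]) (U : set R[i]) (G : contour R).
Hypotheses (Uo : open U) (phiU : holomorphic_on U phi)
  (GU : surrounds G (lemniscate p q rho) (U `&` [set z | q.[z] != 0])).

(** The contour that defines F and G have equal index at the points of the
spectrum, namely 1, and at those outside both domains of phi, namely 0. *)
Lemma hfc_lemniscate_contour (F : {linear V -> V}) x y : is_hfc ip A phi F ->
  ip (F x) y = (two_pi_i R)^-1 * contour_integral G (fun z => phi z * ip (Rz z x) y).
Proof.
have sV := spectrum_sub_lemniscate.
move=> [_ [U' [G' [Uo' sU' phiU' GU' ->]]]]; rewrite -/(two_pi_i R); congr (_ * _).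
have [c1 t1 i1 o1] := surroundsP GU'; have [c2 t2 i2 o2] := surroundsP GU.
have Wo : open ((U' `|` U) `&` ~` spectrum A).
  by apply: openI; [exact: openU|apply: closed_openC; exact: closed_spectrum].
apply: (cint_homologous Wo c1 c2).
- by move=> z /t1[? ?]; split=> //; left.
- by move=> z /t2[[Uz _] nV]; split; [right|move=> /sV].
- move=> z nW; have [sz|nz] := pselect (spectrum A z); first by rewrite i1// i2//; exact: sV.
  rewrite o1; last by move=> Uz; apply: nW; split=> //; left.
  by rewrite o2// => -[Uz _]; apply: nW; split=> //; right.
- move=> z [UU nz]; apply: cder_derivable.
  have dz : derivable phi z 1 by case: UU; [exact: phiU'|exact: phiU].
  exact: cderM (derivable_cder dz) (resolvent_cder ip_norm x y nz).
Qed.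

Variables (rho1 m : R).
Local Notation VR := (lemniscate p q rho).
Hypotheses (rho_lt : rho < rho1) (m_gt0 : 0 < m)
  (cauchy : forall z, VR z ->
    contour_integral G (fun w => phi w * (w - z)^-1) = two_pi_i R * phi z)
  (G_large : forall w, ctrace G w -> rho1 <= rnorm (r w))
  (G_away : forall w z, ctrace G w -> VR z -> m <= rnorm (w - z)).
Local Notation appr := (approximant p q lambda phi G).

Let Gt : ctrace G `<=` [set z | (U `&` [set z | q.[z] != 0]) z /\ ~ VR z].
Proof. by have [] := surroundsP GU. Qed.

Let Gq w : ctrace G w -> q.[w] != 0. Proof. by move=> /Gt[[]]. Qed.

Let Gs w : ctrace G w -> ~ spectrum A w.
Proof. by move=> /Gt[_ nV] /spectrum_sub_lemniscate. Qed.

Let phi_cont : cont_on (ctrace G) phi.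
Proof. by move=> w /Gt[[Uw _] _]; apply: derivable_continuous_at; exact: phiU. Qed.

Let rho1_gt0 : 0 < rho1. Proof. exact: le_lt_trans rho_lt. Qed.

(** This is expansion_tail with the inner product of R(w) r(A) ^ k x and y for
g k w.  As r(A) commutes with R(w), it is at most rho ^ k |R(w) x| |y|. *)
Lemma approximant_op (F : {linear V -> V}) x y : is_hfc ip A phi F ->
  exists D : R, forall N,
  rnorm (ip (\sum_(j < d) T j (pop Tr (appr N j) x)) y - ip (F x) y) <=
  D * (rho / rho1) ^+ N.
Proof.
move=> HF; have rc : cont_on (ctrace G) r by exact: ratfun_cont.
have Gr := ratio_off_zero rho_ge0 rho_lt G_large.
have Gp := num_off_zero rho_ge0 rho_lt G_large.
have Gl := trace_off_nodes lambda_root rho_ge0 rho_lt G_large.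
have [C C0 tail] := expansion_tail phi_cont rc Gr Gl rho_ge0 rho1_gt0 G_large.
have [M HM] : exists M, forall w, ctrace G w -> rnorm (Rz w x) <= M.
  by apply: ctrace_max => w Gw; apply: resolvent_norm_cont; exact: Gs.
exists (C * (`|M| * rnorm y)) => N.
have := tail (fun j k => ip (T j (iter k Tr x)) y) (fun k w => ip (Rz w (iter k Tr x)) y) (`|M| * rnorm y) N.
have -> : \sum_(k < N) \sum_(j < d) acoef G phi r lambda j k * ip (T j (iter k Tr x)) y =
    ip (\sum_(j < d) T j (pop Tr (appr N j) x)) y.
  rewrite exchange_big ip_suml; apply: eq_bigr => j _.
  rewrite (pop_wide _ _ (size_poly N _)) (linear_sum (T j)) ip_suml.
  by apply: eq_bigr => k _; rewrite (linearZ_LR (T j)) ipZl coef_poly ltn_ord.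
rewrite -(hfc_lemniscate_contour _ _ HF); apply.
- by move=> k; apply: (resolvent_cont ip_norm); exact: Gs.
- move=> k w Gw; apply: (le_trans (cauchy_schwarz ip_norm _ _)).
  rewrite mulrAC; apply: ler_wpM2r; first exact: rnorm_ge0.
  rewrite mulrC; have -> : Rz w (iter k Tr x) = iter k Tr (Rz w x).
    elim: k => //= k IH.
    by rewrite (resolvent_comm _ (Gs Gw) ratfun_op_comm) IH.
  elim: k => [|k IH] /=.
    by rewrite expr0 mul1r; apply: (le_trans (HM w Gw)); exact: ler_norm.
  by apply: (le_trans (ratfun_op_le _)); rewrite exprS -mulrA; exact: ler_wpM2l.
- move=> k w Gw; have E := partial_fractions_op (iter k Tr x) (Gp w Gw) (Gs Gw).
  have := congr1 (ip^~ y) E; rewrite /= ip_suml ipBl ipZl => E'.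
  have -> : \sum_(j < d) ip (T j (iter k Tr x)) y / (w - lambda j) =
     \sum_(j < d) ip ((w - lambda j)^-1 *: T j (iter k Tr x)) y.
    by apply: eq_bigr => j _; rewrite ipZl mulrC.
  by rewrite E'; congr (_ - _); rewrite mulrC /ratfun invf_div.
Qed.

Variable c : R.
Hypotheses (c_const : multicentric_const p q lambda rho c) (d_gt0 : (0 < d)%N).
Local Notation K := (\sum_(j < d) opnorm (T j)).

(** Weak convergence suffices, since it can be tested against F x itself. *)
Lemma hfc_bound (F : {linear V -> V}) x : is_hfc ip A phi F ->
  rnorm (F x) <= c * K * sup_on VR phi * rnorm x.
Proof.
move=> HF; pose t := rho / rho1; pose s := sup_on VR phi.
have t0 : 0 <= t by rewrite divr_ge0// ltW.
have t1 : t < 1 by rewrite ltr_pdivrMr// mul1r.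
have V0 : VR !=set0.
  exists (lambda (Ordinal d_gt0)); split=> //.
  by rewrite /ratfun (rootP (lambda_root _)) mul0r rnorm0.
have c0 : 0 <= c by exact: (multicentric_const_ge0 rho_ge0 c_const).
have K0 : 0 <= K by apply: sumr_ge0 => j _; apply: opnorm_ge0; exact: delta_op_continuous.
have [C C0 HC] := approximant_lemniscate size_p lambda_inj lambda_root size_q q_lambda
  rho_ge0 rho_lt m_gt0 phi_cont cauchy Gq G_large G_away.
pose FN N := \sum_(j < d) T j (pop Tr (appr N j) x).
have FN_le N : rnorm (FN N) <= K * (c * (s + C * t ^+ N)) * rnorm x.
  apply: (le_trans (ler_rnorm_sum _ _ _)); rewrite !mulr_suml; apply: ler_sum => j _.
  apply: (le_trans (le_opnorm _ (@delta_op_continuous j))); rewrite -mulrA.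
  apply: ler_wpM2l; first by apply: opnorm_ge0; exact: delta_op_continuous.
  apply: (von_neumann ip_norm rho_ge0 ratfun_op_le) => w wr.
  apply: (multicentric_poly rho_ge0 c_const j c0 V0 _ wr) => z Vz.
  rewrite -[X in rnorm X](subrK (phi z)) addrC; apply: (le_trans (ler_rnormD _ _)).
  by apply: lerD; [exact: (le_sup_lemniscate m_gt0 phi_cont cauchy G_away)|exact: HC].
have [D HD] := approximant_op x (F x) HF.
have [->|Fx] := eqVneq (F x) 0.
  by rewrite rnorm0 !mulr_ge0 ?rnorm_ge0 ?sup_on_ge0.
have Fx0 : 0 < rnorm (F x) by rewrite rnorm_gt0.
rewrite -(ler_pM2r Fx0).
apply: (@geometric_le _ _ _ (K * c * C * rnorm x * rnorm (F x) + D) t) => // N.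
have h1 : rnorm (F x) * rnorm (F x) <= rnorm (ip (FN N) (F x)) + D * t ^+ N.
  have -> : rnorm (F x) * rnorm (F x) = rnorm (ip (F x) (F x)).
    by rewrite (ip_rnorm ip_norm) rnormR ger0_norm ?expr2// mulr_ge0 ?rnorm_ge0.
  by rewrite addrC -lerBlDr; apply: le_trans (HD N); rewrite rdistC; exact: lerB_rnorm.
have h2 := le_trans (cauchy_schwarz ip_norm (FN N) (F x)) (ler_wpM2r (ltW Fx0) (FN_le N)).
apply: (le_trans h1); apply: (@le_trans _ _ (_ + D * t ^+ N)); first by rewrite lerD2r; exact: h2.
rewrite le_eqVlt; apply/orP; left; apply/eqP; rewrite -/s.
by move: (t ^+ N) => X; ring.
Qed.

End MulticentricOperator.

Theorem theorem5p2 (R : realType) (d : nat) (p q : {poly R[i]})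
    (lambda : 'I_d -> R[i])
    (size_p : size p = d.+1)
    (lambda_inj : injective lambda)
    (lambda_root : forall j, root p (lambda j))
    (q_neq0 : q != 0)
    (size_q : (size q <= d)%N)
    (q_lambda : forall j, q.[lambda j] != 0)
    (rho : R) (rho_ge0 : 0 <= rho)
    (no_crit : no_critical_point p q rho)
    (c : R) (c_const : multicentric_const p q lambda rho c)
    (V : completeNormedModType R[i]) (ip : {dot V for Num.conj})
    (ip_norm : forall x : V, ip x x = `|x| ^+ 2)
    (A : {linear V -> V}) (A_bounded : continuous A)
    (A_poles : forall z, spectrum A z -> q.[z] != 0)
    (rA_le : opnorm (hfc ip A (ratfun p q)) <= rho)
    (phi : R[i] -> R[i])
    (phi_hol : holomorphic_in (lemniscate p q rho) phi) :
  opnorm (hfc ip A phi) <=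
    (c * \sum_(j < d) opnorm (hfc ip A (delta p q (lambda j)))) *
    sup_on (lemniscate p q rho) phi.
Proof.
have [Q [Qc Q1 Q2]] := pop_inverse A_bounded q_neq0 A_poles.
have d0 : (0 < d)%N.
  by rewrite lt0n; apply: contraNneq q_neq0 => d0; rewrite -size_poly_leq0 -d0.
have c0 : 0 <= c by exact: (multicentric_const_ge0 rho_ge0 c_const).
have K0 : 0 <= c * (\sum_(j < d) opnorm (hfc ip A (delta p q (lambda j)))) *
    sup_on (lemniscate p q rho) phi.
  rewrite !mulr_ge0 ?sup_on_ge0//; apply: sumr_ge0 => j _; apply: opnorm_ge0.
  exact: (delta_op_continuous size_p lambda_inj lambda_root q_neq0 q_lambda ip_norm A_bounded A_poles Qc Q2).
apply: opnorm_le => // x.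
(* if nothing represents phi, the value chosen by default is the operator 0 *)
have [[F HF]|nF] := pselect (exists F, is_hfc ip A phi F); last first.
  have -> : hfc ip A phi = point by apply: getPN => F HF; apply: nF; exists F.
  by rewrite rnorm0 mulr_ge0 ?rnorm_ge0.
have {}HF : is_hfc ip A phi (hfc ip A phi) by exact: (getI HF).
have [U [Uo VU phiU]] := phi_hol.
have qp : (size q < size p)%N by rewrite size_p ltnS.
have [G [rho1 [m [[GU r1 m0] cauchy Gr Gm]]]] :=
  lemniscate_contour qp (num_at_pole size_p lambda_inj lambda_root q_lambda) rho_ge0 Uo VU.
exact: (hfc_bound size_p lambda_inj lambda_root q_neq0 size_q q_lambda ip_norm A_bounded A_poles Qc Q1 Q2
  rho_ge0 rA_le Uo phiU GU r1 m0 (cauchy _ phiU) (fun w Gw => (Gr w Gw).2) Gm c_const d0 x HF).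
Qed.
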